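(* Let $1 \leq p < \infty$, let $u\colon \mathbb{D} \to \mathbb{C}$ and $\phi\colon \mathbb{D}\to\mathbb{D}$ be analytic, and suppose that $uC_\phi$ is bounded $H^p \to H^p$ with $m(E_\phi) = 0$. If $uC_\phi$ is bounded below on an infinite-dimensional subspace $M \subset H^p$, then $M$ contains an isomorphic copy of $\ell^p$ (on which $uC_\phi$ is bounded below). In particular, if $p\neq 2$, then $uC_\phi$ does not fix any isomorphic copy of $\ell^2$ in $H^p$.
   Context: $\mathbb{D}$ is the open unit disc, $\mathbb{T}$ the unit circle with normalized Lebesgue measure $m$, and $H^p$ the classical Hardy space. The weighted composition operator is $(uC_\phi)f = u\cdot(f\circ\phi)$. The boundary contact set is $E_\phi = \{\zeta\in\mathbb{T} : |\phi(\zeta)|=1\}$, where $\phi(\zeta)$ denotes the radial limit (existing a.e.). An operator fixes a copy of a space $X$ if it is bounded below on some subspace isomorphic to $X$. *)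

(* Defs.v *)
(* Complex numbers are R[i] (mathcomp-real-closed)
   over an arbitrary realType R, viewed as a normed field over itself (^o),
   so that `derivable` below is *complex* differentiability. *)
From HB Require Import structures.
From mathcomp Require Import all_boot all_order all_algebra.
From mathcomp Require Import all_classical all_reals all_analysis.
From mathcomp Require Import complex.
Import Order.TTheory GRing.Theory Num.Theory.
Import numFieldTopology.Exports numFieldNormedType.Exports.

Set Implicit Arguments.
Unset Strict Implicit.
Unset Printing Implicit Defensive.

Local Open Scope classical_set_scope.
Local Open Scope ring_scope.

Section Hardy.
Variable R : realType.

Definition Cx : Type := (R[i])^o.

Definition cmod (z : Cx) : R :=
  Num.sqrt (complex.Re (z : R[i]) ^+ 2 + complex.Im (z : R[i]) ^+ 2).

Definition twopi : R := 2 * pi.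

Definition expi (t : R) : Cx := (Complex (cos t) (sin t) : R[i]).

Definition polar (r t : R) : Cx := ((r%:C)%C * (expi t : R[i]) : R[i]).

Definition in_disc (z : Cx) : Prop := cmod z < 1.

Definition analytic_on_disc (f : Cx -> Cx) : Prop :=
  forall z : Cx, in_disc z -> derivable f z 1.

(* equality of functions on D (elements of H^p are functions on D) *)
Definition eq_on_disc (f g : Cx -> Cx) : Prop :=
  forall z : Cx, in_disc z -> f z = g z.

(* integral means  M_p(f,r)^p = \int_T |f(r zeta)|^p dm(zeta),
   m = normalized Lebesgue measure on T, parametrized by t in [0, 2pi) *)
Definition Mp (p : R) (f : Cx -> Cx) (r : R) : \bar R :=
  ((twopi^-1)%:E *
   \int[@lebesgue_measure R]_(t in `[0%R, twopi[%classic) ((cmod (f (polar r t))) `^ p)%:E)%E.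

Definition in_Hp (p : R) (f : Cx -> Cx) : Prop :=
  analytic_on_disc f /\
  exists K : R, forall r : R, 0 <= r < 1 -> (Mp p f r <= K%:E)%E.

Definition Hp_norm (p : R) (f : Cx -> Cx) : R :=
  (fine (ereal_sup [set Mp p f r | r in `[0, 1[])) `^ p^-1.

Definition wcomp (u phi : Cx -> Cx) (f : Cx -> Cx) : Cx -> Cx :=
  fun z => u z * f (phi z).

Definition wcomp_bounded (p : R) (u phi : Cx -> Cx) : Prop :=
  exists K : R, forall f, in_Hp p f ->
    in_Hp p (wcomp u phi f) /\ Hp_norm p (wcomp u phi f) <= K * Hp_norm p f.

Definition contact_set (phi : Cx -> Cx) : set R :=
  [set t | 0 <= t < twopi /\
     exists l : Cx, (phi (polar r t) @[r --> at_left (1 : R)] --> l)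
                    /\ cmod l = 1].

Definition closed_subspace_Hp (p : R) (M : set (Cx -> Cx)) : Prop :=
  (forall f, M f -> in_Hp p f) /\
  M (fun _ => 0) /\
  (forall (a : Cx) f g, M f -> M g -> M (fun z => a * f z + g z)) /\
  (forall (fs : nat -> Cx -> Cx) (f : Cx -> Cx),
      (forall n, M (fs n)) -> in_Hp p f ->
      (fun n => Hp_norm p (fun z => fs n z - f z)) @ \oo --> (0 : R) ->
      M f).

Definition infinite_dim (M : set (Cx -> Cx)) : Prop :=
  forall n : nat, exists fs : 'I_n -> Cx -> Cx,
    (forall i, M (fs i)) /\
    (forall c : 'I_n -> Cx,
       eq_on_disc (fun z => \sum_(i < n) c i * fs i z) (fun _ => 0) ->
       forall i, c i = 0).

Definition bounded_below_on (p : R) (u phi : Cx -> Cx) (S : set (Cx -> Cx))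
  : Prop :=
  exists c : R, 0 < c /\
    forall f, S f -> c * Hp_norm p f <= Hp_norm p (wcomp u phi f).

Definition in_lq (q : R) (x : nat -> Cx) : Prop :=
  exists K : R, forall n : nat, \sum_(k < n) (cmod (x k)) `^ q <= K.

Definition lq_norm (q : R) (x : nat -> Cx) : R :=
  (fine (\sum_(k <oo) ((cmod (x k)) `^ q)%:E)%E) `^ q^-1.

(* T : l^q -> H^p is an isomorphic embedding with values in M
   (linear, bounded and bounded below); its range is then a closed
   subspace of M isomorphic to l^q *)
Definition lq_embedding_into (q p : R) (M : set (Cx -> Cx))
  (T : (nat -> Cx) -> (Cx -> Cx)) : Prop :=
  (forall x, in_lq q x -> M (T x)) /\
  (forall (a : Cx) x y, in_lq q x -> in_lq q y ->
     eq_on_disc (T (fun k => a * x k + y k)) (fun z => a * T x z + T y z)) /\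
  exists a b : R, 0 < a /\ 0 < b /\
    forall x, in_lq q x ->
      a * lq_norm q x <= Hp_norm p (T x) <= b * lq_norm q x.

Definition lq_range (q : R) (T : (nat -> Cx) -> (Cx -> Cx)) : set (Cx -> Cx) :=
  [set T x | x in in_lq q].

End Hardy.

(* Main.v *)
Require Import Defs.
From HB Require Import structures.
From mathcomp Require Import all_boot all_order all_algebra.
From mathcomp Require Import all_classical all_reals all_analysis.
From mathcomp Require Import complex measurable_realfun ring lra.

(* An infinite-dimensional [M] contains unit vectors vanishing on any prescribed finite set,
   hence unit vectors that are arbitrarily small on a given compact subset of the disc.  Let
   [B i] be the set of angles at which [|phi| > 1 - 1/(i+1)] on one of the circles of radius
   [1 - 1/(j+2)], [j >= i].  By Fatou's theorem for [phi], the [B i] decrease to the contact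
   set up to a null set, so their measures tend to [0].  If [f] is small on the disc of radius
   [1 - 1/(i+1)], then [g = u (f o phi)] is concentrated on [B i], and since [|g|^p] is
   uniformly integrable over circles, [g] has almost no mass on [B i'] for [i'] large.
   Iterating, one gets unit vectors [f_k] in [M] whose images live essentially on the disjoint
   sets [B i_k \ B i_(k+1)]; the images, and then the [f_k] themselves because [u C_phi] is
   bounded and bounded below on [M], are equivalent to the unit vector basis of [l^p].

   Applied to a copy of [l^2], this yields [x_k] in [l^2], of norms bounded above and below,
   with [||sum +-x_k||] comparable to [n^(1/p)] for all signs, [k < n].  By the parallelogram
   law some choice of signs makes this norm at most a multiple of [n^(1/2)] and another one at
   least such a multiple, so [p = 2].

   Boundary values of [H^p] functions are never used: all estimates are made on circles of
   radius [r < 1].  Uniform integrability on them comes from the inequality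
   [|f|^(p/2) <= P(|f|^(p/2))] for the Poisson operator [P] between two circles, together with
   the convergence of the means of [|f|^p] as [r] tends to [1]; the same [L^2] argument and the
   maximal inequality give Fatou's theorem. *)

Set Implicit Arguments.
Unset Strict Implicit.
Unset Printing Implicit Defensive.
Import Order.TTheory GRing.Theory Num.Theory.
Import numFieldTopology.Exports numFieldNormedType.Exports.
Local Open Scope classical_set_scope.
Local Open Scope ring_scope.

(** The exponent [p / 2] puts [|f|^(p/2)] in [L^2], where the Poisson operator is a positive
    self-adjoint contraction: a small drop of the mean of [|f|^p] between two circles then forces
    the functions on these circles to be close. The inequality is needed for exponents as low as
    [1/2], where the power is not convex. It is proved for [1/2] on polynomials, after reflecting
    the zeros out of the disc so that a holomorphic square root exists, then extended by
    approximation and raised to the power [p >= 1] by Jensen.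

    Minkowski's inequality is avoided: all estimates concern [p]-th powers of norms, subadditive up
    to the factor [2 ^ p]. Iterated along a sum, this costs [(2 ^ p) ^ (k + 1)] on the [k]-th term,
    which is why the humps are built with geometrically small errors.

    Cauchy's theory comes from Goursat's argument on rectangles in polar coordinates, whose arcs are
    directly the circle means of interest. Angles are real numbers in one period, so the maximal
    estimate is made on compact arcs exhausting it. *)

(** * Moduli of complex numbers and polar coordinates *)

Section Basics.
Context {R : realType}.
Local Notation C := R[i].
Implicit Types (z w : C).

Lemma cmodE (z : C) : ((cmod z)%:C)%C = `|z|.
Proof. by rewrite normc_def. Qed.

Lemma cmod_normc (z : C) : cmod z = Normc.normc z.
Proof. by case: z. Qed.

Lemma cmod_ge0 (z : C) : 0 <= cmod z.
Proof. exact: sqrtr_ge0. Qed.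

Lemma cmodM (z w : C) : cmod (z * w : C) = cmod z * cmod w.
Proof. by rewrite !cmod_normc Normc.normcM. Qed.

Lemma cmodV (z : C) : cmod (z^-1 : C) = (cmod z)^-1.
Proof. by rewrite !cmod_normc Normc.normcV. Qed.

Lemma cmodD (z w : C) : cmod (z + w : C) <= cmod z + cmod w.
Proof. rewrite !cmod_normc; exact: le_normcD. Qed.

Lemma cmodN (z : C) : cmod (- z : C) = cmod z.
Proof. by rewrite !cmod_normc normcN. Qed.

Lemma cmodB (z w : C) : cmod (z - w : C) = cmod (w - z : C).
Proof. by rewrite -cmodN opprB. Qed.

Lemma cmod0 : cmod (0 : C) = 0.
Proof. by rewrite cmod_normc Normc.normc0. Qed.

Lemma cmod1 : cmod (1 : C) = 1.
Proof. by rewrite cmod_normc Normc.normc1. Qed.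

Lemma cmod_eq0 (z : C) : (cmod z == 0) = (z == 0).
Proof.
apply/eqP/eqP => [|->]; last exact: cmod0.
by rewrite cmod_normc => /Normc.eq0_normc.
Qed.

Lemma cmod_gt0 (z : C) : (0 < cmod z) = (z != 0).
Proof. by rewrite lt_def cmod_ge0 andbT cmod_eq0. Qed.

Lemma cmodX (z : C) n : cmod (z ^+ n : C) = cmod z ^+ n.
Proof. by elim: n => [|n IH]; rewrite ?cmod1// !exprS cmodM IH. Qed.

Lemma cmod_real (x : R) : cmod ((x%:C)%C : C) = `|x|.
Proof. by rewrite /cmod /= expr0n addr0 sqrtr_sqr. Qed.

Lemma cmodJ (z : C) : cmod ((z^*)%C : C) = cmod z.
Proof. by case: z => a b; rewrite /cmod /= sqrrN. Qed.

Lemma sqr_cmod (z : C) : cmod z ^+ 2 = complex.Re z ^+ 2 + complex.Im z ^+ 2.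
Proof. by rewrite /cmod sqr_sqrtr// addr_ge0// sqr_ge0. Qed.

Lemma cmod_Re (z : C) : `|complex.Re z| <= cmod z.
Proof. by rewrite -sqrtr_sqr; apply: ler_wsqrtr; rewrite lerDl sqr_ge0. Qed.

Lemma cmod_Im (z : C) : `|complex.Im z| <= cmod z.
Proof. by rewrite -sqrtr_sqr; apply: ler_wsqrtr; rewrite lerDr sqr_ge0. Qed.

Lemma cmod_le_ReIm (z : C) : cmod z <= `|complex.Re z| + `|complex.Im z|.
Proof.
rewrite -(@ler_pXn2r _ 2)// ?nnegrE ?cmod_ge0 ?addr_ge0//.
rewrite sqr_cmod sqrrD !real_normK ?num_real// -addrA lerD2l lerDr.
by rewrite mulrn_wge0// mulr_ge0.
Qed.

Lemma cmod_sub_ge (z w : C) : cmod z - cmod w <= cmod (z - w : C).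
Proof. by rewrite lerBlDr (le_trans _ (cmodD _ _))// subrK. Qed.

Lemma cmod_distD (y z w : C) : cmod (z - w : C) <= cmod (z - y : C) + cmod (y - w : C).
Proof. by rewrite (le_trans _ (cmodD _ _))// addrA subrK. Qed.

Lemma cmod_dist_le (z w : C) : `|cmod z - cmod w| <= cmod (z - w : C).
Proof.
by rewrite ler_norml cmod_sub_ge andbT lerNl opprB cmodB cmod_sub_ge.
Qed.

Lemma cmod_sum (I : Type) (s : seq I) (Q : pred I) (F : I -> C) :
  cmod (\sum_(i <- s | Q i) F i : C) <= \sum_(i <- s | Q i) cmod (F i).
Proof.
elim/big_ind2 : _ => [|x y z w h1 h2|//]; first by rewrite cmod0.
by rewrite (le_trans (cmodD _ _))// lerD.
Qed.

Lemma cmod_expi (t : R) : cmod (expi t) = 1.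
Proof. by rewrite /cmod /= cos2Dsin2 sqrtr1. Qed.

Lemma expiD (s t : R) : expi (s + t) = (expi s : C) * expi t.
Proof.
rewrite /expi cosD sinD; simpc; congr (_ +i* _)%C.
by rewrite addrC.
Qed.

Lemma expi0 : expi (0 : R) = 1 :> C.
Proof. by rewrite /expi cos0 sin0. Qed.

Lemma expi2pi : expi (twopi R) = 1 :> C.
Proof. by rewrite /expi /twopi mulr_natl cos2pi sin2pi. Qed.

Lemma polarE (r t : R) : polar r t = (r%:C)%C * (expi t : C).
Proof. by []. Qed.

Lemma cmod_polar (r t : R) : cmod (polar r t) = `|r|.
Proof. by rewrite polarE cmodM cmod_real cmod_expi mulr1. Qed.

Lemma dist_sin (s t : R) : `|sin s - sin t| <= `|s - t|.
Proof.
wlog st : s t / s <= t => [H|].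
  by case: (leP s t) => [/H//|/ltW/H]; rewrite distrC [X in _ <= X]distrC.
move: st; rewrite le_eqVlt => /predU1P[->|st]; first by rewrite !subrr.
have [x _ H] : exists2 x, x \in `]s, t[%R & sin t - sin s = cos x * (t - s).
  by apply: MVT => //; apply: continuous_subspaceT => ?; exact: continuous_sin.
rewrite distrC H normrM [X in _ <= X]distrC ler_piMl// cos_max//.
Qed.

Lemma dist_cos (s t : R) : `|cos s - cos t| <= `|s - t|.
Proof.
rewrite -!sinDpihalf (le_trans (dist_sin _ _))//.
by rewrite opprD addrACA subrr addr0.
Qed.

Lemma dist_expi (s t : R) : cmod ((expi s : C) - expi t : C) <= 2 * `|s - t|.
Proof.
apply: (le_trans (cmod_le_ReIm _)); rewrite /= mulr_natl mulr2n.
by apply: lerD; [exact: dist_cos|exact: dist_sin].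
Qed.

Lemma dist_polar (r s t u : R) :
  cmod ((polar r s : C) - polar t u : C) <= `|r - t| + 2 * `|t| * `|s - u|.
Proof.
have -> : (polar r s : C) - polar t u =
   ((r - t)%:C)%C * (expi s : C) + (t%:C)%C * ((expi s : C) - expi u).
  by rewrite !polarE rmorphB /=; ring.
apply: (le_trans (cmodD _ _)); rewrite !cmodM !cmod_real cmod_expi mulr1 lerD2l.
by rewrite -mulrA mulrCA ler_wpM2l// dist_expi.
Qed.

End Basics.

(** * Complex differentiability with real tolerances *)

Section Differentiability.
Context {R : realType}.
Local Notation C := R[i].

(** Without quotients both sides vanish at [w = z], so that full neighbourhoods can be used instead
    of punctured ones. *)
Definition cdiff (f : C -> C) (z d : C) : Prop :=
  forall e : R, 0 < e -> exists2 r : R, 0 < r & forall w : C,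
    cmod (w - z : C) < r -> cmod (f w - f z - d * (w - z) : C) <= e * cmod (w - z : C).

Definition ccont (f : C -> C) (z : C) : Prop :=
  forall e : R, 0 < e -> exists2 r : R, 0 < r & forall w : C,
    cmod (w - z : C) < r -> cmod (f w - f z : C) <= e.

Lemma realC_gt0 (e : R) : (0 < (e%:C)%C :> C) = (0 < e).
Proof. by rewrite ltcR. Qed.

Lemma Cgt0 (e : C) : 0 < e -> exists2 x : R, 0 < x & e = (x%:C)%C.
Proof.
case: e => a b; rewrite ltcE /= => /andP[/eqP -> a0]; by exists a.
Qed.

Lemma ltC_cmod (z : C) (e : R) : (`|z| < (e%:C)%C) = (cmod z < e).
Proof. by rewrite -cmodE ltcR. Qed.

Lemma leC_cmod (z : C) (e : R) : (`|z| <= (e%:C)%C) = (cmod z <= e).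
Proof. by rewrite -cmodE lecR. Qed.

(** Bridge from the statement to [cdiff]. A ball of [C] has a complex radius, and positivity of a
    complex number forces it to be real: this is how [Cgt0] extracts real tolerances. *)
Lemma derivable_cdiff (f : C -> C) (z : C) :
  derivable (f : C^o -> C^o) z 1 <-> exists d, cdiff f z d.
Proof.
split.
- move=> df; exists ('D_1 (f : C^o -> C^o) z) => e e0.
  have /cvgrPdist_le/(_ ((e%:C)%C)) := df; rewrite realC_gt0 => /(_ e0).
  rewrite near_withinE near_simpl => /nbhs_ballP[r0 /= /Cgt0[r r0' ->]] H.
  exists r => // w wr.
  have [->|wz] := eqVneq w z.
    by rewrite !subrr mulr0 subr0 cmod0 mulr0.
  have wz0 : w - z != 0 by rewrite subr_eq0.
  have := H (w - z); rewrite -ball_normE /= sub0r normrN ltC_cmod => /(_ wr wz0).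
  rewrite /GRing.scale /= mulr1 subrK leC_cmod => h.
  have -> : f w - f z - 'D_1 (f : C^o -> C^o) z * (w - z) =
     - ((w - z) * ('D_1 (f : C^o -> C^o) z - (w - z)^-1 * (f w - f z))) :> C.
    by field.
  by rewrite cmodN cmodM mulrC ler_wpM2r// cmod_ge0.
- case=> d H; apply/cvg_ex; exists d; apply/cvgrPdist_le => _ /Cgt0[e e0 ->].
  rewrite near_withinE near_simpl; have [r r0 Hr] := H e e0.
  apply/nbhs_ballP; exists ((r%:C)%C) => /=; first by rewrite realC_gt0.
  move=> h; rewrite -ball_normE /= sub0r normrN ltC_cmod => hr h0.
  rewrite /GRing.scale /= mulr1 leC_cmod.
  have := Hr (h + z); rewrite addrK => /(_ hr) h1.
  have -> : d - h^-1 * (f (h + z) - f z) = - (h^-1 * (f (h + z) - f z - d * h)) :> C.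
    by field.
  rewrite cmodN cmodM cmodV mulrC ler_pdivrMr ?cmod_gt0//.
Qed.

Lemma cdiff_ccont f z d : cdiff f z d -> ccont f z.
Proof.
move=> H e e0; have [r r0 Hr] := H 1 ltr01.
have k0 : 0 < 1 + cmod d by rewrite ltr_pwDl// cmod_ge0.
exists (Order.min r (e / (1 + cmod d))) => [|w].
  by rewrite lt_min r0 divr_gt0.
rewrite lt_min => /andP[/Hr h1 h2].
have -> : f w - f z = (f w - f z - d * (w - z)) + d * (w - z) :> C by ring.
apply: (le_trans (cmodD _ _)); rewrite cmodM.
rewrite (le_trans (lerD h1 (lexx _)))// -mulrDl mulrC -ler_pdivlMr//.
exact: ltW.
Qed.

Lemma ccontD f g z : ccont f z -> ccont g z -> ccont (fun w => f w + g w) z.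
Proof.
move=> cf cg e e0; have e2 : 0 < e / 2 by rewrite divr_gt0.
have [r r0 Hr] := cf _ e2; have [s s0 Hs] := cg _ e2.
exists (Order.min r s) => [|w]; first by rewrite lt_min r0.
rewrite lt_min => /andP[/Hr h1 /Hs h2].
rewrite opprD addrACA (le_trans (cmodD _ _))// (splitr e) lerD//.
Qed.

Lemma ccontM f g z : ccont f z -> ccont g z -> ccont (fun w => f w * g w) z.
Proof.
move=> cf cg e e0.
pose A := 1 + cmod (f z) + cmod (g z).
have A0 : 0 < A by rewrite /A -addrA ltr_pwDl// addr_ge0// cmod_ge0.
pose e1 := Order.min 1 (e / (2 * A)).
have e10 : 0 < e1 by rewrite lt_min ltr01 divr_gt0// mulr_gt0.
have [r r0 Hr] := cf _ e10; have [s s0 Hs] := cg _ e10.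
exists (Order.min r s) => [|w]; first by rewrite lt_min r0.
rewrite lt_min => /andP[/Hr h1 /Hs h2].
have -> : f w * g w - f z * g z = (f w - f z) * (g w - g z)
   + (f w - f z) * g z + f z * (g w - g z) :> C by ring.
apply: (le_trans (cmodD _ _)); apply: (le_trans (lerD (cmodD _ _) (lexx _))).
rewrite !cmodM.
have e1e : e1 * (2 * A) <= e.
  by rewrite -ler_pdivlMr ?mulr_gt0// ge_min lexx orbT.
have e11 : e1 <= 1 by rewrite ge_min lexx.
apply: le_trans e1e; rewrite /A.
have := cmod_ge0 (f z); have := cmod_ge0 (g z).
have := cmod_ge0 (f w - f z); have := cmod_ge0 (g w - g z).
move: (cmod (f w - f z)) (cmod (g w - g z)) (cmod (f z)) (cmod (g z)) h1 h2.
move=> a b c d; nra.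
Qed.

Lemma ccont_cst (c : C) z : ccont (fun=> c) z.
Proof. by move=> e e0; exists 1 => // w _; rewrite subrr cmod0 ltW. Qed.

Lemma ccont_id z : ccont id z.
Proof. by move=> e e0; exists e => // w /ltW. Qed.

Lemma ccontV f z : ccont f z -> f z != 0 -> ccont (fun w => (f w)^-1) z.
Proof.
move=> cf fz e e0.
have m0 : 0 < cmod (f z) by rewrite cmod_gt0.
pose e1 := Order.min (cmod (f z) / 2) (e * (cmod (f z) ^+ 2) / 2).
have e10 : 0 < e1.
  by rewrite lt_min !divr_gt0// ?mulr_gt0// exprn_gt0.
have [r r0 Hr] := cf _ e10; exists r => // w /Hr.
rewrite le_min => /andP[h1 h2].
have h3 : cmod (f z) / 2 <= cmod (f w).
  have := cmod_sub_ge (f z) (f w); rewrite cmodB; lra.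
have fw : f w != 0 by rewrite -cmod_gt0 (lt_le_trans _ h3)// divr_gt0.
have -> : (f w)^-1 - (f z)^-1 = - (f w - f z) / (f w * f z) :> C by field; rewrite fw fz.
rewrite cmodM cmodV cmodN cmodM ler_pdivrMr ?mulr_gt0 ?cmod_gt0//.
apply: (le_trans h2).
rewrite -mulrA ler_wpM2l ?(ltW e0)// expr2 -mulrA mulrC ler_wpM2r ?cmod_ge0//.
Qed.

Definition holo (f : C -> C) (z : C) := exists d, cdiff f z d.

Lemma holo_near_eq (f g : C -> C) (z : C) (r : R) : 0 < r ->
  (forall w, cmod (w - z : C) < r -> f w = g w) -> holo f z -> holo g z.
Proof.
move=> r0 fg [d df]; exists d => e e0.
have [s s0 Hs] := df e e0; exists (Order.min r s) => [|w].
  by rewrite lt_min r0.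
rewrite lt_min => /andP[wr /Hs]; rewrite !fg//.
by rewrite subrr cmod0.
Qed.

Lemma holo_ccont f z : holo f z -> ccont f z.
Proof. by case=> d; exact: cdiff_ccont. Qed.

(* Caratheodory's criterion: the difference quotient extends continuously. *)
Lemma holoP (f : C -> C) (z : C) : holo f z <->
  exists q : C -> C, ccont q z /\ exists2 r : R, 0 < r &
    forall w, cmod (w - z : C) < r -> f w = f z + q w * (w - z).
Proof.
split.
- case=> d df; exists (fun w => if w == z then d else (f w - f z) / (w - z)); split.
    move=> e e0; have [r r0 Hr] := df e e0; exists r => // w wr; rewrite eqxx.
    have [_|wz] := eqVneq w z; first by rewrite subrr cmod0 ltW.
    have wz0 : w - z != 0 by rewrite subr_eq0.
    have -> : (f w - f z) / (w - z) - d = (f w - f z - d * (w - z)) / (w - z) :> C by field.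
    by rewrite cmodM cmodV ler_pdivrMr ?cmod_gt0// Hr.
  exists 1 => // w _; have [->|wz] := eqVneq w z; first by rewrite subrr mulr0 addr0.
  by rewrite divfK ?subr_eq0// addrC subrK.
- case=> q [cq [r r0 Hq]]; exists (q z) => e e0; have [s s0 Hs] := cq e e0.
  exists (Order.min r s) => [|w]; first by rewrite lt_min r0.
  rewrite lt_min => /andP[/Hq -> /Hs h].
  have -> : f z + q w * (w - z) - f z - q z * (w - z) = (q w - q z) * (w - z) :> C by ring.
  by rewrite cmodM ler_wpM2r// cmod_ge0.
Qed.

Lemma ccont_comp (f g : C -> C) (z : C) :
  ccont f z -> ccont g (f z) -> ccont (fun w => g (f w)) z.
Proof.
move=> cf cg e e0; have [s s0 Hs] := cg e e0.
have [r r0 Hr] := cf (s / 2) (divr_gt0 s0 (ltr0n _ 2)).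
exists r => // w /Hr h; apply: Hs; rewrite (le_lt_trans h)//.
by rewrite ltr_pdivrMr// ltr_pMr// ltr1n.
Qed.

Lemma holo_cst (c z : C) : holo (fun=> c) z.
Proof.
apply/holoP; exists (fun=> 0); split; first exact: ccont_cst.
by exists 1 => // w _; rewrite mul0r addr0.
Qed.

Lemma holo_id (z : C) : holo id z.
Proof.
apply/holoP; exists (fun=> 1); split; first exact: ccont_cst.
by exists 1 => // w _; rewrite mul1r addrC subrK.
Qed.

Lemma holoM (f g : C -> C) (z : C) : holo f z -> holo g z -> holo (fun w => f w * g w) z.
Proof.
move=> hf hg; have cg := holo_ccont hg.
move: hf hg => /holoP[p [cp [r r0 Hp]]] /holoP[q [cq [s s0 Hq]]]; apply/holoP.
exists (fun w => p w * g w + f z * q w); split.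
  by apply: ccontD; apply: ccontM => //; exact: ccont_cst.
exists (Order.min r s) => [|w]; first by rewrite lt_min r0.
by rewrite lt_min => /andP[/Hp -> /Hq ->]; ring.
Qed.

Lemma holoD (f g : C -> C) (z : C) : holo f z -> holo g z -> holo (fun w => f w + g w) z.
Proof.
move=> /holoP[p [cp [r r0 Hp]]] /holoP[q [cq [s s0 Hq]]]; apply/holoP.
exists (fun w => p w + q w); split; first exact: ccontD.
exists (Order.min r s) => [|w]; first by rewrite lt_min r0.
by rewrite lt_min => /andP[/Hp -> /Hq ->]; ring.
Qed.

Lemma holoZ (c : C) (f : C -> C) (z : C) : holo f z -> holo (fun w => c * f w) z.
Proof. exact: holoM (holo_cst c z). Qed.

Lemma holoB (f g : C -> C) (z : C) : holo f z -> holo g z -> holo (fun w => f w - g w) z.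
Proof.
move=> df dg; apply: (holo_near_eq ltr01 _ (holoD df (holoZ (-1) dg))) => w _.
by rewrite mulN1r.
Qed.

Lemma holoV (f : C -> C) (z : C) : f z != 0 -> holo f z -> holo (fun w => (f w)^-1) z.
Proof.
move=> fz hf; have cf := holo_ccont hf.
move: hf => /holoP[p [cp [r r0 Hp]]]; apply/holoP.
have fz0 : 0 < cmod (f z) by rewrite cmod_gt0.
have [s s0 Hs] := cf (cmod (f z) / 2) (divr_gt0 fz0 (ltr0n _ 2)).
exists (fun w => - p w * (f w)^-1 * (f z)^-1); split.
  apply: ccontM; last exact: ccont_cst.
  apply: ccontM; last exact: ccontV.
  move=> e /cp[t t0 Ht]; exists t => // w /Ht.
  by rewrite -opprD cmodN.
exists (Order.min r s) => [|w]; first by rewrite lt_min r0.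
rewrite lt_min => /andP[/Hp h /Hs h'].
have fw : f w != 0.
  apply: contraTneq h' => ->; rewrite sub0r cmodN -ltNge ltr_pdivrMr//.
  by rewrite ltr_pMr// ltr1n.
have E : p w * (w - z) = f w - f z by rewrite h; ring.
have -> : - p w / f w / f z * (w - z) = - (p w * (w - z)) / f w / f z :> C by ring.
by rewrite E; field; rewrite fw fz.
Qed.

Lemma holo_comp (f g : C -> C) (z : C) :
  holo f z -> holo g (f z) -> holo (fun w => g (f w)) z.
Proof.
move=> hf; have cf := holo_ccont hf.
move: hf => /holoP[p [cp [r r0 Hp]]] /holoP[q [cq [s s0 Hq]]]; apply/holoP.
exists (fun w => q (f w) * p w); split; first by apply: ccontM => //; exact: ccont_comp.
have [t t0 Ht] := cf (s / 2) (divr_gt0 s0 (ltr0n _ 2)).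
exists (Order.min r t) => [|w]; first by rewrite lt_min r0.
rewrite lt_min => /andP[/Hp h /Ht h'].
rewrite Hq; last by rewrite (le_lt_trans h')// ltr_pdivrMr// ltr_pMr// ltr1n.
by rewrite {2}h; ring.
Qed.

Lemma holo_sum (I : Type) (s : seq I) (f : I -> C -> C) (z : C) :
  (forall i, holo (f i) z) -> holo (fun w => \sum_(i <- s) f i w) z.
Proof.
move=> df; elim: s => [|i s IH].
  by apply: (holo_near_eq ltr01 _ (holo_cst 0 z)) => w _; rewrite big_nil.
by apply: (holo_near_eq ltr01 _ (holoD (df i) IH)) => w _; rewrite big_cons.
Qed.

Lemma holo_prod (I : Type) (s : seq I) (f : I -> C -> C) (z : C) :
  (forall i, holo (f i) z) -> holo (fun w => \prod_(i <- s) f i w) z.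
Proof.
move=> df; elim: s => [|i s IH].
  by apply: (holo_near_eq ltr01 _ (holo_cst 1 z)) => w _; rewrite big_nil.
by apply: (holo_near_eq ltr01 _ (holoM (df i) IH)) => w _; rewrite big_cons.
Qed.

Lemma holoX (f : C -> C) (z : C) n : holo f z -> holo (fun w => f w ^+ n) z.
Proof.
move=> df; elim: n => [|n IH]; first exact: (holo_cst 1).
by apply: (holo_near_eq ltr01 _ (holoM df IH)) => w _; rewrite exprS.
Qed.

End Differentiability.

(** * A subdivision principle for rectangles *)

Section Quartering.
Context {R : realType}.

Lemma bisection_limit (a b : nat -> R) (L : R) : 0 <= L ->
  (forall n, a n <= a n.+1) -> (forall n, b n.+1 <= b n) ->
  (forall n, b n - a n = L / 2 ^+ n) ->
  exists x, (forall n, a n <= x <= b n) /\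
    (forall e, 0 < e -> exists n, b n - a n < e).
Proof.
move=> L0 ha hb hab.
have ab n : a n <= b n.
  by rewrite -subr_ge0 hab divr_ge0// exprn_ge0.
have ha' : {homo a : m n / (m <= n)%N >-> m <= n}.
  by apply: homo_leq => //; exact: le_trans.
have hb' n m : (n <= m)%N -> b m <= b n.
  by move=> /subnK <-; elim: (m - n)%N => // k IH; rewrite addSn (le_trans (hb _)).
have amb n m : a n <= b m.
  have [nm|/ltnW mn] := leqP n m; first by rewrite (le_trans (ha' _ _ nm)).
  by rewrite (le_trans (ab _))// hb'.
exists (sup (range a)); split.
  move=> n; apply/andP; split.
    apply: ub_le_sup; last by exists n.
    by exists (b 0) => _ [k _ <-].
  apply: ge_sup; first by exists (a 0), 0%N.
  by move=> _ [k _ <-].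
move=> e e0.
exists (Num.bound (L / e)); rewrite hab ltr_pdivrMr ?exprn_gt0//.
rewrite mulrC -ltr_pdivrMr//.
rewrite (lt_le_trans (archi_boundP (divr_ge0 L0 (ltW e0))))//.
by rewrite -natrX ler_nat ltnW// ltn_expl.
Qed.

(* A two-dimensional Cousin lemma, proved by bisection. *)
Lemma quartering (P : R -> R -> R -> R -> Prop) (a b c d : R) : a <= b -> c <= d ->
  (forall a b c d, let m := (a + b) / 2 in let n := (c + d) / 2 in
     a <= b -> c <= d ->
     P a m c n -> P m b c n -> P a m n d -> P m b n d -> P a b c d) ->
  (forall x y, a <= x <= b -> c <= y <= d -> exists2 r, 0 < r &
     forall a' b' c' d', a <= a' -> a' <= x <= b' -> b' <= b ->
       c <= c' -> c' <= y <= d' -> d' <= d ->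
       b' - a' < r -> d' - c' < r -> P a' b' c' d') ->
  P a b c d.
Proof.
move=> ab cd Hsplit Hloc; apply: contrapT => nP.
pose mid (u v : R) := (u + v) / 2.
pose Q := ((R * R) * (R * R))%type.
pose bad (q : Q) := ~ P q.1.1 q.1.2 q.2.1 q.2.2.
pose ok (q : Q) := q.1.1 <= q.1.2 /\ q.2.1 <= q.2.2.
pose half (u v u' v' : R) := (u' = u /\ v' = mid u v) \/ (u' = mid u v /\ v' = v).
(* The assumptions on [q] stand under the existential so that [choice] yields a successor defined on
   all quadruples. *)
have step (q : Q) : exists q' : Q, ok q -> bad q -> bad q' /\
    half q.1.1 q.1.2 q'.1.1 q'.1.2 /\ half q.2.1 q.2.2 q'.2.1 q'.2.2.
  case: q => [[u v] [s t]]; rewrite /bad /ok /half /=.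
  apply: contrapT => /forallNP H.
  have G u' v' s' t' : half u v u' v' -> half s t s' t' -> P u' v' s' t'.
    move=> h1 h2; apply: contrapT => np; apply: (H ((u', v'), (s', t'))) => _ _ /=.
    by split.
  apply: (H ((u, v), (s, t))) => /= -[uv st] np; exfalso; apply: np.
  by apply: Hsplit => //; apply: G; rewrite /half /mid; tauto.
have [F HF] := choice step.
pose q n := iter n F ((a, b), (c, d)).
have half_le u v u' v' : u <= v -> half u v u' v' ->
    [/\ u <= u', v' <= v, u' <= v' & v' - u' = (v - u) / 2].
  by move=> uv [[-> ->]|[-> ->]]; rewrite /mid; split; lra.
have inv n : ok (q n) /\ bad (q n).
  elim: n => [|n [ok_n bad_n]]; first by split.
  have [b1 [h1 h2]] := HF (q n) ok_n bad_n.
  case: ok_n => o1 o2.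
  have [? ? ? ?] := half_le _ _ _ _ o1 h1.
  by have [? ? ? ?] := half_le _ _ _ _ o2 h2.
have stp n : half (q n).1.1 (q n).1.2 (q n.+1).1.1 (q n.+1).1.2 /\
    half (q n).2.1 (q n).2.2 (q n.+1).2.1 (q n.+1).2.2.
  by have [okn b1] := inv n; have [_ []] := HF (q n) okn b1.
have H1 n := half_le _ _ _ _ (inv n).1.1 (stp n).1.
have H2 n := half_le _ _ _ _ (inv n).1.2 (stp n).2.
have L1 n : (q n).1.2 - (q n).1.1 = (b - a) / 2 ^+ n.
  elim: n => [|n IH]; first by rewrite expr0 divr1.
  by have [_ _ _ ->] := H1 n; rewrite IH exprS invfM; ring.
have L2 n : (q n).2.2 - (q n).2.1 = (d - c) / 2 ^+ n.
  elim: n => [|n IH]; first by rewrite expr0 divr1.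
  by have [_ _ _ ->] := H2 n; rewrite IH exprS invfM; ring.
have [x [Hx Sx]] := @bisection_limit (fun n => (q n).1.1) (fun n => (q n).1.2) (b - a)
  ltac:(by rewrite subr_ge0) ltac:(by move=> n; case: (H1 n)) ltac:(by move=> n; case: (H1 n)) L1.
have [y [Hy Sy]] := @bisection_limit (fun n => (q n).2.1) (fun n => (q n).2.2) (d - c)
  ltac:(by rewrite subr_ge0) ltac:(by move=> n; case: (H2 n)) ltac:(by move=> n; case: (H2 n)) L2.
have [r r0 Hr] := Hloc x y (Hx 0%N) (Hy 0%N).
have mono n : [/\ a <= (q n).1.1, (q n).1.2 <= b, c <= (q n).2.1 & (q n).2.2 <= d].
  elim: n => [|n [h1 h2 h3 h4]]; first by [].
  have [? ? _ _] := H1 n; have [? ? _ _] := H2 n.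
  by split; [apply: le_trans h1 _|apply: le_trans h2|apply: le_trans h3 _|apply: le_trans h4].
have [n1 Hn1] := Sx _ r0; have [n2 Hn2] := Sy _ r0.
pose n := maxn n1 n2.
have le_exp (L : R) k l : 0 <= L -> (k <= l)%N -> L / 2 ^+ l <= L / 2 ^+ k.
  move=> L0 kl; apply: ler_wpM2l => //.
  by rewrite lef_pV2 ?posrE ?exprn_gt0// ler_eXn2l// ltr1n.
have [m1 m2 m3 m4] := mono n.
apply: (inv n).2; apply: Hr => //.
- by apply: le_lt_trans Hn1; rewrite !L1; apply: le_exp; rewrite ?subr_ge0// leq_maxl.
- by apply: le_lt_trans Hn2; rewrite !L2; apply: le_exp; rewrite ?subr_ge0// leq_maxr.
Qed.

End Quartering.

(** * Compactness of closed annuli and discs *)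

Section Compactness.
Context {R : realType}.
Local Notation C := R[i].

(** Compactness as an induction principle: each use names an ideal of sets to which every point
    contributes a neighbourhood, and no finite covers have to be manipulated. Taking [ra = 0] gives
    closed discs. *)
Lemma annulus_ind (ra rb : R) (P : (C -> Prop) -> Prop) :
  P (fun _ => False) ->
  (forall A B, P A -> P B -> P (fun z => A z \/ B z)) ->
  (forall A B : C -> Prop, (forall z, A z -> B z) -> P B -> P A) ->
  (forall z : C, ra <= cmod z <= rb -> exists2 r, 0 < r & P (fun w => cmod (w - z : C) < r)) ->
  P (fun z => ra <= cmod z <= rb).
Proof.
move=> P0 PU PS Ploc.
have [rb0|rb0] := ltP rb 0.
  apply: PS P0 => z /andP[_ zb].
  by have := le_trans (cmod_ge0 z) zb; rewrite leNgt rb0.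
pose S (z : C) := ra <= cmod z <= rb.
pose box (a b c d : R) (z : C) := [/\ S z, a <= complex.Re z <= b & c <= complex.Im z <= d].
suff H : P (box (- rb) rb (- rb) rb).
  apply: PS H => z Sz; split => //; rewrite -ler_norml.
    by rewrite (le_trans (cmod_Re _))//; case/andP: Sz.
  by rewrite (le_trans (cmod_Im _))//; case/andP: Sz.
apply: (quartering (P := fun a b c d => P (box a b c d))).
- by rewrite lerNl (le_trans _ rb0)// oppr_le0.
- by rewrite lerNl (le_trans _ rb0)// oppr_le0.
- move=> a b c d m n _ _ h1 h2 h3 h4.
  apply: PS (PU _ _ (PU _ _ h1 h2) (PU _ _ h3 h4)) => z [Sz /andP[z1 z2] /andP[z3 z4]].
  rewrite /box z1 z2 z3 z4.
  by case: (leP (complex.Re z) m) => hm; case: (leP (complex.Im z) n) => hn;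
    rewrite ?(ltW hm) ?(ltW hn);
    [left; left|right; left|left; right|right; right]; split => //; rewrite ?hm ?hn.
- move=> x y xab ycd; pose z := (Complex x y : C).
  have near (r : R) : 0 < r -> forall a' b' c' d' (w : C), a' <= x <= b' -> c' <= y <= d' ->
      b' - a' < r / 2 -> d' - c' < r / 2 -> box a' b' c' d' w -> cmod (w - z : C) < r.
    move=> r0 a' b' c' d' w x1 y1 l1 l2 [_ w1 w2].
    apply: (le_lt_trans (cmod_le_ReIm _)).
    case: w w1 w2 => p q /= w1 w2.
    have : `|p - x| <= b' - a' by rewrite ler_norml; lra.
    have : `|q - y| <= d' - c' by rewrite ler_norml; lra.
    lra.
  have [Sz|nSz] := boolP (ra <= cmod z <= rb).
    have [r r0 Pr] := Ploc z Sz; exists (r / 2) => [|a' b' c' d' *]; first by rewrite divr_gt0.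
    by apply: PS Pr => w; apply: near => //.
  (* The bisected square is larger than the annulus; a small box about a point off the annulus
     misses it and falls under the case of the empty set. *)
  have [r r0 Hr] : exists2 r, 0 < r & forall w : C, cmod (w - z : C) < r -> ~ S w.
    move: nSz; rewrite negb_and -!ltNge => /orP[h|h].
      exists (ra - cmod z); first by rewrite subr_gt0.
      by move=> w hw; rewrite /S => /andP[h1 _]; have := cmod_sub_ge w z; lra.
    exists (cmod z - rb); first by rewrite subr_gt0.
    by move=> w hw; rewrite /S => /andP[_ h1]; have := cmod_sub_ge z w; rewrite cmodB; lra.
  exists (r / 2) => [|a' b' c' d' *]; first by rewrite divr_gt0.
  apply: PS P0 => w bw; apply: (Hr w _ (let: And3 h _ _ := bw in h)).
  by apply: near bw.
Qed.

Lemma annulus_bounded (ra rb : R) (f : C -> C) :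
  (forall z : C, ra <= cmod z <= rb -> ccont f z) ->
  exists2 K, 0 <= K & forall z : C, ra <= cmod z <= rb -> cmod (f z) <= K.
Proof.
move=> cf.
apply: (@annulus_ind ra rb (fun A => exists2 K, 0 <= K & forall z, A z -> cmod (f z) <= K)).
- by exists 0.
- move=> A B [K K0 HK] [L L0 HL]; exists (Order.max K L); first by rewrite le_max K0.
  by move=> z [/HK|/HL] h; rewrite le_max h ?orbT.
- by move=> A B AB [K K0 HK]; exists K => // z /AB/HK.
- move=> z /cf/(_ 1 ltr01)[r r0 Hr]; exists r => //.
  exists (1 + cmod (f z)); first by rewrite addr_ge0// cmod_ge0.
  by move=> w /Hr h; rewrite -lerBlDr (le_trans (cmod_sub_ge _ _)).
Qed.

Lemma annulus_unif_cont (ra rb : R) (f : C -> C) :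
  (forall z : C, ra <= cmod z <= rb -> ccont f z) ->
  forall e : R, 0 < e -> exists2 r, 0 < r &
    forall z w : C, ra <= cmod z <= rb -> cmod (w - z : C) < r -> cmod (f w - f z : C) <= e.
Proof.
move=> cf e e0.
apply: (@annulus_ind ra rb (fun A => exists2 r, 0 < r &
    forall z w : C, A z -> cmod (w - z : C) < r -> cmod (f w - f z : C) <= e)).
- by exists 1.
- move=> A B [r r0 Hr] [s s0 Hs]; exists (Order.min r s); first by rewrite lt_min r0.
  by move=> z w [Az|Bz]; rewrite lt_min => /andP[h1 h2]; [apply: Hr|apply: Hs].
- by move=> A B AB [r r0 Hr]; exists r => // z w /AB; exact: Hr.
- move=> z /cf/(_ (e / 2) (divr_gt0 e0 (ltr0n _ 2)))[r r0 Hr].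
  exists (r / 2); first by rewrite divr_gt0.
  exists (r / 2); first by rewrite divr_gt0.
  move=> x w xz wx; rewrite (le_trans (cmod_distD (f z) _ _))//.
  rewrite (splitr e) lerD//.
    by apply: Hr; rewrite (le_lt_trans (cmod_distD x _ _))// (splitr r) ltrD.
  rewrite cmodB; apply: Hr; lra.
Qed.

End Compactness.

(** * Means of bounded functions over one period *)

Section Mean.
Context {R : realType}.
Local Notation C := R[i].
Local Notation mu := (@lebesgue_measure R).

Lemma twopi_gt0 : 0 < twopi R.
Proof. by rewrite mulr_gt0// pi_gt0. Qed.

Definition circ := @uniform_prob R 0 (twopi R) twopi_gt0.

HB.instance Definition _ := Measure.on circ.
HB.instance Definition _ := Probability.on circ.

Definition mean (f : R -> R) : R := (\int[circ]_t f t)%R.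

(** The class of integrands for all means: it is stable under algebraic operations and integrable
    for every finite measure, so integrability conditions reduce to closure properties. *)
Definition bmeas d (T : measurableType d) (f : T -> R) : Prop :=
  measurable_fun setT f /\ exists K, forall t, `|f t| <= K.

Lemma bmeas_cst d (T : measurableType d) (c : R) : bmeas (fun _ : T => c).
Proof. by split => //; exists `|c|. Qed.

Lemma bmeasD d (T : measurableType d) (f g : T -> R) :
  bmeas f -> bmeas g -> bmeas (fun t => f t + g t).
Proof.
move=> [mf [K HK]] [mg [L HL]]; split; first exact: measurable_funD.
by exists (K + L) => t; rewrite (le_trans (ler_normD _ _))// lerD.
Qed.

Lemma bmeasM d (T : measurableType d) (f g : T -> R) :
  bmeas f -> bmeas g -> bmeas (fun t => f t * g t).
Proof.
move=> [mf [K HK]] [mg [L HL]]; split; first exact: measurable_funM.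
by exists (K * L) => t; rewrite normrM ler_pM.
Qed.

Lemma bmeasN d (T : measurableType d) (f : T -> R) : bmeas f -> bmeas (fun t => - f t).
Proof.
move=> [mf [K HK]]; split; first exact: measurableT_comp.
by exists K => t; rewrite normrN.
Qed.

Lemma bmeasB d (T : measurableType d) (f g : T -> R) :
  bmeas f -> bmeas g -> bmeas (fun t => f t - g t).
Proof. by move=> mf mg; apply: bmeasD => //; exact: bmeasN. Qed.

Lemma bmeasX d (T : measurableType d) (f : T -> R) n : bmeas f -> bmeas (fun t => f t ^+ n).
Proof.
move=> mf; elim: n => [|n IH]; first exact: bmeas_cst.
by under eq_fun do rewrite exprS; exact: bmeasM.
Qed.

Lemma bmeas_norm d (T : measurableType d) (f : T -> R) : bmeas f -> bmeas (fun t => `|f t|).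
Proof.
move=> [mf [K HK]]; split; first exact: measurableT_comp.
by exists K => t; rewrite normr_id.
Qed.

Lemma bmeas_powR d (T : measurableType d) (f : T -> R) (p : R) : 0 <= p ->
  (forall t, 0 <= f t) -> bmeas f -> bmeas (fun t => f t `^ p).
Proof.
move=> p0 f0 [mf [K HK]]; split.
  exact: (measurableT_comp (measurable_powR p)).
exists (K `^ p) => t; rewrite ger0_norm ?powR_ge0//.
apply: ge0_ler_powR; rewrite ?nnegrE//.
  by rewrite (le_trans _ (HK t)).
by rewrite (le_trans _ (HK t))// ler_norm.
Qed.

Lemma bmeas_sqrt d (T : measurableType d) (f : T -> R) :
  (forall t, 0 <= f t) -> bmeas f -> bmeas (fun t => Num.sqrt (f t)).
Proof.
move=> f0 bf; under eq_fun do rewrite -powR12_sqrt//.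
by apply: bmeas_powR => //; rewrite invr_ge0.
Qed.

Lemma bmeas_indic d (T : measurableType d) (A : set T) : measurable A -> bmeas (\1_A : T -> R).
Proof.
move=> mA; split; first exact: measurable_indic.
by exists 1 => t; rewrite indicE; case: (_ \in _); rewrite ?normr0 ?normr1.
Qed.

Lemma bmeas_sum d (T : measurableType d) (I : Type) (s : seq I) (f : I -> T -> R) :
  (forall i, bmeas (f i)) -> bmeas (fun t => \sum_(i <- s) f i t).
Proof.
move=> bf; elim: s => [|i s IH].
  by under eq_fun do rewrite big_nil; exact: bmeas_cst.
by under eq_fun do rewrite big_cons; exact: bmeasD.
Qed.

Lemma bmeas_continuous (f : R -> R) : continuous f -> (exists K, forall t, `|f t| <= K) ->
  bmeas f.
Proof. by move=> cf bf; split => //; exact: continuous_measurable_fun. Qed.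

Lemma bmeas_integrable d (T : measurableType d) (m : {finite_measure set T -> \bar R})
  (f : T -> R) : bmeas f -> m.-integrable setT (EFin \o f).
Proof.
move=> [mf [K HK]]; apply: (@le_integrable _ _ _ _ _ _ _ (cst K%:E)) => //.
- exact/measurable_EFinP.
- by move=> t _ /=; rewrite lee_fin (le_trans (HK t))// ler_norm.
- exact: finite_measure_integrable_cst.
Qed.

Lemma bmeas_integrable_itv (a b : R) (g : R -> R) : bmeas g ->
  mu.-integrable `[a, b] (EFin \o g).
Proof.
move=> [mg [L HL]]; apply: (@le_integrable _ _ _ _ _ _ _ (cst L%:E)) => //.
- exact/measurable_EFinP/measurable_funTS.
- by move=> t _ /=; rewrite lee_fin (le_trans (HL t))// ler_norm.
- apply/integrableP; split; first exact: measurable_cst.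
  rewrite integral_cst//= lebesgue_measure_itv/= lte_fin.
  by case: ifPn => _; rewrite ?mule0 ?ltry// -EFinB -EFinM ltry.
Qed.

Lemma meanD f g : bmeas f -> bmeas g -> mean (fun t => f t + g t) = mean f + mean g.
Proof. by move=> bf bg; rewrite /mean RintegralD//; exact: bmeas_integrable. Qed.

Lemma meanB f g : bmeas f -> bmeas g -> mean (fun t => f t - g t) = mean f - mean g.
Proof. by move=> bf bg; rewrite /mean RintegralB//; exact: bmeas_integrable. Qed.

Lemma meanZ c f : bmeas f -> mean (fun t => c * f t) = c * mean f.
Proof. by move=> bf; rewrite /mean RintegralZl//; exact: bmeas_integrable. Qed.

Lemma mean_cst c : mean (fun=> c) = c.
Proof.
rewrite /mean Rintegral_cst//.
transitivity (c * fine (1%E : \bar R)); last by rewrite mulr1.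
congr (_ * fine _); exact: (probability_setT circ).
Qed.

Lemma mean_sum (I : Type) (s : seq I) (f : I -> R -> R) : (forall i, bmeas (f i)) ->
  mean (fun t => \sum_(i <- s) f i t) = \sum_(i <- s) mean (f i).
Proof.
move=> bf; elim: s => [|i s IH].
  by under [in LHS]eq_fun do rewrite big_nil; rewrite big_nil mean_cst.
under [in LHS]eq_fun do rewrite big_cons; rewrite big_cons -IH meanD//.
exact: bmeas_sum.
Qed.

Lemma mean_lebesgue f : bmeas f ->
  mean f = (twopi R)^-1 * \int[mu]_(t in `[0, twopi R]) f t.
Proof.
move=> bf; have [mf [K HK]] := bf.
have K0 : 0 <= K by rewrite (le_trans _ (HK 0)).
have intI := @bmeas_integrable_itv 0 (twopi R).
(* Adding the bound [K] reduces to nonnegative integrands, the case to which [integral_uniform] is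
   applied. *)
suff H (g : R -> R) : bmeas g -> (forall t, 0 <= g t) ->
    mean g = (twopi R)^-1 * \int[mu]_(t in `[0, twopi R]) g t.
  have h1 : bmeas (fun t => f t + K) by apply: bmeasD => //; exact: bmeas_cst.
  have h0 t : 0 <= f t + K.
    by have := HK t; rewrite ler_norml => /andP[]; lra.
  have := H _ h1 h0; rewrite meanD//; last exact: bmeas_cst.
  rewrite RintegralD//; [|exact: intI|exact/intI/bmeas_cst].
  rewrite (H (cst K))//; last exact: bmeas_cst.
  by rewrite mulrDr => /addIr.
move=> bg g0; rewrite /mean /Rintegral integral_uniform//.
- rewrite subr0 fineM//; apply: integrable_fin_num => //; exact: intI.
- by apply/measurable_EFinP; case: bg.
Qed.

(** The comparison is asked for on one period only, since kernel bounds such as the one in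
    [Pois_maximal] hold only for angles [t] in [[0, 2 pi]]. *)
Lemma le_mean f g : bmeas f -> bmeas g ->
  (forall t, 0 <= t <= twopi R -> f t <= g t) -> mean f <= mean g.
Proof.
move=> bf bg fg; rewrite !mean_lebesgue// ler_wpM2l ?invr_ge0 ?(ltW twopi_gt0)//.
by apply: le_Rintegral => //; exact: bmeas_integrable_itv.
Qed.

Lemma eq_mean f g : f =1 g -> mean f = mean g.
Proof. by move=> /funext ->. Qed.

Lemma mean_ge0 f : (forall t, 0 <= f t) -> 0 <= mean f.
Proof. by move=> f0; exact: Rintegral_ge0. Qed.

Lemma le_normr_mean f : bmeas f -> `|mean f| <= mean (fun t => `|f t|).
Proof. by move=> bf; apply: le_normr_Rintegral => //; exact: bmeas_integrable. Qed.

Lemma mean_le_cst f K : bmeas f -> (forall t, f t <= K) -> mean f <= K.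
Proof.
by move=> bf fK; rewrite -[leRHS]mean_cst; apply: le_mean => //; exact: bmeas_cst.
Qed.

Lemma bmeas_section1 (F : R * R -> R) s : bmeas F -> bmeas (fun t => F (s, t)).
Proof.
move=> [mF [K HK]]; split; last by exists K.
exact: measurableT_comp.
Qed.

Lemma bmeas_section2 (F : R * R -> R) t : bmeas F -> bmeas (fun s => F (s, t)).
Proof.
move=> [mF [K HK]]; split; last by exists K.
exact: measurableT_comp.
Qed.

Lemma bmeas_integrable_prod (F : R * R -> R) : bmeas F ->
  (circ \x circ)%E.-integrable setT (EFin \o F).
Proof.
move=> bF; have [mF [K HK]] := bF.
apply: (@le_integrable _ _ _ _ _ _ _ (cst K%:E)) => //.
- exact/measurable_EFinP.
- by move=> t _ /=; rewrite lee_fin (le_trans (HK t))// ler_norm.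
- apply/integrableP; split; first exact: measurable_cst.
  rewrite integral_cst//.
  have E : (circ \x circ)%E (setT `*` setT) = (circ setT * circ setT)%E.
    exact: product_measure1E.
  rewrite (_ : circ setT = 1%E) in E; last exact: (probability_setT circ).
  by rewrite -setXTT [X in (_ * X < _)%E]E !mule1 ltry.
Qed.

Lemma bmeas_mean (F : R * R -> R) : bmeas F -> bmeas (fun s => mean (fun t => F (s, t))).
Proof.
move=> bF; have [mF [K HK]] := bF.
have iF := bmeas_integrable_prod bF.
split.
  have := measurable_fubini_F iF; rewrite /fubini_F => h.
  apply/measurable_EFinP; apply: eq_measurable_fun h => s _ /=.
  rewrite /mean fineK//; apply: integrable_fin_num => //.
  by apply: bmeas_integrable; exact: bmeas_section1.
exists K => s; rewrite (le_trans (le_normr_mean _))//; first exact: bmeas_section1.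
by apply: mean_le_cst => //; exact/bmeas_norm/bmeas_section1.
Qed.

Lemma mean_fubini (F : R * R -> R) : bmeas F ->
  mean (fun s => mean (fun t => F (s, t))) = mean (fun t => mean (fun s => F (s, t))).
Proof.
move=> bF; rewrite /mean /Rintegral.
have iF := bmeas_integrable_prod bF.
have := Fubini iF => /= h.
congr fine; transitivity (\int[circ]_s \int[circ]_t (F (s, t))%:E)%E.
  apply: eq_integral => s _; rewrite fineK//; apply: integrable_fin_num => //.
  by apply: bmeas_integrable; exact: bmeas_section1.
rewrite h; apply: eq_integral => s _; rewrite fineK//; apply: integrable_fin_num => //.
by apply: bmeas_integrable; exact: bmeas_section2.
Qed.

End Mean.

Opaque mean.

(** * Complex-valued integrals over intervals *)

Section ComplexIntegral.
Context {R : realType}.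
Local Notation C := R[i].
Local Notation mu := (@lebesgue_measure R).
Local Notation Re := complex.Re.
Local Notation Im := complex.Im.
Implicit Types (f g : R -> C).

Lemma cReD (z w : C) : Re (z + w) = Re z + Re w.
Proof. by case: z w => ? ? []. Qed.

Lemma cImD (z w : C) : Im (z + w) = Im z + Im w.
Proof. by case: z w => ? ? []. Qed.

Lemma cReN (z : C) : Re (- z) = - Re z. Proof. by case: z. Qed.

Lemma cImN (z : C) : Im (- z) = - Im z. Proof. by case: z. Qed.

Lemma cReM (z w : C) : Re (z * w) = Re z * Re w - Im z * Im w.
Proof. by case: z w => ? ? []. Qed.

Lemma cImM (z w : C) : Im (z * w) = Re z * Im w + Im z * Re w.
Proof. by case: z w => ? ? []. Qed.

Definition bmC f := bmeas (fun t => Re (f t)) /\ bmeas (fun t => Im (f t)).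

Lemma bmC_cst (c : C) : bmC (fun=> c).
Proof. by split; exact: bmeas_cst. Qed.

Lemma bmC_D f g : bmC f -> bmC g -> bmC (fun t => f t + g t).
Proof.
move=> [f1 f2] [g1 g2]; split.
  by under eq_fun do rewrite cReD; exact: bmeasD.
by under eq_fun do rewrite cImD; exact: bmeasD.
Qed.

Lemma bmC_M f g : bmC f -> bmC g -> bmC (fun t => f t * g t).
Proof.
move=> [f1 f2] [g1 g2]; split.
  by under eq_fun do rewrite cReM; apply: bmeasB; exact: bmeasM.
by under eq_fun do rewrite cImM; apply: bmeasD; exact: bmeasM.
Qed.

Lemma bmC_Z c f : bmC f -> bmC (fun t => c * f t).
Proof. exact/bmC_M/bmC_cst. Qed.

Lemma bmC_B f g : bmC f -> bmC g -> bmC (fun t => f t - g t).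
Proof.
by move=> bf bg; under eq_fun do rewrite -mulN1r; apply: bmC_D => //; exact: bmC_Z.
Qed.

Lemma bmC_cmod f : bmC f -> bmeas (fun t => cmod (f t)).
Proof.
move=> [f1 f2]; apply: bmeas_sqrt; first by move=> t; rewrite addr_ge0// sqr_ge0.
by apply: bmeasD; exact: bmeasX.
Qed.

Lemma bmC_real (f : R -> R) : bmeas f -> bmC (fun t => ((f t)%:C)%C).
Proof. by move=> bf; split => //=; exact: bmeas_cst. Qed.

Definition rcont f := forall t (e : R), 0 < e -> exists2 r : R, 0 < r &
  forall s, `|s - t| < r -> cmod (f s - f t : C) <= e.

Lemma continuous_eps (g : R -> R) :
  (forall t (e : R), 0 < e -> exists2 r : R, 0 < r &
     forall s, `|s - t| < r -> `|g s - g t| <= e) -> continuous g.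
Proof.
move=> H t; apply/cvgrPdist_le => e e0; have [r r0 Hr] := H t e e0.
exists r => //= s /= h.
by rewrite distrC; apply: Hr; rewrite distrC.
Qed.

Lemma rcont_bmC f (K : R) : rcont f -> (forall t, cmod (f t) <= K) -> bmC f.
Proof.
move=> cf Kf; split; apply: bmeas_continuous.
- apply: continuous_eps => t e /(cf t)[r r0 Hr]; exists r => // s /Hr.
  by apply: le_trans; rewrite -cReN -cReD cmod_Re.
- by exists K => t; rewrite (le_trans (cmod_Re _)).
- apply: continuous_eps => t e /(cf t)[r r0 Hr]; exists r => // s /Hr.
  by apply: le_trans; rewrite -cImN -cImD cmod_Im.
- by exists K => t; rewrite (le_trans (cmod_Im _)).
Qed.

Lemma rcont_polar (f : C -> C) (rho theta : R -> R) (L : R) : 0 < L ->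
  (forall t, ccont f (polar (rho t) (theta t))) ->
  (forall s t, cmod ((polar (rho s) (theta s) : C) - polar (rho t) (theta t) : C)
     <= L * `|s - t|) ->
  rcont (fun t => f (polar (rho t) (theta t))).
Proof.
move=> L0 cf Lip t e e0; have [r r0 Hr] := cf t e e0.
exists (r / L) => [|s st]; first by rewrite divr_gt0.
apply: Hr; rewrite (le_lt_trans (Lip _ _))// mulrC -ltr_pdivlMr//.
Qed.

Lemma polar_circle_bmC (f : C -> C) (r : R) : 0 <= r ->
  (forall z, cmod z = r -> ccont f z) -> bmC (fun t => f (polar r t)).
Proof.
move=> r0 cf.
have cf' z : r <= cmod z <= r -> ccont f z by rewrite -eq_le eq_sym => /eqP /cf.
have [K K0 HK] := annulus_bounded cf'.
apply: (@rcont_bmC _ K); last by move=> t; apply: HK; rewrite cmod_polar ger0_norm// lexx.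
apply: (@rcont_polar f (fun=> r) id (1 + 2 * r)).
- by rewrite ltr_pwDl// mulr_ge0.
- by move=> t; apply: cf; rewrite cmod_polar ger0_norm.
- move=> s t; apply: (le_trans (dist_polar _ _ _ _)).
  by rewrite subrr normr0 add0r ger0_norm// ler_wpM2r// lerDr.
Qed.

Definition CI (a b : R) f : C :=
  Complex (\int[mu]_(t in `[a, b]) Re (f t))%R (\int[mu]_(t in `[a, b]) Im (f t))%R.

Lemma eq_CI a b f g : (forall t, a <= t <= b -> f t = g t) -> CI a b f = CI a b g.
Proof.
move=> fg; rewrite /CI; congr Complex; apply: eq_Rintegral => t;
  by rewrite inE/= in_itv/= => /fg ->.
Qed.

Lemma CI_D a b f g : bmC f -> bmC g -> CI a b (fun t => f t + g t) = CI a b f + CI a b g.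
Proof.
move=> [f1 f2] [g1 g2]; rewrite /CI; simpc; congr Complex.
  under eq_Rintegral do rewrite cReD.
  by rewrite RintegralD//; exact: bmeas_integrable_itv.
under eq_Rintegral do rewrite cImD.
by rewrite RintegralD//; exact: bmeas_integrable_itv.
Qed.

Lemma CI_Z a b (c : C) f : bmC f -> CI a b (fun t => c * f t) = c * CI a b f.
Proof.
move=> [f1 f2]; rewrite /CI; case: c => x y; simpc; congr Complex.
  under eq_Rintegral do rewrite cReM /=.
  by rewrite RintegralB// ?RintegralZl//; apply: bmeas_integrable_itv => //; apply: bmeasM => //; exact: bmeas_cst.
under eq_Rintegral do rewrite cImM /=.
by rewrite RintegralD// ?RintegralZl//; apply: bmeas_integrable_itv => //; apply: bmeasM => //; exact: bmeas_cst.
Qed.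

Lemma CI_B a b f g : bmC f -> bmC g -> CI a b (fun t => f t - g t) = CI a b f - CI a b g.
Proof.
move=> bf bg; under [in LHS]eq_fun do rewrite -mulN1r.
by rewrite CI_D//; [rewrite CI_Z// mulN1r|exact: bmC_Z].
Qed.

Lemma Rintegral_cst_itv (a b c : R) : a <= b -> (\int[mu]_(_ in `[a, b]) c)%R = c * (b - a).
Proof.
move=> ab; rewrite Rintegral_cst//= lebesgue_measure_itv/= lte_fin.
by move: ab; rewrite le_eqVlt => /predU1P[->|->//]; rewrite ltxx subrr.
Qed.

Lemma CI_cst a b (c : C) : a <= b -> CI a b (fun=> c) = ((b - a)%:C)%C * c.
Proof.
move=> ab; rewrite /CI !Rintegral_cst_itv//; case: c => x y; simpc => /=.
by rewrite mulrC [y * _]mulrC.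
Qed.

Lemma CI_split a m b f : a <= m -> m <= b -> bmC f -> CI a b f = CI a m f + CI m b f.
Proof.
move=> am mb [f1 f2]; rewrite /CI; simpc; congr Complex.
  rewrite -(@Rintegral_itv_obnd_cbnd _ m); last first.
    by apply: integrableS (bmeas_integrable_itv m b f1) => //; exact: subset_itv_oc_cc.
  rewrite -(@Rintegral_itvB _ _ (BLeft a) (BRight b) m) ?bnd_simp//.
    by rewrite addrC subrK.
  exact: bmeas_integrable_itv.
rewrite -(@Rintegral_itv_obnd_cbnd _ m); last first.
  by apply: integrableS (bmeas_integrable_itv m b f2) => //; exact: subset_itv_oc_cc.
rewrite -(@Rintegral_itvB _ _ (BLeft a) (BRight b) m) ?bnd_simp//.
  by rewrite addrC subrK.
exact: bmeas_integrable_itv.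
Qed.

Lemma Rintegral_bound (a b K : R) (f : R -> R) : a <= b -> bmeas f ->
  (forall t, a <= t <= b -> `|f t| <= K) ->
  `|(\int[mu]_(t in `[a, b]) f t)%R| <= K * (b - a).
Proof.
move=> ab bf Kf.
apply: (le_trans (le_normr_Rintegral _ _)) => //; first exact: bmeas_integrable_itv.
apply: (@le_trans _ _ (\int[mu]_(t in `[a, b]) K)%R).
  apply: le_Rintegral => //.
  - by apply: bmeas_integrable_itv; exact: bmeas_norm.
  - by apply: bmeas_integrable_itv; exact: bmeas_cst.
by rewrite Rintegral_cst_itv.
Qed.

(** The factor 2 comes from bounding real and imaginary parts separately; it is harmless in
    Goursat's argument, and [cmod_cmean] gives the sharp constant for means. *)
Lemma CI_bound a b f (K : R) : a <= b -> bmC f ->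
  (forall t, a <= t <= b -> cmod (f t) <= K) -> cmod (CI a b f) <= 2 * K * (b - a).
Proof.
move=> ab [f1 f2] Kf; apply: (le_trans (cmod_le_ReIm _)).
rewrite -mulrA mulr_natl mulr2n; apply: lerD; apply: Rintegral_bound => // t /Kf.
  by apply: le_trans; exact: cmod_Re.
by apply: le_trans; exact: cmod_Im.
Qed.

Lemma bmC_expi : bmC (@expi R).
Proof.
by split; apply: bmeas_continuous; (try exact: continuous_cos); (try exact: continuous_sin);
  exists 1 => t; [exact: cos_max|exact: sin_max].
Qed.

Lemma CI_expi a b : a <= b -> CI a b (@expi R) = - 'i%C * ((expi b : C) - expi a).
Proof.
rewrite le_eqVlt => /predU1P[->|ab].
  by rewrite subrr mulr0 /CI set_itv1 !Rintegral_set1.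
have H1 : (\int[mu]_(t in `[a, b]) cos t)%R = sin b - sin a.
  rewrite /Rintegral (@continuous_FTC2 _ cos sin)//.
  - by apply: continuous_subspaceT => x; exact: continuous_cos.
  - split.
    + by move=> x _; exact: derivable_sin.
    + by apply: cvg_at_right_filter; exact: continuous_sin.
    + by apply: cvg_at_left_filter; exact: continuous_sin.
  - by move=> x _; rewrite derive1E derive_val.
have H2 : (\int[mu]_(t in `[a, b]) sin t)%R = - cos b + cos a.
  rewrite /Rintegral (@continuous_FTC2 _ sin (fun x => - cos x))//=.
  - by rewrite opprK.
  - by apply: continuous_subspaceT => x; exact: continuous_sin.
  - split.
    + by move=> x _; apply: derivableN; exact: derivable_cos.
    + by apply: cvg_at_right_filter; apply: cvgN; exact: continuous_cos.
    + by apply: cvg_at_left_filter; apply: cvgN; exact: continuous_cos.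
  - move=> x _; rewrite derive1E deriveN; last exact: derivable_cos.
    by rewrite derive_val opprK.
by rewrite /CI /= H1 H2 /expi; simpc; congr Complex; ring.
Qed.

End ComplexIntegral.

(** * Goursat's theorem for polar rectangles *)

Section Goursat.
Context {R : realType}.
Local Notation C := R[i].

(** Projection onto [[a, b]]. It extends radial integrands to bounded continuous functions on the
    whole line, as [bmC] demands. *)
Definition clamp (a b x : R) : R := Order.max a (Order.min x b).

Lemma clamp_id a b x : a <= x <= b -> clamp a b x = x.
Proof. by case/andP=> ax xb; rewrite /clamp (min_l xb) (max_r ax). Qed.

Lemma clamp_itv a b x : a <= b -> a <= clamp a b x <= b.
Proof. by move=> ab; rewrite /clamp le_max lexx ge_max ab ge_min lexx orbT. Qed.

Lemma clamp_lip a b x y : a <= b -> `|clamp a b x - clamp a b y| <= `|x - y|.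
Proof.
move=> ab; have D (u : R) : u <= `|u| by exact: ler_norm.
wlog xy : x y / x <= y.
  by move=> H; case: (leP x y) => [/H//|/ltW/H]; rewrite distrC [X in _ <= X]distrC.
rewrite !(distrC _ (clamp a b y)) !(distrC _ y) (ger0_norm (_ : 0 <= y - x)) ?subr_ge0//.
rewrite /clamp; case: (leP x b) => xb; case: (leP y b) => yb;
  case: (leP a x) => h1; case: (leP a y) => h2; case: (leP a b) => h3;
  rewrite ler_norml; lra.
Qed.

Lemma bmC_radial (f : C -> C) (a b t : R) : 0 < a -> a <= b ->
  (forall z : C, a <= cmod z <= b -> ccont f z) ->
  bmC (fun r => f (polar (clamp a b r) t)).
Proof.
move=> a0 ab cf; have [K K0 HK] := annulus_bounded cf.
have cmodE' r : cmod (polar (clamp a b r) t) = clamp a b r.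
  by rewrite cmod_polar ger0_norm//; case/andP: (clamp_itv r ab) => /(le_trans (ltW a0)).
apply: (@rcont_bmC _ _ K); last by move=> r; apply: HK; rewrite cmodE' clamp_itv.
apply: (@rcont_polar _ f (clamp a b) (fun=> t) 1) => //.
  by move=> r; apply: cf; rewrite cmodE' clamp_itv.
move=> r s; apply: (le_trans (dist_polar _ _ _ _)).
by rewrite subrr normr0 mulr0 addr0 mul1r clamp_lip.
Qed.

Section polar_rectangle.
Variables (ra rb : R).
Hypotheses (ra0 : 0 < ra) (rab : ra <= rb).
Let cl := clamp ra rb.

Let clE r : ra <= r <= rb -> cl r = r. Proof. exact: clamp_id. Qed.

Let cl_gt0 r : 0 < cl r.
Proof. by case/andP: (clamp_itv r rab) => /(lt_le_trans ra0). Qed.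

(** This is [1 / i] times the integral of [f(z) dz / z] along the boundary of the polar rectangle,
    because [dz / z = dr / r + i dt]. Dividing by [z] makes the two arcs contribute unweighted
    integrals over circles. *)
Definition polar_boundary (f : C -> C) a b c d : C :=
  (CI c d (fun t => f (polar (cl b) t)) - CI c d (fun t => f (polar (cl a) t)))
  + 'i%C * (CI a b (fun r => f (polar (cl r) d) * (((cl r)^-1)%:C)%C)
     - CI a b (fun r => f (polar (cl r) c) * (((cl r)^-1)%:C)%C)).

Let good f := forall z : C, ra <= cmod z <= rb -> ccont f z.

Let bm_ang f r : good f -> bmC (fun t => f (polar (cl r) t)).
Proof.
move=> gf; apply: polar_circle_bmC; first exact: ltW.
by move=> z zr; apply: gf; rewrite zr clamp_itv.
Qed.

Let bm_inv : bmC (fun r : R => (((cl r)^-1)%:C)%C : C).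
Proof.
apply: bmC_real; apply: bmeas_continuous; last first.
  exists (ra^-1) => r; rewrite ger0_norm ?invr_ge0 ?(ltW (cl_gt0 r))//.
  by rewrite lef_pV2 ?posrE//; case/andP: (clamp_itv r rab).
apply: continuous_eps => t e e0.
exists (e * ra ^+ 2) => [|s st]; first by rewrite mulr_gt0// exprn_gt0.
have -> : (cl s)^-1 - (cl t)^-1 = (cl t - cl s) / (cl s * cl t).
  by field; rewrite !gt_eqF.
rewrite normrM normfV (ger0_norm (mulr_ge0 (ltW (cl_gt0 s)) (ltW (cl_gt0 t)))).
rewrite ler_pdivrMr ?mulr_gt0// distrC.
apply: (le_trans (clamp_lip _ _ rab)); apply: (le_trans (ltW st)).
rewrite ler_wpM2l ?(ltW e0)// expr2 ler_pM ?(ltW ra0)//.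
  by case/andP: (clamp_itv s rab).
by case/andP: (clamp_itv t rab).
Qed.

Let bm_rad f t : good f -> bmC (fun r => f (polar (cl r) t) * (((cl r)^-1)%:C)%C).
Proof. by move=> gf; apply: bmC_M bm_inv; exact: bmC_radial. Qed.

Lemma polar_boundary_split f a b c d m n : good f ->
  a <= m <= b -> c <= n <= d ->
  polar_boundary f a b c d = polar_boundary f a m c n + polar_boundary f m b c n
    + polar_boundary f a m n d + polar_boundary f m b n d.
Proof.
move=> gf /andP[am mb] /andP[cn nd]; rewrite /polar_boundary.
rewrite !(CI_split am mb (bm_rad _ gf)) !(CI_split cn nd (bm_ang _ gf)).
by ring.
Qed.

Lemma polar_boundaryB f g a b c d : good f -> good g ->
  polar_boundary (fun z => f z - g z) a b c d =
  polar_boundary f a b c d - polar_boundary g a b c d.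
Proof.
move=> gf gg; rewrite /polar_boundary.
rewrite !(CI_B _ _ (bm_ang _ gf) (bm_ang _ gg)).
have E t : CI a b (fun r => (f (polar (cl r) t) - g (polar (cl r) t)) * (((cl r)^-1)%:C)%C) =
    CI a b (fun r => f (polar (cl r) t) * (((cl r)^-1)%:C)%C)
    - CI a b (fun r => g (polar (cl r) t) * (((cl r)^-1)%:C)%C).
  by rewrite -CI_B; [apply: eq_CI => r _; rewrite mulrBl|exact: bm_rad|exact: bm_rad].
by rewrite !E; ring.
Qed.

Lemma good_affine (al be : C) : good (fun z => al + be * z).
Proof.
move=> z _; apply: ccontD; first exact: ccont_cst.
by apply: ccontM; [exact: ccont_cst|exact: ccont_id].
Qed.

(** In the coordinates [(r, t)] the form [f(z) dz / z] has the primitive [al (log r + i t) + be z];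
    the computation integrates its pieces explicitly. *)
Lemma polar_boundary_affine (al be : C) a b c d :
  ra <= a -> a <= b -> b <= rb -> c <= d ->
  polar_boundary (fun z => al + be * z) a b c d = 0.
Proof.
move=> raa ab brb cd; rewrite /polar_boundary.
have E r : CI c d (fun t => al + be * polar (cl r) t) =
    ((d - c)%:C)%C * al + be * ((cl r)%:C)%C * (- 'i%C * ((expi d : C) - expi c)).
  transitivity (CI c d (fun t => al + (be * ((cl r)%:C)%C) * expi t)).
    by apply: eq_CI => t _; rewrite polarE mulrA.
  rewrite CI_D; [|exact: bmC_cst|exact/bmC_Z/bmC_expi].
  by rewrite CI_cst// CI_Z ?CI_expi//; exact: bmC_expi.
have bmr t := bm_rad t (good_affine al be).
rewrite !E -(CI_B _ _ (bmr d) (bmr c)).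
have -> : CI a b (fun t => (al + be * polar (cl t) d) * (((cl t)^-1)%:C)%C -
      (al + be * polar (cl t) c) * (((cl t)^-1)%:C)%C) =
    CI a b (fun=> be * ((expi d : C) - expi c)).
  apply: eq_CI => t _; rewrite !polarE.
  have : ((cl t)%:C)%C != 0 :> C by rewrite eq_complex /= negb_and gt_eqF.
  have alg (x v w : C) : x != 0 -> (al + be * (x * v)) * x^-1 - (al + be * (x * w)) * x^-1
      = be * (v - w) by move=> x0; field.
  by rewrite fmorphV; exact: alg.
rewrite CI_cst// !clE; [|by rewrite raa (le_trans ab)|by rewrite brb andbT (le_trans raa)].
have -> : ((b - a)%:C)%C = (b%:C)%C - (a%:C)%C :> C by rewrite rmorphB.
by ring.
Qed.

Lemma polar_boundary_bound f a b c d K : good f ->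
  ra <= a -> a <= b -> b <= rb -> c <= d ->
  (forall r t, a <= r <= b -> c <= t <= d -> cmod (f (polar r t)) <= K) ->
  cmod (polar_boundary f a b c d) <= 4 * K * (1 + ra^-1) * ((b - a) + (d - c)).
Proof.
move=> gf raa ab brb cd HK; rewrite /polar_boundary.
have inr r : a <= r <= b -> ra <= r <= rb.
  by case/andP=> h1 h2; rewrite (le_trans raa)// (le_trans h2).
have K0 : 0 <= K by rewrite (le_trans (cmod_ge0 _) (HK a c _ _))// lexx.
have A r : a <= r <= b -> cmod (CI c d (fun t => f (polar (cl r) t))) <= 2 * K * (d - c).
  move=> hr; apply: CI_bound => //; first exact: bm_ang.
  by move=> t ht; rewrite clE ?inr//; exact: HK.
have B t : c <= t <= d ->
    cmod (CI a b (fun r => f (polar (cl r) t) * (((cl r)^-1)%:C)%C)) <= 2 * (K * ra^-1) * (b - a).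
  move=> ht; apply: CI_bound => //; first exact: bm_rad.
  move=> r hr; rewrite cmodM cmod_real ger0_norm ?invr_ge0 ?(ltW (cl_gt0 r))//.
  apply: ler_pM; rewrite ?cmod_ge0 ?invr_ge0 ?(ltW (cl_gt0 r))//.
    by rewrite clE ?inr//; exact: HK.
  by rewrite lef_pV2 ?posrE//; case/andP: (clamp_itv r rab).
have i1 : cmod ('i%C : C) = 1 by rewrite /cmod /= expr0n expr1n add0r sqrtr1.
apply: (le_trans (cmodD _ _)); rewrite cmodM i1 mul1r.
apply: (@le_trans _ _ (2 * K * (d - c) + 2 * K * (d - c)
   + (2 * (K * ra^-1) * (b - a) + 2 * (K * ra^-1) * (b - a)))).
  have aa : a <= a <= b by rewrite lexx ab.
  have bb : a <= b <= b by rewrite lexx ab.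
  have cc : c <= c <= d by rewrite lexx cd.
  have dd : c <= d <= d by rewrite lexx cd.
  apply: lerD; (apply: (le_trans (cmodD _ _)); rewrite cmodN).
    by apply: lerD; [exact: (A b bb)|exact: (A a aa)].
  by apply: lerD; [exact: (B d dd)|exact: (B c cc)].
have h1 : 0 <= K * (b - a) by rewrite mulr_ge0// subr_ge0.
have h2 : 0 <= K * (d - c) * ra^-1 by rewrite !mulr_ge0 ?subr_ge0// invr_ge0 ltW.
lra.
Qed.

(** Near each point [f] differs from an affine function, whose boundary integral is zero, by a small
    multiple of the distance. The integral over a small rectangle is thus a small multiple of its
    squared half-perimeter, and bisection carries this to the whole rectangle. *)
Lemma polar_goursat f c d : c <= d ->
  (forall z : C, ra <= cmod z <= rb -> holo f z) -> polar_boundary f ra rb c d = 0.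
Proof.
move=> cd hf; have gf : good f by move=> z /hf; exact: holo_ccont.
apply/eqP; rewrite -cmod_eq0; apply/eqP/le_anti; rewrite cmod_ge0 andbT.
apply/ler_addgt0Pl => e e0; rewrite addr0.
pose S0 := rb - ra + (d - c) + 1.
have S00 : 0 < S0 by rewrite ltr_wpDl// addr_ge0// subr_ge0.
pose e1 := e / S0 ^+ 2.
have e10 : 0 < e1 by rewrite divr_gt0// exprn_gt0.
suff : cmod (polar_boundary f ra rb c d) <= e1 * ((rb - ra) + (d - c)) ^+ 2.
  move/le_trans; apply; rewrite /e1 mulrAC ler_pdivrMr ?exprn_gt0// ler_wpM2l ?(ltW e0)//.
  have S1 : rb - ra + (d - c) <= S0 by rewrite /S0 lerDl.
  have S2 : 0 <= rb - ra + (d - c) by rewrite addr_ge0// subr_ge0.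
  by rewrite !expr2 ler_pM.
(* Halving both sides divides the squared half-perimeter by four, so the bounds of the four quarters
   add up to that of the rectangle. *)
pose P a b c d := ra <= a -> a <= b -> b <= rb -> c <= d ->
   cmod (polar_boundary f a b c d) <= e1 * ((b - a) + (d - c)) ^+ 2.
suff : P ra rb c d by apply; rewrite ?lexx.
apply: quartering => //.
- move=> a b c' d' m n ab cd' h1 h2 h3 h4 raa _ brb _.
  have [am mb] : a <= m /\ m <= b by rewrite /m; split; lra.
  have [cn nd] : c' <= n /\ n <= d' by rewrite /n; split; lra.
  rewrite (@polar_boundary_split _ _ _ _ _ m n)// ?am ?cn//.
  have {}h1 := h1 raa am (le_trans mb brb) cn.
  have {}h2 := h2 (le_trans raa am) mb brb cn.
  have {}h3 := h3 raa am (le_trans mb brb) nd.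
  have {}h4 := h4 (le_trans raa am) mb brb nd.
  apply: (le_trans (cmodD _ _)); apply: (le_trans (lerD (cmodD _ _) (lexx _))).
  apply: (le_trans (lerD (lerD (cmodD _ _) (lexx _)) (lexx _))).
  apply: (le_trans (lerD (lerD (lerD h1 h2) h3) h4)).
  by rewrite /m /n le_eqVlt; apply/orP; left; apply/eqP; field.
move=> x y xr yr; pose z0 := polar x y.
have zr : ra <= cmod z0 <= rb.
  by rewrite cmod_polar ger0_norm// (le_trans (ltW ra0))//; case/andP: xr.
(* By [dist_polar], [K1] times the half-perimeter bounds distances inside a rectangle of the
   annulus; [et] absorbs [K1] and the constant of [polar_boundary_bound]. *)
pose K1 := 1 + 2 * rb.
have K10 : 0 < K1 by rewrite ltr_pwDl// mulr_ge0// (le_trans (ltW ra0)).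
pose et := e1 / (4 * (1 + ra^-1) * K1).
have ra1 : 0 < 1 + ra^-1 by rewrite addr_gt0// invr_gt0.
have et0 : 0 < et by rewrite divr_gt0// !mulr_gt0.
have [d0 /(_ _ et0)[r r0 Hr]] := hf z0 zr.
exists (r / (2 * K1)) => [|a b c' d' raa xab brb _ ycd _ l1 l2 _ ab _ cd'].
  by rewrite divr_gt0// mulr_gt0.
pose L (w : C) := (f z0 - d0 * z0) + d0 * w.
have gL : good L by exact: good_affine.
have -> : polar_boundary f a b c' d' = polar_boundary (fun w => f w - L w) a b c' d'.
  by rewrite polar_boundaryB// polar_boundary_affine// subr0.
have gfL : good (fun w => f w - L w).
  move=> w hw; apply: ccontD; first exact: gf.
  move=> u /(gL _ hw)[s s0 Hs]; exists s => // v /Hs.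
  by rewrite -opprD cmodN.
pose S := (b - a) + (d' - c').
have S0' : 0 <= S by rewrite addr_ge0// subr_ge0.
have Sr : K1 * S < r.
  have -> : r = K1 * (r / (2 * K1) + r / (2 * K1)) by field; rewrite gt_eqF.
  by rewrite ltr_pM2l// ltrD.
apply: (@le_trans _ _ (4 * (et * (K1 * S)) * (1 + ra^-1) * S)).
  apply: polar_boundary_bound => // s t hs ht.
  have dz : cmod ((polar s t : C) - z0 : C) <= K1 * S.
    apply: (le_trans (dist_polar _ _ _ _)).
    have sx : `|s - x| <= b - a by rewrite ler_norml; move: hs xab; lra.
    have ty : `|t - y| <= d' - c' by rewrite ler_norml; move: ht ycd; lra.
    have x0 : `|x| <= rb.
      by move/andP: xab => [ax xb]; rewrite ger0_norm; move: ra0 raa ax xb brb; lra.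
    have h1 : `|x| * `|t - y| <= rb * (d' - c') by exact: ler_pM.
    have h2 : 0 <= rb * (b - a).
      by rewrite mulr_ge0 ?subr_ge0// (le_trans (ltW ra0)).
    by rewrite /K1 /S; lra.
  have -> : f (polar s t) - L (polar s t) = f (polar s t) - f z0 - d0 * ((polar s t : C) - z0) :> C.
    by rewrite /L; ring.
  rewrite (le_trans (Hr _ (le_lt_trans dz Sr)))// ler_wpM2l// ltW//.
have alg (k v w s : R) : w != 0 -> v != 0 -> 4 * (k / (4 * w * v) * (v * s)) * w * s = k * s ^+ 2.
  by move=> w0 v0; field; rewrite w0 v0.
by rewrite alg ?gt_eqF.
Qed.

End polar_rectangle.

Definition cmean (f : R -> C) : C := Complex (mean (fun t => complex.Re (f t))) (mean (fun t => complex.Im (f t))).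

Lemma cmean_CI f : bmC f -> cmean f = (((twopi R)^-1)%:C)%C * CI 0 (twopi R) f.
Proof. by move=> [f1 f2]; rewrite /cmean !mean_lebesgue// /CI; simpc. Qed.

Lemma polar_2pi r : polar r (twopi R) = polar r 0 :> C.
Proof. by rewrite !polarE expi2pi expi0. Qed.

(** Over a full turn the two radial sides carry the same integral and cancel, so Goursat's theorem
    equates the two circles. *)
Lemma cmean_circle_const f (ra rb : R) : 0 < ra -> ra <= rb ->
  (forall z : C, ra <= cmod z <= rb -> holo f z) ->
  cmean (fun t => f (polar ra t)) = cmean (fun t => f (polar rb t)).
Proof.
move=> ra0 rab hf.
have rb0 := lt_le_trans ra0 rab.
have := polar_goursat ra0 rab (ltW twopi_gt0) hf.
rewrite /polar_boundary !clamp_id ?lexx ?rab//.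
under [X in _ + 'i%C * (X - _)]eq_CI => r _ do rewrite polar_2pi.
rewrite subrr mulr0 addr0 => /eqP; rewrite subr_eq0 => /eqP E.
rewrite !cmean_CI ?E//; apply: polar_circle_bmC; rewrite ?ltW// => z zr;
  by apply: holo_ccont; apply: hf; rewrite zr ?lexx ?rab.
Qed.

End Goursat.

(** * Cauchy and Poisson formulas on circles *)

Section Poisson.
Context {R : realType}.
Local Notation C := R[i].
Implicit Types (f g : R -> C).

Lemma eq_cmean f g : f =1 g -> cmean f = cmean g.
Proof. by move=> /funext ->. Qed.

Lemma cmeanD f g : bmC f -> bmC g -> cmean (fun t => f t + g t) = cmean f + cmean g.
Proof.
move=> [f1 f2] [g1 g2]; rewrite /cmean; simpc; congr Complex; rewrite -meanD//;
  by apply: eq_mean => t; rewrite ?cReD ?cImD.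
Qed.

Lemma cmeanZ (c : C) f : bmC f -> cmean (fun t => c * f t) = c * cmean f.
Proof.
move=> [f1 f2]; rewrite /cmean; case: c => x y; simpc; congr Complex.
  rewrite -!meanZ// -meanB; [|by apply: bmeasM => //; exact: bmeas_cst..].
  by apply: eq_mean => t; exact: cReM.
rewrite -!meanZ// -meanD; [|by apply: bmeasM => //; exact: bmeas_cst..].
by apply: eq_mean => t; exact: cImM.
Qed.

Lemma cmeanB f g : bmC f -> bmC g -> cmean (fun t => f t - g t) = cmean f - cmean g.
Proof.
move=> bf bg; rewrite -mulN1r -cmeanZ// -cmeanD//; last exact: bmC_Z.
by apply: eq_cmean => t; rewrite mulN1r.
Qed.

Lemma cmean_cst (c : C) : cmean (fun=> c) = c.
Proof. by rewrite /cmean !mean_cst; case: c. Qed.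

Lemma cmean_conj f : bmC f -> cmean (fun t => ((f t)^*)%C) = ((cmean f)^*)%C.
Proof.
move=> [f1 f2]; rewrite /cmean /=; congr Complex.
  by apply: eq_mean => t; case: (f t).
rewrite -mulN1r -meanZ//; apply: eq_mean => t; rewrite mulN1r; by case: (f t).
Qed.

Lemma Re_cmean f : complex.Re (cmean f) = mean (fun t => complex.Re (f t)).
Proof. by []. Qed.

(** A unimodular [c] rotates the mean onto the positive axis, where it is the mean of a real
    part. *)
Lemma cmod_cmean f : bmC f -> cmod (cmean f) <= mean (fun t => cmod (f t)).
Proof.
move=> bf; set z := cmean f.
have [z0|z0] := eqVneq z 0.
  by rewrite z0 cmod0; apply: mean_ge0 => t; exact: cmod_ge0.
pose c : C := (z^*)%C / ((cmod z)%:C)%C.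
have m0 : cmod z != 0 by rewrite cmod_eq0.
have c1 : cmod c = 1.
  by rewrite cmodM cmodV cmodJ cmod_real ger0_norm ?cmod_ge0// divff.
have -> : cmod z = complex.Re (cmean (fun t => c * f t)).
  rewrite cmeanZ// -/z /c mulrAC [(z^*)%C * z]mulrC -sqr_normc -cmodE -rmorphXn /=.
  by rewrite expr0n addr0 mul0r subr0; field.
have bcf : bmC (fun t => c * f t) by exact: bmC_Z.
rewrite Re_cmean; apply: le_mean; [by case: bcf|exact: bmC_cmod|].
move=> t _; rewrite (le_trans (ler_norm _))// (le_trans (cmod_Re _))//.
by rewrite cmodM c1 mul1r.
Qed.

Lemma cmod_cmean_le f K : bmC f -> (forall t, cmod (f t) <= K) -> cmod (cmean f) <= K.
Proof.
move=> bf fK; rewrite (le_trans (cmod_cmean bf))//; apply: mean_le_cst => //.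
exact: bmC_cmod.
Qed.

Lemma polar0 (t : R) : polar 0 t = 0 :> C.
Proof. by rewrite polarE mul0r. Qed.

(** The circle can be shrunk without changing the mean, until continuity at the origin applies. *)
Lemma cmean_value (f : C -> C) (rho r : R) : 0 <= r -> r < rho ->
  (forall z, cmod z < rho -> holo f z) -> cmean (fun t => f (polar r t)) = f 0.
Proof.
move=> r0 rrho hf; move: r0; rewrite le_eqVlt => /predU1P[<-|r0].
  by under eq_cmean do rewrite polar0; rewrite cmean_cst.
apply/eqP; rewrite -subr_eq0 -cmod_eq0; apply/eqP/le_anti; rewrite cmod_ge0 andbT.
apply/ler_addgt0Pl => e e0; rewrite addr0.
have rho0 := lt_trans r0 rrho.
have cf z : cmod z < rho -> ccont f z by move=> /hf; exact: holo_ccont.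
have [d d0 Hd] : exists2 d, 0 < d & forall w : C, cmod (w - 0) < d -> cmod (f w - f 0 : C) <= e.
  by apply: cf => //; rewrite cmod0.
pose s := Order.min r (d / 2).
have s0 : 0 < s by rewrite lt_min r0 divr_gt0.
have sr : s <= r by rewrite ge_min lexx.
have sd : s < d by rewrite gt_min ltr_pdivrMr// ltr_pMr// ltr1n orbT.
rewrite -(@cmean_circle_const _ f s r)//; last first.
  by move=> z /andP[_ zr]; apply: hf; exact: le_lt_trans rrho.
have bf : bmC (fun t => f (polar s t)).
  apply: polar_circle_bmC (ltW s0) _ => z zs; apply: cf.
  by rewrite zs (le_lt_trans sr).
rewrite -[f 0]cmean_cst -cmeanB//; last exact: bmC_cst.
apply: cmod_cmean_le; first by apply: bmC_B => //; exact: bmC_cst.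
by move=> t; apply: Hd; rewrite subr0 cmod_polar ger0_norm// ltW.
Qed.

Section cauchy.
Variables (f : C -> C) (rho r : R) (z : C).
Hypotheses (zr : cmod z < r) (rrho : r < rho).
Hypothesis hf : forall w, cmod w < rho -> holo f w.

Let r0 : 0 < r. Proof. by apply: le_lt_trans zr; exact: cmod_ge0. Qed.

Let polar_r_neq t : (polar r t : C) - z != 0.
Proof.
rewrite -cmod_gt0 (lt_le_trans _ (cmod_sub_ge _ _))// subr_gt0.
by rewrite cmod_polar ger0_norm// ltW.
Qed.

Lemma bmC_circle_holo (g : C -> C) : (forall w, cmod w = r -> holo g w) ->
  bmC (fun t => g (polar r t)).
Proof.
move=> hg; apply: polar_circle_bmC; first exact: ltW.
by move=> w /hg; exact: holo_ccont.
Qed.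

Let holo_cauchy_kernel w : w != z -> holo (fun w => w / (w - z)) w.
Proof.
move=> wz; apply: holoM; first exact: holo_id.
apply: holoV; first by rewrite subr_eq0.
by apply: holoB; [exact: holo_id|exact: holo_cst].
Qed.

Let neq_circle w : cmod w = r -> w != z.
Proof. by move=> wr; apply: contra_ltN zr => /eqP <-; rewrite wr. Qed.

Let holo_conj_kernel w : cmod w * cmod z < r ^+ 2 ->
  holo (fun w : C => ((r ^+ 2)%:C)%C / (((r ^+ 2)%:C)%C - (z^*)%C * w)) w.
Proof.
move=> h; apply: holoM; first exact: holo_cst.
apply: holoV; last first.
  by apply: holoB; [exact: holo_cst|apply: holoZ; exact: holo_id].
rewrite -cmod_gt0 (lt_le_trans _ (cmod_sub_ge _ _))// subr_gt0.
by rewrite cmodM cmodJ cmod_real ger0_norm ?sqr_ge0// mulrC.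
Qed.

(** On the circle the conjugate of [w] is [r^2 / w]. The conjugated Cauchy kernel is therefore the
    trace of a function whose only pole lies outside the closed disc, to which the mean value
    property applies. *)
Let kernel_conj t : ((((polar r t : C) / ((polar r t : C) - z)))^*)%C =
  ((r ^+ 2)%:C)%C / (((r ^+ 2)%:C)%C - (z^*)%C * (polar r t : C)).
Proof.
have pr0 : (polar r t : C) != 0 by rewrite -cmod_gt0 cmod_polar normr_gt0 gt_eqF.
have pz := polar_r_neq t.
have pE : (((polar r t : C)^*)%C) = ((r ^+ 2)%:C)%C / (polar r t : C).
  apply: (mulIf pr0); rewrite divfK// mulrC -sqr_normc -cmodE cmod_polar.
  by rewrite -rmorphXn /= real_normK ?num_real.
have pz' : ((r ^+ 2)%:C)%C / (polar r t : C) - (z^*)%C != 0.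
  by rewrite -pE -rmorphB conjc_eq0.
move: (polar r t : C) (((r ^+ 2)%:C)%C : C) pr0 pE pz' => v a v0 vE h.
have conjB (x y : C) : ((x - y)^*)%C = (x^*)%C - (y^*)%C by rewrite rmorphB.
have conjM (x y : C) : ((x * y)^*)%C = (x^*)%C * (y^*)%C by rewrite rmorphM.
rewrite conjM conjc_inv conjB vE.
move: ((z^*)%C) h => y h.
have h' : a - y * v != 0.
  by apply: contra h => /eqP e; apply/eqP; apply: (mulIf v0); rewrite mul0r mulrBl divfK.
by field; rewrite h' v0.
Qed.

(** The kernel has its pole inside the circle; its conjugate does not, and takes the value 1 at the
    origin. *)
Lemma cmean_cauchy_kernel1 :
  cmean (fun t => (polar r t : C) / ((polar r t : C) - z)) = 1.
Proof.
have bk : bmC (fun t => (polar r t : C) / ((polar r t : C) - z)).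
  apply: (@bmC_circle_holo (fun w => w / (w - z))) => w wr.
  by apply: holo_cauchy_kernel; exact: neq_circle.
apply: (can_inj (@conjcK _)); rewrite -cmean_conj// conjc1.
under eq_cmean do rewrite kernel_conj.
have [z0|z0] := eqVneq z 0.
  rewrite (@eq_cmean _ (fun=> 1)) ?cmean_cst// => t.
  by rewrite z0 conjc0 mul0r subr0 divff// -cmod_gt0 cmod_real normr_gt0 expf_neq0// gt_eqF.
have mz : 0 < cmod z by rewrite cmod_gt0.
rewrite (@cmean_value (fun w : C => ((r ^+ 2)%:C)%C / (((r ^+ 2)%:C)%C - (z^*)%C * w))
  (r ^+ 2 / cmod z)) ?(ltW r0)//.
- by rewrite mulr0 subr0 divff// -cmod_gt0 cmod_real normr_gt0 expf_neq0// gt_eqF.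
- by rewrite ltr_pdivlMr// expr2 ltr_pM2l.
- by move=> w; rewrite ltr_pdivlMr// => /holo_conj_kernel.
Qed.

Let dslope (d w : C) : C := if w == z then d else (f w - f z) / (w - z).

Let dslope_holo d w : w != z -> cmod w < rho -> holo (dslope d) w.
Proof.
move=> wz wr; have wz0 : 0 < cmod (w - z) by rewrite cmod_gt0 subr_eq0.
apply: (@holo_near_eq _ (fun w => (f w - f z) * (w - z)^-1) _ _ _ wz0).
  move=> v vw; rewrite /dslope ifF//; apply/eqP => vz.
  by move: vw; rewrite vz cmodB ltxx.
apply: holoM; first by apply: holoB; [exact: hf|exact: holo_cst].
apply: holoV; first by rewrite subr_eq0.
by apply: holoB; [exact: holo_id|exact: holo_cst].
Qed.

Let dslope_ccont d : cdiff f z d -> ccont (dslope d) z.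
Proof.
move=> df e e0; have [s s0 Hs] := df e e0; exists s => // w wr; rewrite /dslope eqxx.
have [_|wz] := eqVneq w z; first by rewrite subrr cmod0 ltW.
have wz0 : w - z != 0 by rewrite subr_eq0.
have -> : (f w - f z) / (w - z) - d = (f w - f z - d * (w - z)) / (w - z) :> C by field.
by rewrite cmodM cmodV ler_pdivrMr ?cmod_gt0// Hs.
Qed.

(* The circle means of [w * dslope w] vanish for radii below [cmod z], are constant
   above it, and the function is continuous across the circle through [z]. *)
Lemma cauchy_formula :
  f z = cmean (fun t => f (polar r t) * ((polar r t : C) / ((polar r t : C) - z))).
Proof.
have [d df] : holo f z by apply: hf; exact: lt_trans zr rrho.
pose g (w : C) := dslope d w * w.
have cg w : cmod w < rho -> ccont g w.
  move=> wr; apply: ccontM; last exact: ccont_id.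
  have [->|wz] := eqVneq w z; first exact: dslope_ccont.
  by apply: holo_ccont; exact: dslope_holo.
have bg s : 0 <= s -> s < rho -> bmC (fun t => g (polar s t)).
  by move=> s0 sr; apply: polar_circle_bmC => // w ws; apply: cg; rewrite ws.
have J0 : cmean (fun t => g (polar r t)) = 0.
  apply/eqP; rewrite -cmod_eq0; apply/eqP/le_anti; rewrite cmod_ge0 andbT.
  apply/ler_addgt0Pl => e e0; rewrite addr0.
  have [|s s0 Hs] := @annulus_unif_cont _ 0 r g _ e e0.
    by move=> w /andP[_ wr]; apply: cg; exact: le_lt_trans rrho.
  (* The radii [s1] and [s2] lie on the two sides of [cmod z], at most [s / 2] apart, so uniform
     continuity of [g] compares their means. *)
  pose s1 := Order.max 0 (cmod z - s / 4).
  pose s2 := Order.min r (cmod z + s / 4).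
  have s40 : 0 < s / 4 by rewrite divr_gt0.
  have s10 : 0 <= s1 by rewrite le_max lexx.
  have s1z : s1 <= cmod z by rewrite ge_max cmod_ge0/= lerBlDr lerDl ltW.
  have zs2 : cmod z < s2 by rewrite lt_min zr ltrDl.
  have s2r : s2 <= r by rewrite ge_min lexx.
  have s12 : `|s2 - s1| < s.
    have h1 : cmod z - s / 4 <= s1 by rewrite le_max lexx orbT.
    have h2 : s2 <= cmod z + s / 4 by rewrite ge_min lexx orbT.
    by rewrite ger0_norm; lra.
  have J1 : cmean (fun t => g (polar s1 t)) = 0.
    have g0 : g 0 = 0 by rewrite /g mulr0.
    have [z0|z0] := eqVneq z 0.
      have -> : s1 = 0 by apply/le_anti; rewrite s10 andbT (le_trans s1z)// z0 cmod0.
      by under eq_cmean do rewrite polar0; rewrite cmean_cst.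
    have mz : 0 < cmod z by rewrite cmod_gt0.
    rewrite (@cmean_value g (cmod z))//.
      by rewrite gt_max mz ltrBlDr ltrDl.
    move=> w wz; apply: holoM; last exact: holo_id.
    apply: dslope_holo; last by rewrite (lt_trans wz)// (lt_trans zr).
    by apply: contraTneq wz => ->; rewrite ltxx.
  have J2 : cmean (fun t => g (polar s2 t)) = cmean (fun t => g (polar r t)).
    apply: cmean_circle_const => //; first by rewrite (le_lt_trans _ zs2)// cmod_ge0.
    move=> w /andP[w1 w2]; apply: holoM; last exact: holo_id.
    apply: dslope_holo; last exact: le_lt_trans rrho.
    by apply: contraTneq w1 => ->; rewrite -ltNge.
  have s20 : 0 <= s2 by rewrite (le_trans s10)// (le_trans s1z)// ltW.
  rewrite -[cmean _]subr0 -J1 -J2 -cmeanB; last 2 first.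
  - by apply: bg => //; exact: le_lt_trans rrho.
  - by apply: bg => //; rewrite (le_lt_trans s1z)// (lt_trans zr).
  apply: cmod_cmean_le.
    apply: bmC_B; apply: bg => //; first exact: le_lt_trans rrho.
    by rewrite (le_lt_trans s1z)// (lt_trans zr).
  move=> t; apply: Hs.
    by rewrite cmod_polar ger0_norm// s10/= (le_trans s1z)// ltW.
  by rewrite (le_lt_trans (dist_polar _ _ _ _))// subrr normr0 mulr0 addr0.
have bk : bmC (fun t => (polar r t : C) / ((polar r t : C) - z)).
  apply: (@bmC_circle_holo (fun w => w / (w - z))) => w wr.
  by apply: holo_cauchy_kernel; exact: neq_circle.
have bf : bmC (fun t => f (polar r t)).
  by apply: bmC_circle_holo => w wr; apply: hf; rewrite wr.
apply/eqP; rewrite -subr_eq0 -oppr_eq0 opprB -J0; apply/eqP.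
rewrite -[in f z](mulr1 (f z)) -cmean_cauchy_kernel1 -cmeanZ// -cmeanB//; last first.
- exact: bmC_Z.
- exact: bmC_M.
apply: eq_cmean => t; rewrite /g /dslope ifF; last by apply/eqP/eqP; rewrite -subr_eq0.
by rewrite -mulrBl mulrA mulrAC.
Qed.

Lemma poisson_conj_part :
  cmean (fun t => f (polar r t) * ((((polar r t : C) / ((polar r t : C) - z)))^*)%C) = f 0.
Proof.
under eq_cmean do rewrite kernel_conj.
pose g (w : C) := f w * (((r ^+ 2)%:C)%C / (((r ^+ 2)%:C)%C - (z^*)%C * w)).
have r2 : ((r ^+ 2)%:C)%C != 0 :> C by rewrite -cmod_gt0 cmod_real normr_gt0 expf_neq0// gt_eqF.
have g0 : g 0 = f 0 by rewrite /g mulr0 subr0 divff// mulr1.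
rewrite -g0.
(* Radius of a disc on which both [f] and the conjugated kernel are holomorphic; for [z = 0] the
   kernel is constant and imposes no limit. *)
pose rho' := if z == 0 then rho else Order.min rho (r ^+ 2 / cmod z).
have hg w : cmod w < rho' -> cmod w < rho /\ cmod w * cmod z < r ^+ 2.
  rewrite /rho'; have [->|z0] := eqVneq z 0.
    by rewrite cmod0 mulr0 exprn_gt0.
  by rewrite lt_min ltr_pdivlMr ?cmod_gt0// => /andP[].
apply: (@cmean_value g rho') => //; first exact: ltW.
  rewrite /rho'; have [//|z0] := eqVneq z 0.
  by rewrite lt_min rrho/= ltr_pdivlMr ?cmod_gt0// expr2 ltr_pM2l.
by move=> w /hg[h1 h2]; apply: holoM; [exact: hf|exact: holo_conj_kernel].
Qed.

End cauchy.

(** Poisson kernel between two concentric circles. Only the ratio [rho] of the radii enters, so a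
    single family serves all pairs of circles. *)
Definition pker (rho th t : R) : R :=
  (1 - rho ^+ 2) / (1 - 2 * rho * cos (th - t) + rho ^+ 2).

Lemma pker_den (rho x : R) : 0 <= rho -> (1 - rho) ^+ 2 <= 1 - 2 * rho * cos x + rho ^+ 2.
Proof.
move=> r0; rewrite sqrrB expr1n mul1r lerD2r lerD2l lerN2 mulr_natl.
by rewrite ler_piMr ?mulrn_wge0// cos_le1.
Qed.

Lemma pker_den_gt0 (rho x : R) : 0 <= rho -> rho < 1 -> 0 < 1 - 2 * rho * cos x + rho ^+ 2.
Proof.
move=> r0 r1; apply: (lt_le_trans _ (pker_den x r0)).
by rewrite exprn_gt0// subr_gt0.
Qed.

Lemma pker_ge0 (rho th t : R) : 0 <= rho -> rho < 1 -> 0 <= pker rho th t.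
Proof.
move=> r0 r1; rewrite divr_ge0//; last exact/ltW/pker_den_gt0.
by rewrite subr_ge0 expr_le1// ltW.
Qed.

Lemma pkerC (rho th t : R) : pker rho th t = pker rho t th.
Proof. by rewrite /pker -cosN opprB. Qed.

Lemma bmeas_pker2 (rho : R) : 0 <= rho -> rho < 1 ->
  bmeas (fun x : R * R => pker rho x.1 x.2).
Proof.
move=> r0 r1.
pose G (x : R) := (1 - rho ^+ 2) / (1 - 2 * rho * cos x + rho ^+ 2).
have cG : continuous G.
  move=> x; apply: cvgM; first exact: cvg_cst.
  apply: cvgV; first by rewrite gt_eqF// pker_den_gt0.
  apply: cvgD; last exact: cvg_cst.
  apply: cvgB; first exact: cvg_cst.
  by apply: cvgM; [exact: cvg_cst|exact: continuous_cos].
split.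
  apply: (measurableT_comp (continuous_measurable_fun cG)).
  by apply: measurable_funB; [exact: measurable_fst|exact: measurable_snd].
exists ((1 - rho ^+ 2) / (1 - rho) ^+ 2) => x.
rewrite ger0_norm ?pker_ge0// ler_wpM2l//; first by rewrite subr_ge0 expr_le1// ltW.
by rewrite lef_pV2 ?posrE ?pker_den// ?pker_den_gt0// exprn_gt0// subr_gt0.
Qed.

Lemma bmeas_pker (rho th : R) : 0 <= rho -> rho < 1 -> bmeas (pker rho th).
Proof. by move=> r0 r1; apply: (bmeas_section1 th (bmeas_pker2 r0 r1)). Qed.

Lemma pker_cauchy (rho r th t : R) : 0 <= rho -> rho < 1 -> 0 < r ->
  let w : C := polar r t in let z : C := polar (rho * r) th in
  ((pker rho th t)%:C)%C = w / (w - z) + ((w / (w - z))^*)%C - 1.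
Proof.
move=> rho0 rho1 r0 w z.
rewrite addcJ.
have -> : w / (w - z) = (1 - (rho%:C)%C * expi (th - t))^-1 :> C.
  have w0 : w != 0 by rewrite -cmod_gt0 cmod_polar normr_gt0 gt_eqF.
  have -> : w - z = w * (1 - (rho%:C)%C * (expi (th - t) : C)).
    rewrite mulrBr mulr1 /z /w !polarE rmorphM /=; congr (_ - _).
    have -> : (expi th : C) = (expi t : C) * expi (th - t) by rewrite -expiD addrC subrK.
    by ring.
  by rewrite invfM mulrA divff// mul1r.
have D0 := pker_den_gt0 (th - t) rho0 rho1.
have DE : (1 - rho * cos (th - t)) ^+ 2 + (rho * sin (th - t)) ^+ 2 =
   1 - 2 * rho * cos (th - t) + rho ^+ 2.
  by have := cos2Dsin2 (th - t); move: (cos _) (sin _) => x y /(congr1 (fun u => rho ^+ 2 * u)); lra.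
rewrite /pker /expi; simpc => /=; simpc; apply/eqP; rewrite eq_complex /=; apply/andP; split.
  rewrite sqrrN DE; apply/eqP; field.
  by rewrite gt_eqF.
exact: eqxx.
Qed.

(** By [pker_cauchy] the kernel is [k + conj k - 1] with [k] the Cauchy kernel. Cauchy's formula
    handles [k], while [conj k] and [1] both produce [f 0] and cancel. *)
Lemma poisson_formula (f : C -> C) (rho r R0 th : R) : 0 <= rho -> rho < 1 -> 0 < r ->
  r < R0 -> (forall w, cmod w < R0 -> holo f w) ->
  f (polar (rho * r) th) = cmean (fun t => ((pker rho th t)%:C)%C * f (polar r t)).
Proof.
move=> rho0 rho1 r0 rR hf; set z : C := polar (rho * r) th.
have zr : cmod z < r.
  by rewrite cmod_polar ger0_norm ?mulr_ge0 ?(ltW r0)// gtr_pMl.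
pose k t : C := (polar r t : C) / ((polar r t : C) - z).
have bk : bmC k.
  apply: (@polar_circle_bmC _ (fun w => w / (w - z)) r (ltW r0)) => w wr.
  apply: ccontM; first exact: ccont_id.
  apply: ccontV.
    apply: ccontD; first exact: ccont_id.
    exact: ccont_cst.
  by rewrite subr_eq0; apply: contra_ltN zr => /eqP <-; rewrite wr.
have bk' : bmC (fun t => ((k t)^*)%C).
  case: bk => b1 b2; split.
    by rewrite (_ : (fun t => _) = (fun t => complex.Re (k t)))//; apply/funext => t; case: (k t).
  rewrite (_ : (fun t => _) = (fun t => - complex.Im (k t))); first exact: bmeasN.
  by apply/funext => t; case: (k t).
have bf : bmC (fun t => f (polar r t)).
  by apply: polar_circle_bmC (ltW r0) _ => w wr; apply: holo_ccont; apply: hf; rewrite wr.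
rewrite (@eq_cmean _ (fun t => f (polar r t) * k t + f (polar r t) * ((k t)^*)%C - f (polar r t))).
  rewrite cmeanB//; last by apply: bmC_D; exact: bmC_M.
  rewrite cmeanD//; [|exact: bmC_M..].
  rewrite (poisson_conj_part zr rR hf) -(cauchy_formula zr rR hf).
  rewrite (@cmean_value f R0 r (ltW r0) rR hf).
  by rewrite addrK.
move=> t; rewrite (pker_cauchy th t rho0 rho1 r0) -/z -/(k t).
by move: (f _) (k t) => u v; ring.
Qed.

Lemma mean_pker (rho th : R) : 0 <= rho -> rho < 1 -> mean (pker rho th) = 1.
Proof.
move=> r0 r1.
have := @poisson_formula (fun=> 1) rho 1 2 th r0 r1 ltr01 (ltr1n _ _) (fun w _ => holo_cst 1 w).
move/(congr1 (@complex.Re _)); rewrite Re_cmean [complex.Re 1]/= => ->.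
by apply: eq_mean => t; rewrite mulr1.
Qed.

End Poisson.

(** * The Poisson operator on bounded functions *)

Section PoissonOperator.
Context {R : realType}.
Local Notation C := R[i].
Implicit Types (v u : R -> R).

Definition Pois (rho : R) v (th : R) : R := mean (fun t => pker rho th t * v t).

Variable rho : R.
Hypotheses (rho0 : 0 <= rho) (rho1 : rho < 1).

Lemma bmeas_pker_mul2 v : bmeas v -> bmeas (fun x : R * R => pker rho x.1 x.2 * v x.2).
Proof.
move=> [mv [K HK]]; apply: bmeasM; first exact: bmeas_pker2.
by split; [exact: (measurableT_comp mv measurable_snd)|exists K].
Qed.

Lemma bmeas_Pois v : bmeas v -> bmeas (Pois rho v).
Proof. by move=> bv; exact: (bmeas_mean (bmeas_pker_mul2 bv)). Qed.

Lemma le_Pois v u th : bmeas v -> bmeas u -> (forall t, v t <= u t) ->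
  Pois rho v th <= Pois rho u th.
Proof.
move=> bv bu vu; apply: le_mean; [exact/bmeasM/bv/bmeas_pker|exact/bmeasM/bu/bmeas_pker|].
by move=> t _; rewrite ler_wpM2l// pker_ge0.
Qed.

Lemma Pois_ge0 v th : (forall t, 0 <= v t) -> 0 <= Pois rho v th.
Proof. by move=> v0; apply: mean_ge0 => t; rewrite mulr_ge0// pker_ge0. Qed.

Lemma Pois_affine v th a b : bmeas v ->
  Pois rho (fun t => a + b * v t) th = a + b * Pois rho v th.
Proof.
move=> bv; have bp : bmeas (pker rho th) by exact: bmeas_pker.
have bpv : bmeas (fun t => pker rho th t * v t) by exact: bmeasM.
rewrite /Pois (@eq_mean _ _ (fun t => a * pker rho th t + b * (pker rho th t * v t))).
  rewrite meanD; [|by apply: bmeasM => //; exact: bmeas_cst..].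
  by rewrite (meanZ a bp) (meanZ b bpv) mean_pker// mulr1.
by move=> t; ring.
Qed.

Lemma Pois_selfadjoint u v : bmeas u -> bmeas v ->
  mean (fun th => u th * Pois rho v th) = mean (fun t => Pois rho u t * v t).
Proof.
move=> bu bv.
pose F (x : R * R) := pker rho x.1 x.2 * v x.2 * u x.1.
have bF : bmeas F.
  apply: bmeasM; first exact: bmeas_pker_mul2.
  case: bu => mu [K HK].
  by split; [exact: (measurableT_comp mu measurable_fst)|exists K].
transitivity (mean (fun s => mean (fun t => F (s, t)))).
  apply: eq_mean => s; rewrite -meanZ.
    by apply: eq_mean => t; rewrite mulrC.
  by apply: bmeasM => //; exact: bmeas_pker.
rewrite mean_fubini//; apply: eq_mean => t.
rewrite mulrC -meanZ.
  by apply: eq_mean => s; rewrite /F /= pkerC; ring.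
by apply: bmeasM => //; exact: bmeas_pker.
Qed.

Lemma mean_Pois v : bmeas v -> mean (Pois rho v) = mean v.
Proof.
move=> bv; have := Pois_selfadjoint (bmeas_cst _ 1) bv.
rewrite (@eq_mean _ _ (Pois rho v)); last by move=> t; rewrite mul1r.
move=> ->; apply: eq_mean => t; rewrite -[RHS]mul1r; congr (_ * _).
rewrite -[RHS](mean_pker t rho0 rho1); apply: eq_mean => s; exact: mulr1.
Qed.

(** Jensen's inequality: the square lies above its tangent line at [a], and averaging an affine
    function of [v] gives the same affine function of [a]. *)
Lemma Pois_sqr v th : bmeas v -> Pois rho v th ^+ 2 <= Pois rho (fun t => v t ^+ 2) th.
Proof.
move=> bv; set a := Pois rho v th.
have -> : a ^+ 2 = Pois rho (fun t => - a ^+ 2 + 2 * a * v t) th.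
  by rewrite Pois_affine// -/a; ring.
apply: le_Pois; [|exact: bmeasX|].
  apply: bmeasD; first exact: bmeas_cst.
  by apply: bmeasM => //; exact: bmeas_cst.
move=> t; rewrite -subr_ge0.
have -> : v t ^+ 2 - (- a ^+ 2 + 2 * a * v t) = (v t - a) ^+ 2 by ring.
exact: sqr_ge0.
Qed.

End PoissonOperator.

(** * Jensen's inequality, semigroup law and defect of the Poisson operator *)

Section PoissonSemigroup.
Context {R : realType}.
Local Notation C := R[i].

(** For [p > 1] this is Young's inequality for [x] and [a ^ (p - 1)] with the exponents [p] and
    [p / (p - 1)]; for [p = 1] it is an equality. *)
Lemma powR_tangent (p x a : R) : 1 <= p -> 0 <= x -> 0 <= a ->
  a `^ p + p * a `^ (p - 1) * (x - a) <= x `^ p.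
Proof.
rewrite le_eqVlt => /predU1P[<-|p1] x0 a0.
  by rewrite subrr powRr0 !powRr1// !mul1r addrC subrK.
have p0 : 0 < p by exact: lt_trans p1.
have q0 : 0 < p / (p - 1) by rewrite divr_gt0// subr_gt0.
have pq : p^-1 + (p / (p - 1))^-1 = 1.
  by field; rewrite (gt_eqF p0)/= subr_eq0 (gt_eqF p1).
have := conjugate_powR x0 (powR_ge0 a (p - 1)) p0 q0 pq.
rewrite -powRrM (_ : (p - 1) * (p / (p - 1)) = p); last first.
  by field; rewrite subr_eq0 (gt_eqF p1).
move=> h.
have h2 : p * (x * a `^ (p - 1)) <= x `^ p + (p - 1) * a `^ p.
  have -> : x `^ p + (p - 1) * a `^ p = p * (x `^ p / p + a `^ p / (p / (p - 1))).
    by field; rewrite (gt_eqF p0)/= subr_eq0 (gt_eqF p1).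
  by rewrite ler_pM2l.
have h3 := mulr_powRB1 a0 p0.
move: h2 h3; move: (a `^ p) (x `^ p) (a `^ (p - 1)) => A X B h2 h3.
by rewrite -h3 in h2 *; lra.
Qed.

Lemma Pois_powR (rho p : R) (v : R -> R) th : 0 <= rho -> rho < 1 -> 1 <= p -> bmeas v ->
  (forall t, 0 <= v t) -> Pois rho v th `^ p <= Pois rho (fun t => v t `^ p) th.
Proof.
move=> rho0 rho1 p1 bv v0; set a := Pois rho v th.
have a0 : 0 <= a by exact: Pois_ge0.
have -> : a `^ p = Pois rho (fun t => (a `^ p - p * a `^ (p - 1) * a) + p * a `^ (p - 1) * v t) th.
  by rewrite Pois_affine// -/a subrK.
apply: le_Pois => //.
- apply: bmeasD; first exact: bmeas_cst.
  by apply: bmeasM => //; exact: bmeas_cst.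
- by apply: bmeas_powR => //; exact: le_trans p1.
- by move=> t; apply: le_trans (powR_tangent p1 (v0 t) a0); lra.
Qed.

(** As a function of its first angle, the kernel is the real part on the unit circle of the
    holomorphic function [G]; the law is the Poisson formula for [G]. *)
Lemma pker_semigroup (a b th t : R) : 0 <= a -> a < 1 -> 0 <= b -> b < 1 ->
  mean (fun s => pker a th s * pker b s t) = pker (a * b) th t.
Proof.
move=> a0 a1 b0 b1.
pose W : C := polar 1 t.
pose G (w : C) : C := 2 * (W / (W - (b%:C)%C * w)) - 1.
have W1 : cmod W = 1 by rewrite cmod_polar normr1.
have bE c s : 0 <= c -> c < 1 -> forall w, (b%:C)%C * w = polar (c * 1) s :> C ->
    complex.Re (G w) = pker c s t.
  move=> c0 c1 w wE.
  have : ((pker c s t)%:C)%C = W / (W - polar (c * 1) s) + ((W / (W - polar (c * 1) s))^*)%C - 1.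
    exact: pker_cauchy s t c0 c1 ltr01.
  rewrite -wE addcJ => /(congr1 (@complex.Re _)); rewrite [LHS]/= => ->.
  by rewrite /G; move: (W / _) => [x y] /=; rewrite !(mul0r, mulr0, addr0, subr0).
(* The pole of [G] has modulus [1 / b]; the radius [2 / (1 + b)] lies between 1 and [1 / b] and
   remains meaningful at [b = 0]. *)
have h : forall w : C, cmod w < 2 / (1 + b) -> holo G w.
  have b10 : 0 < 1 + b by rewrite ltr_pwDl.
  move=> w hw; apply: holoB; last exact: holo_cst.
  apply: holoZ; apply: holoM; first exact: holo_cst.
  apply: holoV; last by apply: holoB; [exact: holo_cst|apply: holoZ; exact: holo_id].
  rewrite -cmod_gt0 (lt_le_trans _ (cmod_sub_ge _ _))// W1 subr_gt0 cmodM cmod_real ger0_norm//.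
  move: hw; rewrite ltr_pdivlMr// => hw; have := cmod_ge0 w; nra.
have R1 : 1 < 2 / (1 + b) by rewrite ltr_pdivlMr; lra.
have := poisson_formula th a0 a1 ltr01 R1 h.
move/(congr1 (@complex.Re _)); rewrite Re_cmean.
have ab0 : 0 <= a * b by rewrite mulr_ge0.
have ab1 : a * b < 1 by rewrite (le_lt_trans _ a1)// ler_piMr// ltW.
rewrite (bE (a * b) th ab0 ab1); last first.
  by rewrite !polarE !mulr1 rmorphM /=; ring.
move=> ->; apply: eq_mean => s; rewrite cReM (bE b s b0 b1) /= ?mul0r ?subr0//.
by rewrite !polarE mulr1 /= mul1r.
Qed.

Lemma Pois_semigroup (a b : R) (v : R -> R) th : 0 <= a -> a < 1 -> 0 <= b -> b < 1 ->
  bmeas v -> Pois a (Pois b v) th = Pois (a * b) v th.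
Proof.
move=> a0 a1 b0 b1 bv.
pose F (x : R * R) := pker b x.1 x.2 * v x.2 * pker a th x.1.
have bF : bmeas F.
  apply: bmeasM; first exact: bmeas_pker_mul2.
  case: (bmeas_pker th a0 a1) => mp [K HK].
  by split; [exact: (measurableT_comp mp measurable_fst)|exists K].
transitivity (mean (fun s => mean (fun t => F (s, t)))).
  apply: eq_mean => s; rewrite -meanZ.
    by apply: eq_mean => t; rewrite mulrC.
  by apply: bmeasM => //; exact: bmeas_pker.
rewrite mean_fubini//; apply: eq_mean => t.
rewrite -(pker_semigroup th t a0 a1 b0 b1) mulrC -meanZ.
  by apply: eq_mean => s; rewrite /F /=; ring.
apply: bmeasM; first exact: bmeas_pker.
by apply: (bmeas_section2 t (bmeas_pker2 b0 b1)).
Qed.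

(* [Pois] is a positive self-adjoint contraction of L2 (it is the square of
   [Pois (Num.sqrt rho)]), hence [|v - Pv|^2 <= |v|^2 - |Pv|^2]. *)
Lemma Pois_defect (rho : R) (v : R -> R) : 0 <= rho -> rho < 1 -> bmeas v ->
  mean (fun t => (v t - Pois rho v t) ^+ 2) <=
  mean (fun t => v t ^+ 2) - mean (fun t => Pois rho v t ^+ 2).
Proof.
move=> rho0 rho1 bv.
pose s := Num.sqrt rho.
have s0 : 0 <= s by exact: sqrtr_ge0.
have ss : s * s = rho by rewrite -expr2 sqr_sqrtr.
have s1 : s < 1 by rewrite -(@ltr_pXn2r _ 2)// ?nnegrE// expr1n expr2 ss.
pose q := Pois s v.
have bq : bmeas q by exact: bmeas_Pois.
have PE th : Pois rho v th = Pois s q th by rewrite Pois_semigroup// ss.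
have bP : bmeas (Pois rho v) by exact: bmeas_Pois.
have vP : mean (fun t => v t * Pois rho v t) = mean (fun t => q t ^+ 2).
  rewrite (@eq_mean _ _ (fun t => v t * Pois s q t)); last by move=> t; rewrite PE.
  by rewrite Pois_selfadjoint//.
have bq2 := bmeasX 2 bq; have bP2 := bmeasX 2 bP; have bv2 := bmeasX 2 bv.
have PP : mean (fun t => Pois rho v t ^+ 2) <= mean (fun t => q t ^+ 2).
  rewrite -(mean_Pois s0 s1 bq2); apply: (le_mean bP2 (bmeas_Pois s0 s1 bq2)).
  by move=> t _; rewrite PE; exact: Pois_sqr.
have bvP := bmeasM bv bP.
move: (Pois rho v) q vP PP bP2 bvP {PE bP bq bq2} => P q vP PP bP2 bvP.
rewrite (@eq_mean _ _ (fun t => (v t ^+ 2 + P t ^+ 2) - 2 * (v t * P t))); last first.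
  by move=> t; ring.
rewrite (meanB (bmeasD bv2 bP2) (bmeasM (bmeas_cst _ 2) bvP)) (meanD bv2 bP2) (meanZ 2 bvP) vP.
by move: (mean _) (mean _) (mean _) PP => A B D; lra.
Qed.

End PoissonSemigroup.

(** * Sub-mean inequality for the square root of the modulus of a polynomial *)

Section SquareRoot.
Context {R : realType}.
Local Notation C := R[i].
Local Notation Re := complex.Re.
Local Notation Im := complex.Im.

(** The sign is normalised by the real part, which makes the root continuous on the right
    half-plane. *)
Definition csqrt (v : C) : C := let s := sqrtc v in if 0 < Re s then s else - s.

Lemma csqrt_sqr v : csqrt v ^+ 2 = v.
Proof. by rewrite /csqrt; case: ifP => _; rewrite ?sqrrN sqr_sqrtc. Qed.

Lemma Re_csqrt_gt0 v : 0 < Re v -> 0 < Re (csqrt v).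
Proof.
rewrite -{1}(sqr_sqrtc v) /csqrt; case: (sqrtc v) => x y /= xy.
case: ifPn => //=; rewrite -leNgt oppr_gt0 lt_neqAle => ->; rewrite andbT.
by apply: contraTneq xy => ->; rewrite mul0r sub0r oppr_gt0 -leNgt -expr2 sqr_ge0.
Qed.

(** The difference of two roots is [(w - v)] divided by their sum, and the sum stays away from zero
    because both real parts are positive. *)
Lemma holo_csqrt v : 0 < Re v -> holo csqrt v.
Proof.
move=> v0; have s0 := Re_csqrt_gt0 v0.
have near w : cmod (w - v) < Re v -> 0 < Re w.
  move=> h; have := le_lt_trans (cmod_Re _) h.
  by rewrite cReD cReN ltr_norml => /andP[]; lra.
have sE w : cmod (w - v) < Re v -> csqrt w + csqrt v != 0 /\
    Re (csqrt v) <= cmod (csqrt w + csqrt v).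
  move=> /near/Re_csqrt_gt0 w0.
  have h : Re (csqrt v) <= cmod (csqrt w + csqrt v).
    rewrite (le_trans _ (cmod_Re _))// cReD (le_trans _ (ler_norm _))//.
    by rewrite lerDr ltW.
  by split => //; rewrite -cmod_gt0 (lt_le_trans s0).
have dE w : cmod (w - v) < Re v -> csqrt w = csqrt v + (csqrt w + csqrt v)^-1 * (w - v).
  move=> /sE[h _]; rewrite -[in w - v](csqrt_sqr w) -[in X in _ - X](csqrt_sqr v).
  by field.
have cs : ccont csqrt v.
  move=> e e0; exists (Order.min (Re v) (e * Re (csqrt v))).
    by rewrite lt_min v0 mulr_gt0.
  move=> w; rewrite lt_min => /andP[h1 h2]; have [h3 h4] := sE _ h1.
  rewrite dE// addrAC subrr add0r cmodM cmodV mulrC ler_pdivrMr ?(lt_le_trans s0)//.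
  by rewrite (le_trans (ltW h2))// ler_wpM2l// ltW.
apply/holoP; exists (fun w => (csqrt w + csqrt v)^-1); split; last by exists (Re v).
apply: ccontV; first by apply: ccontD => //; exact: ccont_cst.
by have [] := sE v (ltac:(by rewrite subrr cmod0)).
Qed.

(* The linear factor [w - a], reflected in the circle of radius [r] when [a] is inside. *)
Definition outer_factor (r : R) (a w : C) : C :=
  if cmod a < r then (r%:C)%C - (a^*)%C * w / (r%:C)%C else w - a.

(** One identity gives both facts about the reflected factor: equality of moduli on the circle,
    where the last term vanishes, and domination inside, where it is nonnegative. *)
Lemma outer_factor_reflect (r : R) (a w : C) : 0 < r ->
  cmod ((r%:C)%C - (a^*)%C * w / (r%:C)%C) ^+ 2 =
  cmod (w - a) ^+ 2 + (r ^+ 2 - cmod a ^+ 2) * (r ^+ 2 - cmod w ^+ 2) / r ^+ 2.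
Proof.
move=> r0; rewrite -fmorphV; case: a w => a1 a2 [w1 w2]; rewrite !sqr_cmod.
simpc => /=; field.
by rewrite gt_eqF.
Qed.

Lemma cmod_outer_factor_circle (r : R) (a w : C) : 0 < r -> cmod w = r ->
  cmod (outer_factor r a w) = cmod (w - a).
Proof.
move=> r0 wr; rewrite /outer_factor; case: ifP => // _.
apply/eqP; rewrite -(@eqrXn2 _ 2)// ?cmod_ge0//.
by rewrite outer_factor_reflect// wr subrr mulr0 mul0r addr0.
Qed.

Lemma cmod_outer_factor_ge (r : R) (a w : C) : 0 < r -> cmod w <= r ->
  cmod (w - a) <= cmod (outer_factor r a w).
Proof.
move=> r0 wr; rewrite /outer_factor; case: ifP => // ar.
rewrite -(@ler_pXn2r _ 2) ?nnegrE ?cmod_ge0// outer_factor_reflect// lerDl.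
apply: divr_ge0; last exact: sqr_ge0.
by apply: mulr_ge0; rewrite subr_ge0 !expr2 ler_pM ?cmod_ge0// ltW.
Qed.

(** With [cmod b <= r^-1], the factor [1 - b w] has positive real part for [cmod w < r], hence a
    holomorphic square root there. *)
Lemma outer_factor_linear (r : R) (a : C) : 0 < r -> exists c b : C,
  cmod b <= r^-1 /\ forall w, outer_factor r a w = c * (1 - b * w).
Proof.
move=> r0; rewrite /outer_factor; case: ltP => ar.
  have rC : (r%:C)%C != 0 :> C by rewrite -cmod_gt0 cmod_real normr_gt0 gt_eqF.
  exists (r%:C)%C, ((a^*)%C / (r%:C)%C ^+ 2); split; last by move=> w; field.
  rewrite cmodM cmodV cmodX cmodJ cmod_real gtr0_norm// ler_pdivrMr ?exprn_gt0//.
  by rewrite expr2 mulKf ?gt_eqF// ltW.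
have a0 : a != 0 by rewrite -cmod_gt0 (lt_le_trans r0).
exists (- a), a^-1; split; last by move=> w; field.
by rewrite cmodV lef_pV2 ?posrE// (lt_le_trans r0).
Qed.

Lemma outer_factor_sqrt (r : R) (a : C) : 0 < r -> exists h : C -> C,
  forall w, cmod w < r -> holo h w /\ h w ^+ 2 = outer_factor r a w.
Proof.
move=> r0; have [c [b [br E]]] := outer_factor_linear a r0.
exists (fun w => sqrtc c * csqrt (1 - b * w)) => w wr; split; last first.
  by rewrite exprMn sqr_sqrtc csqrt_sqr E.
apply: holoZ; apply: (@holo_comp _ (fun w => 1 - b * w)).
  by apply: holoB; [exact: holo_cst|apply: holoZ; exact: holo_id].
apply: holo_csqrt; rewrite cReD cReN subr_gt0 /=.
rewrite (le_lt_trans (ler_norm _))// (le_lt_trans (cmod_Re _))// cmodM.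
have [w0|w0] := eqVneq w 0; first by rewrite w0 cmod0 mulr0.
rewrite (le_lt_trans (ler_wpM2r (cmod_ge0 _) br))// mulrC ltr_pdivrMr// mul1r//.
Qed.

Lemma holo_outer_factor (r : R) (a w : C) : holo (outer_factor r a) w.
Proof.
have [h|h] := boolP (cmod a < r).
  apply: (holo_near_eq ltr01 (f := fun w => (r%:C)%C - (a^*)%C / (r%:C)%C * w)).
    by move=> v _; rewrite /outer_factor h mulrAC.
  by apply: holoB; [exact: holo_cst|apply: holoZ; exact: holo_id].
apply: (holo_near_eq ltr01 (f := fun w => w - a)).
  by move=> v _; rewrite /outer_factor (negbTE h).
by apply: holoB; [exact: holo_id|exact: holo_cst].
Qed.

Lemma sqrt_approx (x y e : R) : 0 <= y -> 0 <= e -> `|x - y| <= e ^+ 2 ->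
  Num.sqrt x <= Num.sqrt y + e.
Proof.
move=> y0 e0; rewrite ler_norml => /andP[_ h].
have s0 := sqrtr_ge0 y.
rewrite -[leRHS]ger0_norm ?addr_ge0// -sqrtr_sqr ler_wsqrtr// sqrrD sqr_sqrtr//.
have : 0 <= Num.sqrt y * e by rewrite mulr_ge0.
rewrite mulr2n; lra.
Qed.

Lemma Pois_approx (rho th x : R) (v : R -> R) : 0 <= rho -> rho < 1 -> bmeas v ->
  (forall e, 0 < e -> exists u, [/\ bmeas u, forall t, u t <= v t + e & x <= Pois rho u th + e]) ->
  x <= Pois rho v th.
Proof.
move=> rho0 rho1 bv H; apply/ler_addgt0Pl => e e0.
have [u [bu uv xu]] := H (e / 2) (divr_gt0 e0 (ltr0n _ 2)).
rewrite (le_trans xu)// {2}(splitr e) addrC -addrA lerD2l.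
have -> : e / 2 + Pois rho v th = Pois rho (fun t => e / 2 + 1 * v t) th.
  by rewrite Pois_affine// mul1r.
apply: le_Pois => //.
  apply: bmeasD; first exact: bmeas_cst.
  by apply: bmeasM => //; exact: bmeas_cst.
by move=> t; rewrite mul1r addrC.
Qed.

Lemma bmeas_circle_sqrt (f : C -> C) (r : R) : 0 <= r ->
  (forall w, cmod w = r -> ccont f w) -> bmeas (fun t => Num.sqrt (cmod (f (polar r t)))).
Proof.
move=> r0 cf; apply: bmeas_sqrt; first by move=> t; exact: cmod_ge0.
by apply: bmC_cmod; exact: polar_circle_bmC.
Qed.

Lemma holo_horner (p : {poly C}) w : holo (fun w => p.[w]) w.
Proof.
apply: (holo_near_eq ltr01 (f := fun w => \sum_(i < size p) p`_i * w ^+ i)).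
  by move=> v _; rewrite horner_coef.
by apply: holo_sum => i; apply: holoZ; apply: holoX; exact: holo_id.
Qed.

(** Reflecting the zeros inside the circle gives [F] with the modulus of [p] on the circle, at least
    that modulus inside, and no zero in the open disc. There [F] is the square of a holomorphic [H],
    so the root of [cmod F] is [cmod H] and the Poisson formula for [H] concludes. *)
Lemma poly_sqrt_submean (p : {poly C}) (rho r th : R) : 0 <= rho -> rho < 1 -> 0 < r ->
  Num.sqrt (cmod p.[polar (rho * r) th]) <=
  Pois rho (fun t => Num.sqrt (cmod p.[polar r t])) th.
Proof.
move=> rho0 rho1 r0; have [s ps] := closed_field_poly_normal p.
set c := lead_coef p in ps.
have pE w : p.[w] = c * \prod_(a <- s) (w - a).
  by rewrite ps hornerZ horner_prod; congr (_ * _); apply: eq_bigr => a _; rewrite hornerXsubC.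
pose F (w : C) := c * \prod_(a <- s) outer_factor r a w.
have hF w : holo F w.
  by apply: holoZ; apply: holo_prod => a; exact: holo_outer_factor.
have cprod (G : C -> C) : cmod (\prod_(a <- s) G a) = \prod_(a <- s) cmod (G a).
  by elim: s {ps pE F hF} => [|a s IH]; rewrite ?big_nil ?cmod1// !big_cons cmodM IH.
have Fcirc w : cmod w = r -> cmod (F w) = cmod p.[w].
  move=> wr; rewrite pE !cmodM !cprod; congr (_ * _).
  by apply: eq_bigr => a _; rewrite cmod_outer_factor_circle.
have Fge w : cmod w <= r -> cmod p.[w] <= cmod (F w).
  move=> wr; rewrite pE !cmodM !cprod ler_wpM2l ?cmod_ge0//.
  by apply: ler_prod => a _; rewrite cmod_ge0/= cmod_outer_factor_ge.
have [h Hh] := choice (fun a => outer_factor_sqrt a r0).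
pose H (w : C) := sqrtc c * \prod_(a <- s) h a w.
have hH w : cmod w < r -> holo H w.
  by move=> wr; apply: holoZ; apply: holo_prod => a; case: (Hh a w wr).
have H2 w : cmod w < r -> cmod (H w) = Num.sqrt (cmod (F w)).
  move=> wr; rewrite -[LHS]ger0_norm ?cmod_ge0// -sqrtr_sqr -cmodX; congr (Num.sqrt (cmod _)).
  rewrite exprMn sqr_sqrtc; congr (_ * _).
  elim: s {ps pE F hF cprod Fcirc Fge H hH} => [|a s IH]; rewrite ?big_nil ?expr1n//.
  by rewrite !big_cons exprMn IH (Hh a w wr).2.
have cr t : cmod (polar r t : C) = r by rewrite cmod_polar gtr0_norm.
have -> : (fun t => Num.sqrt (cmod p.[polar r t])) = (fun t => Num.sqrt (cmod (F (polar r t)))).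
  by apply/funext => t; rewrite Fcirc.
have zr : cmod (polar (rho * r) th : C) <= r.
  by rewrite cmod_polar ger0_norm ?mulr_ge0 ?(ltW r0)// ger_pMl// ltW.
apply: (@le_trans _ _ (Num.sqrt (cmod (F (polar (rho * r) th))))).
  by rewrite ler_wsqrtr// Fge.
apply: Pois_approx => //.
  by apply: bmeas_circle_sqrt (ltW r0) _ => w _; apply: holo_ccont.
move=> e e0.
have [d d0 Hd] := annulus_unif_cont (ra := 0) (rb := r) (f := F)
  (fun w _ => holo_ccont (hF w)) (exprn_gt0 2 e0).
(* [H] is holomorphic only in the open disc, since [F] may vanish on the circle. The Poisson formula
   is used at radius [sg * r], within [d] of [r], and uniform continuity of [F] absorbs the
   change. *)
pose sg := Order.max (1 / 2) (1 - d / (2 * r)).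
have sg0 : 0 < sg by rewrite lt_max divr_gt0.
have sg1 : sg < 1.
  rewrite gt_max ltrBlDr ltrDl divr_gt0 ?mulr_gt0// andbT; lra.
have sgr : sg * r < r by rewrite gtr_pMl.
have sgr0 : 0 < sg * r by rewrite mulr_gt0.
have dsg : (1 - sg) * r < d.
  have : 1 - d / (2 * r) <= sg by rewrite le_max lexx orbT.
  rewrite lerBlDr -lerBlDl ler_pdivlMr ?mulr_gt0// => h'.
  lra.
have close x t : 0 <= x <= 1 ->
    cmod (F (polar (x * (sg * r)) t) - F (polar (x * r) t)) <= e ^+ 2.
  move=> /andP[x0 x1]; apply: Hd.
    by rewrite cmod_polar ger0_norm ?mulr_ge0 ?(ltW r0)//= ler_piMl// ltW.
  apply: (le_lt_trans (dist_polar _ _ _ _)); rewrite subrr normr0 mulr0 addr0.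
  rewrite -mulrBr normrM ger0_norm// -{2}(mul1r r) -mulrBl normrM distrC.
  rewrite (ger0_norm (_ : 0 <= 1 - sg)) ?subr_ge0 ?(ltW sg1)// gtr0_norm//.
  by apply: le_lt_trans dsg; rewrite ler_piMl// mulr_ge0 ?subr_ge0 ?ltW.
exists (fun t => cmod (H (polar (sg * r) t))); split.
- apply: bmC_cmod; apply: polar_circle_bmC (ltW sgr0) _ => w wr; apply: holo_ccont.
  by apply: hH; rewrite wr.
- move=> t; rewrite H2; last by rewrite cmod_polar gtr0_norm.
  apply: sqrt_approx; rewrite ?cmod_ge0 ?(ltW e0)//.
  rewrite (le_trans (cmod_dist_le _ _))//.
  by have := close 1 t; rewrite !mul1r; apply; rewrite ler01 lexx.
- apply: (@le_trans _ _ (Num.sqrt (cmod (F (polar (rho * (sg * r)) th))) + e)).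
    apply: sqrt_approx; rewrite ?cmod_ge0 ?(ltW e0)//.
    rewrite distrC (le_trans (cmod_dist_le _ _))//.
    by apply: close; rewrite rho0/= ltW.
  have zsr : cmod (polar (rho * (sg * r)) th : C) < r.
    rewrite cmod_polar ger0_norm ?mulr_ge0// ?(ltW r0)// ?(ltW sg0)//.
    by rewrite (le_lt_trans _ sgr)// ler_piMl ?(ltW rho1)// ltW.
  rewrite lerD2r -H2// (poisson_formula th rho0 rho1 sgr0 sgr hH).
  apply: (le_trans (cmod_cmean _)).
    apply: bmC_M; first exact/bmC_real/bmeas_pker.
    apply: polar_circle_bmC (ltW sgr0) _ => w wr; apply: holo_ccont.
    by apply: hH; rewrite wr.
  rewrite le_eqVlt; apply/orP; left; apply/eqP; apply: eq_mean => t.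
  by rewrite cmodM cmod_real ger0_norm// pker_ge0.
Qed.

End SquareRoot.

(** * Sub-mean inequalities and growth of integral means *)

Section Submean.
Context {R : realType}.
Local Notation C := R[i].

Lemma expr_small (q e : R) : 0 <= q -> q < 1 -> 0 < e -> exists N, q ^+ N <= e.
Proof.
move=> q0 q1 e0.
have q1' : `|q| < 1 by rewrite ger0_norm.
have /cvgrPdist_le/(_ _ e0)[N _ HN] := cvg_expr q1'.
exists N; have := HN N (leqnn N); rewrite sub0r normrN ger0_norm// exprn_ge0//.
Qed.

(** Truncating the geometric series of the Cauchy kernel on an intermediate circle leaves
    [(z / w) ^ N] times the kernel as remainder. *)
Lemma poly_approx (f : C -> C) (R0 r e : R) : 0 < r -> r < R0 -> 0 < e ->
  (forall w : C, cmod w < R0 -> holo f w) ->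
  exists p : {poly C}, forall w : C, cmod w <= r -> cmod (f w - p.[w]) <= e.
Proof.
move=> r0 rR e0 hf.
have [s rs sR] : exists2 s, r < s & s < R0 by exists ((r + R0) / 2); lra.
have s0 := lt_trans r0 rs.
have sr0 : 0 < s - r by rewrite subr_gt0.
have cf w : cmod w = s -> ccont f w by move=> ws; apply/holo_ccont/hf; rewrite ws.
have bf : bmC (fun t => f (polar s t)) by exact: polar_circle_bmC (ltW s0) cf.
have [K K0 HK] : exists2 K, 0 <= K & forall t, cmod (f (polar s t)) <= K.
  have [|K K0 HK] := @annulus_bounded _ s s f.
    by move=> w; rewrite -eq_le eq_sym => /eqP; exact: cf.
  by exists K => // t; apply: HK; rewrite cmod_polar gtr0_norm// lexx.
have K1 : 0 < K + 1 by apply: ltr_wpDl.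
have cs t : cmod (polar s t : C) = s by rewrite cmod_polar gtr0_norm.
have ps0 t : (polar s t : C) != 0 by rewrite -cmod_gt0 cs.
(* Solves [(K + 1) (r / s)^N s / (s - r) <= e], where [s / (s - r)] bounds the kernel; [K + 1]
   avoids dividing by zero. *)
have [N HN] : exists N, (r / s) ^+ N <= e * (s - r) / (s * (K + 1)).
  apply: expr_small; first by rewrite divr_ge0// ltW.
    by rewrite ltr_pdivrMr// mul1r.
  by apply: divr_gt0; exact: mulr_gt0.
have bpow n : bmC (fun t => f (polar s t) * (polar s t : C) ^- n).
  apply: bmC_M => //.
  apply: (@polar_circle_bmC _ (fun w => w ^- n)) => [|w ws]; first exact: ltW.
  apply: ccontV; last by rewrite expf_neq0// -cmod_gt0 ws.
  by apply: holo_ccont; apply: holoX; exact: holo_id.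
pose a n := cmean (fun t => f (polar s t) * (polar s t : C) ^- n).
exists (\poly_(i < N) a i) => z zr; rewrite horner_poly.
have zs : cmod z < s by exact: le_lt_trans rs.
pose k t : C := (polar s t : C) / ((polar s t : C) - z).
have kz t : (polar s t : C) - z != 0.
  by rewrite -cmod_gt0 (lt_le_trans _ (cmod_sub_ge _ _))// cs subr_gt0.
have bk : bmC k.
  apply: (@polar_circle_bmC _ (fun w => w / (w - z))) => [|w ws]; first exact: ltW.
  apply: ccontM; first exact: ccont_id.
  apply: ccontV; first by apply: ccontD; [exact: ccont_id|exact: ccont_cst].
  by rewrite subr_eq0; apply: contraTneq zs => <-; rewrite ws ltxx.
have bsum m : bmC (fun t => \sum_(i < m) f (polar s t) * (polar s t : C) ^- i * z ^+ i).
  elim: m => [|m IH]; first by under eq_fun do rewrite big_ord0; exact: bmC_cst.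
  under eq_fun do rewrite big_ord_recr /=.
  by apply: bmC_D => //; apply: bmC_M => //; exact: bmC_cst.
have sumE m : \sum_(i < m) a i * z ^+ i =
    cmean (fun t => \sum_(i < m) f (polar s t) * (polar s t : C) ^- i * z ^+ i).
  elim: m => [|m IH].
    by rewrite big_ord0 (@eq_cmean _ _ (fun=> 0)) ?cmean_cst// => t; rewrite big_ord0.
  rewrite big_ord_recr /= IH /a mulrC -cmeanZ// -cmeanD//; last exact: bmC_Z.
  by apply: eq_cmean => t; rewrite big_ord_recr /= [z ^+ m * _]mulrC.
rewrite sumE (cauchy_formula zs sR hf) -cmeanB//; last exact: bmC_M.
apply: cmod_cmean_le; first by apply: bmC_B => //; exact: bmC_M.
move=> t; move: (polar s t : C) (cs t) (ps0 t) (kz t) (HK t) => w cw w0 wz Hw.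
have -> : f w * (w / (w - z)) - \sum_(i < N) f w * w ^- i * z ^+ i =
    f w * ((z / w) ^+ N * (w / (w - z))).
  have -> : \sum_(i < N) f w * w ^- i * z ^+ i = f w * \sum_(i < N) (z / w) ^+ i.
    rewrite mulr_sumr; apply: eq_bigr => i _.
    by rewrite expr_div_n mulrA mulrAC.
  rewrite -mulrBr; congr (_ * _).
  have E := subrX1 (z / w) N.
  have nz : z / w - 1 != 0.
    have -> : z / w - 1 = - ((w - z) / w) by field; exact: w0.
    by rewrite oppr_eq0 mulf_neq0 ?invr_eq0 ?wz ?w0.
  have -> : \sum_(i < N) (z / w) ^+ i = ((z / w) ^+ N - 1) / (z / w - 1).
    by rewrite E mulrAC mulfV// mul1r.
  move: nz; move: ((z / w) ^+ N) => X nz.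
  have -> : z / w - 1 = - ((w - z) / w) by field; exact: w0.
  by field; rewrite w0 wz.
rewrite !cmodM !cmodX !cmodM !cmodV cw.
apply: (@le_trans _ _ ((K + 1) * ((r / s) ^+ N * (s / (s - r))))).
  apply: ler_pM; rewrite ?cmod_ge0 ?mulr_ge0 ?exprn_ge0 ?mulr_ge0 ?invr_ge0 ?cmod_ge0 ?(ltW s0)//.
    by rewrite (le_trans Hw)// lerDl.
  apply: ler_pM; rewrite ?mulr_ge0 ?exprn_ge0 ?mulr_ge0 ?invr_ge0 ?cmod_ge0 ?(ltW s0)//.
    by rewrite lerXn2r ?nnegrE ?mulr_ge0 ?invr_ge0 ?cmod_ge0 ?(ltW s0) ?(ltW r0)// ler_wpM2r ?invr_ge0// ltW.
  rewrite ler_wpM2l ?(ltW s0)// lef_pV2 ?posrE//.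
    by rewrite (le_trans _ (cmod_sub_ge _ _))// cw lerD2l lerN2.
  by rewrite cmod_gt0.
rewrite mulrCA -ler_pdivlMr; last by apply: mulr_gt0 => //; exact: divr_gt0.
apply: (le_trans HN); rewrite le_eqVlt; apply/orP; left; apply/eqP; field.
by rewrite !gt_eqF.
Qed.

Lemma sqrt_submean (f : C -> C) (R0 rho r th : R) : 0 <= rho -> rho < 1 -> 0 < r -> r < R0 ->
  (forall w : C, cmod w < R0 -> holo f w) ->
  Num.sqrt (cmod (f (polar (rho * r) th))) <=
  Pois rho (fun t => Num.sqrt (cmod (f (polar r t)))) th.
Proof.
move=> rho0 rho1 r0 rR hf; apply: Pois_approx => //.
  by apply: bmeas_circle_sqrt (ltW r0) _ => w wr; apply/holo_ccont/hf; rewrite wr.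
move=> e e0; have [p Hp] := poly_approx r0 rR (exprn_gt0 2 e0) hf.
exists (fun t => Num.sqrt (cmod p.[polar r t])); split.
- by apply: bmeas_circle_sqrt (ltW r0) _ => w wr; exact/holo_ccont/holo_horner.
- move=> t; apply: sqrt_approx; rewrite ?cmod_ge0 ?(ltW e0)//.
  by rewrite distrC (le_trans (cmod_dist_le _ _))// Hp// cmod_polar gtr0_norm.
- rewrite (le_trans _ (lerD (poly_sqrt_submean p th rho0 rho1 r0) (lexx e)))//.
  apply: sqrt_approx; rewrite ?cmod_ge0 ?(ltW e0)//.
  rewrite (le_trans (cmod_dist_le _ _))// Hp// cmod_polar ger0_norm ?mulr_ge0 ?(ltW r0)//.
  by rewrite ler_piMl// ltW.
Qed.

(** The power [p / 2] is the [p]-th power of the square root, and [p >= 1] allows Jensen's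
    inequality: the exponent [1/2] was the only hard case. *)
Lemma powR_submean (f : C -> C) (p R0 rho r th : R) : 1 <= p ->
  0 <= rho -> rho < 1 -> 0 < r -> r < R0 ->
  (forall w : C, cmod w < R0 -> holo f w) ->
  cmod (f (polar (rho * r) th)) `^ (p / 2) <=
  Pois rho (fun t => cmod (f (polar r t)) `^ (p / 2)) th.
Proof.
move=> p1 rho0 rho1 r0 rR hf.
have E x : cmod (f x) `^ (p / 2) = Num.sqrt (cmod (f x)) `^ p.
  by rewrite -powR12_sqrt ?cmod_ge0// -powRrM mulrC.
under [X in Pois _ X]eq_fun do rewrite E.
rewrite E.
have bs : bmeas (fun t => Num.sqrt (cmod (f (polar r t)))).
  by apply: bmeas_circle_sqrt (ltW r0) _ => w wr; apply/holo_ccont/hf; rewrite wr.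
have s0 t : 0 <= Num.sqrt (cmod (f (polar r t))) by exact: sqrtr_ge0.
apply: le_trans (Pois_powR th rho0 rho1 p1 bs s0).
apply: ge0_ler_powR; rewrite ?nnegrE ?sqrtr_ge0 ?Pois_ge0// ?(le_trans _ p1)//.
exact: (sqrt_submean th rho0 rho1 r0 rR hf).
Qed.

Definition disc_holo (f : C -> C) := forall w : C, cmod w < 1 -> holo f w.

Definition Jp (p : R) (f : C -> C) (r : R) : R := mean (fun t => cmod (f (polar r t)) `^ p).

Lemma bmeas_Jp (p r : R) (f : C -> C) : disc_holo f -> 0 <= p -> 0 <= r -> r < 1 ->
  bmeas (fun t => cmod (f (polar r t)) `^ p).
Proof.
move=> hf p0 r0 r1; apply: bmeas_powR => //; first by move=> t; exact: cmod_ge0.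
by apply/bmC_cmod/polar_circle_bmC => // w wr; apply/holo_ccont/hf; rewrite wr.
Qed.

Lemma powR_half_sqr (p x : R) : 0 <= x -> (x `^ (p / 2)) ^+ 2 = x `^ p.
Proof. by move=> x0; rewrite -powR_mulrn ?powR_ge0// -powRrM divfK. Qed.

Lemma Jp_sqr (p r : R) (f : C -> C) :
  Jp p f r = mean (fun t => (cmod (f (polar r t)) `^ (p / 2)) ^+ 2).
Proof. by apply: eq_mean => t; rewrite powR_half_sqr ?cmod_ge0. Qed.

(* Both [w - Pw] and [Pw - v] are controlled by the drop of the L2 norm from [w] to [v]. *)
Lemma Pois_drop (rho : R) (w v : R -> R) : 0 <= rho -> rho < 1 -> bmeas w -> bmeas v ->
  (forall t, 0 <= v t) -> (forall t, v t <= Pois rho w t) ->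
  mean (fun t => (w t - v t) ^+ 2) <= 4 * (mean (fun t => w t ^+ 2) - mean (fun t => v t ^+ 2)).
Proof.
move=> rho0 rho1 bw bs v0.
have bP : bmeas (Pois rho w) by exact: bmeas_Pois.
have D1 := Pois_defect rho0 rho1 bw.
move: (Pois rho w) bP D1 => P bP D1 ws.
have bw2 := bmeasX 2 bw; have bv2 := bmeasX 2 bs; have bP2 := bmeasX 2 bP.
have b1 := bmeasX 2 (bmeasB bw bP).
have b2 := bmeasX 2 (bmeasB bP bs).
have D2 : mean (fun t => (P t - v t) ^+ 2) <= mean (fun t => P t ^+ 2) - mean (fun t => v t ^+ 2).
  rewrite -(meanB bP2 bv2); apply: (le_mean b2 (bmeasB bP2 bv2)) => t _.
  by have := ws t; have := v0 t; nra.
have b12 := bmeasD (bmeasM (bmeas_cst _ 2) b1) (bmeasM (bmeas_cst _ 2) b2).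
apply: (@le_trans _ _ (mean (fun t => 2 * (w t - P t) ^+ 2 + 2 * (P t - v t) ^+ 2))).
  apply: (le_mean (bmeasX 2 (bmeasB bw bs)) b12) => t _.
  have := sqr_ge0 (w t - P t - (P t - v t)); nra.
rewrite (meanD (bmeasM (bmeas_cst _ 2) b1) (bmeasM (bmeas_cst _ 2) b2)).
rewrite (meanZ 2 b1) (meanZ 2 b2).
have M2 : 0 <= mean (fun t => (w t - P t) ^+ 2) by apply: mean_ge0 => t; exact: sqr_ge0.
have M3 : 0 <= mean (fun t => (P t - v t) ^+ 2) by apply: mean_ge0 => t; exact: sqr_ge0.
move: D1 D2 M2 M3; move: (mean _) (mean _) (mean _) (mean _) (mean _) => A B D E F.
by lra.
Qed.

(** Substitute for boundary values: when the means [Jp] are bounded, the functions [|f|^(p/2)] on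
    the circles form a Cauchy family in [L^2] as the radius tends to 1. *)
Lemma Jp_drop (p s r : R) (f : C -> C) : disc_holo f -> 1 <= p ->
  0 <= s -> s < r -> r < 1 ->
  mean (fun t => (cmod (f (polar r t)) `^ (p / 2) - cmod (f (polar s t)) `^ (p / 2)) ^+ 2)
  <= 4 * (Jp p f r - Jp p f s).
Proof.
move=> hf p1 s0 sr r1; have r0 := le_lt_trans s0 sr.
have p20 : 0 <= p / 2 by rewrite divr_ge0// (le_trans _ p1).
have rho0 : 0 <= s / r by rewrite divr_ge0// ltW.
have rho1 : s / r < 1 by rewrite ltr_pdivrMr// mul1r.
have sE : s = s / r * r by rewrite divfK ?gt_eqF.
rewrite !Jp_sqr.
apply: (Pois_drop rho0 rho1 (bmeas_Jp hf p20 (ltW r0) r1) (bmeas_Jp hf p20 s0 (lt_trans sr r1))).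
  by move=> t; exact: powR_ge0.
by move=> t; rewrite {1}sE; exact: (powR_submean t p1 rho0 rho1 r0 r1 hf).
Qed.

(** The left side of [Jp_drop] is nonnegative. *)
Lemma Jp_monotone (p s r : R) (f : C -> C) : disc_holo f -> 1 <= p ->
  0 <= s -> s <= r -> r < 1 -> Jp p f s <= Jp p f r.
Proof.
move=> hf p1 s0; rewrite le_eqVlt => /predU1P[->//|sr] r1.
have := Jp_drop hf p1 s0 sr r1.
have : 0 <= mean (fun t => (cmod (f (polar r t)) `^ (p / 2) - cmod (f (polar s t)) `^ (p / 2)) ^+ 2).
  by apply: mean_ge0 => t; exact: sqr_ge0.
by move: (mean _) (Jp p f r) (Jp p f s) => A B D; lra.
Qed.

End Submean.

(** * Hardy spaces through [p]-th powers of norms *)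

Section HardySpace.
Context {R : realType}.
Local Notation C := R[i].
Local Notation mu := (@lebesgue_measure R).
Implicit Types (f g : C -> C) (p : R).

Lemma analytic_disc_holo f : analytic_on_disc (f : Cx R -> Cx R) <-> disc_holo f.
Proof.
by split=> hf z zd; apply/derivable_cdiff; exact: hf.
Qed.

Lemma MpE p f r : disc_holo f -> 0 <= p -> 0 <= r -> r < 1 -> Mp p f r = (Jp p f r)%:E.
Proof.
move=> hf p0 r0 r1; have bf := bmeas_Jp hf p0 r0 r1.
have iF := bmeas_integrable_itv 0 (twopi R) bf.
rewrite /Mp /Jp mean_lebesgue// /Rintegral EFinM fineK; last exact: integrable_fin_num.
by congr (_ * _)%E; rewrite integral_itv_bndo_bndc//; apply/measurable_EFinP/measurable_funTS; exact: bf.1.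
Qed.

(** The [p]-th power of the norm. It is homogeneous of degree [p] and subadditive up to [2 ^ p],
    which takes the place of the triangle inequality. *)
Definition Np p f : R := fine (ereal_sup [set Mp p (f : Cx R -> Cx R) r | r in `[0, 1[]).

Lemma Hp_normE p f : Hp_norm p f = Np p f `^ p^-1.
Proof. by []. Qed.

Definition Hp p f : Prop :=
  disc_holo f /\ exists K, forall r, 0 <= r -> r < 1 -> Jp p f r <= K.

Lemma in_HpP p f : 0 <= p -> in_Hp p f <-> Hp p f.
Proof.
move=> p0; split => -[hf [K HK]].
  move/analytic_disc_holo : hf => hf; split => //; exists K => r r0 r1.
  by have := HK r; rewrite MpE// lee_fin r0 r1; exact.
split; first exact/analytic_disc_holo.
by exists K => r /andP[r0 r1]; rewrite MpE// lee_fin HK.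
Qed.

Lemma Jp_ge0 p f r : 0 <= Jp p f r.
Proof. by apply: mean_ge0 => t; exact: powR_ge0. Qed.

Lemma Np_fin p f : 0 <= p -> Hp p f ->
  ereal_sup [set Mp p (f : Cx R -> Cx R) r | r in `[0, 1[] \is a fin_num.
Proof.
move=> p0 [hf [K HK]]; rewrite fin_numElt; apply/andP; split.
  apply: (@lt_le_trans _ _ (Jp p f 0)%:E); first exact: ltNyr.
  apply: ereal_sup_ubound; exists 0; last by rewrite MpE.
  by rewrite /= in_itv /= lexx ltr01.
apply: (@le_lt_trans _ _ K%:E); last exact: ltry.
apply: ge_ereal_sup => _ [r /= + <-]; rewrite in_itv /= => /andP[r0 r1].
by rewrite MpE// lee_fin HK.
Qed.

Lemma Jp_le_Np p f r : 0 <= p -> Hp p f -> 0 <= r -> r < 1 -> Jp p f r <= Np p f.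
Proof.
move=> p0 hp r0 r1; rewrite -lee_fin /Np [X in (_ <= X)%E]fineK ?Np_fin//.
apply: ereal_sup_ubound; exists r; last by rewrite MpE//; case: hp.
by rewrite /= in_itv /= r0 r1.
Qed.

Lemma Np_le p f K : 0 <= p -> disc_holo f ->
  (forall r, 0 <= r -> r < 1 -> Jp p f r <= K) -> Np p f <= K.
Proof.
move=> p0 hf HK; have hp : Hp p f by split => //; exists K.
rewrite -lee_fin /Np fineK ?Np_fin//.
apply: ge_ereal_sup => _ [r /= + <-]; rewrite in_itv /= => /andP[r0 r1].
by rewrite MpE// lee_fin HK.
Qed.

Lemma Np_ge0 p f : 0 <= p -> Hp p f -> 0 <= Np p f.
Proof. by move=> p0 hp; rewrite (le_trans (Jp_ge0 p f 0))// Jp_le_Np. Qed.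

Lemma Np_approx p f e : 1 <= p -> Hp p f -> 0 < e -> exists r0, [/\ 0 <= r0, r0 < 1 &
  forall r, r0 <= r -> r < 1 -> Np p f - e <= Jp p f r].
Proof.
move=> p1 hp e0; have p0 := le_trans ler01 p1.
have hf := hp.1.
suff [r0 [r00 r01 h]] : exists r0, [/\ 0 <= r0, r0 < 1 & Np p f - e < Jp p f r0].
  exists r0; split; [exact: r00|exact: r01|] => r r0r r1; apply: (le_trans (ltW h)).
  exact: (Jp_monotone hf p1 r00 r0r r1).
apply: contrapT => H.
suff : Np p f <= Np p f - e by rewrite leNgt ltrBlDr ltrDl e0.
apply: Np_le => // r r0 r1; rewrite leNgt; apply/negP => h; apply: H.
by exists r.
Qed.

Lemma eq_Jp p f g r : 0 <= r -> r < 1 -> (forall z : C, cmod z < 1 -> f z = g z) ->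
  Jp p f r = Jp p g r.
Proof.
move=> r0 r1 fg; apply: eq_mean => t; rewrite fg// cmod_polar ger0_norm//.
Qed.

Lemma eq_disc_holo f g : (forall z : C, cmod z < 1 -> f z = g z) -> disc_holo f -> disc_holo g.
Proof.
move=> fg hf w w1; apply: (@holo_near_eq _ f _ _ (1 - cmod w)); last exact: hf.
  by rewrite subr_gt0.
move=> v vw; apply: fg; have := cmod_sub_ge v w; lra.
Qed.

Lemma eq_Hp p f g : (forall z : C, cmod z < 1 -> f z = g z) -> Hp p f -> Hp p g.
Proof.
move=> fg [hf [K HK]]; split; first exact: eq_disc_holo hf.
by exists K => r r0 r1; rewrite -(eq_Jp p r0 r1 fg) HK.
Qed.

Lemma eq_Np p f g : (forall z : C, cmod z < 1 -> f z = g z) -> Np p f = Np p g.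
Proof.
move=> fg.
have E r : r \in `[0, 1[ -> Mp p (f : Cx R -> Cx R) r = Mp p (g : Cx R -> Cx R) r.
  rewrite in_itv /= => /andP[r0 r1]; rewrite /Mp.
  apply: (congr1 (fun x => (((twopi R)^-1)%:E * x)%E)).
  by apply: eq_integral => t _; rewrite (fg (polar r t))// cmod_polar ger0_norm.
apply: (congr1 (fun A => fine (ereal_sup A))).
by apply: eq_imagel => r; exact: E.
Qed.

Opaque Np.

Lemma powRD_le p (x y : R) : 0 <= p -> 0 <= x -> 0 <= y ->
  (x + y) `^ p <= 2 `^ p * (x `^ p + y `^ p).
Proof.
move=> p0 x0 y0.
have h (a b : R) : 0 <= a -> a <= b -> (a + b) `^ p <= 2 `^ p * (a `^ p + b `^ p).
  move=> a0 ab; have b0 := le_trans a0 ab.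
  apply: (@le_trans _ _ ((2 * b) `^ p)).
    apply: ge0_ler_powR => //; rewrite ?nnegrE ?addr_ge0 ?mulr_ge0//.
    by rewrite mulr_natl mulr2n lerD2r.
  by rewrite powRM// ler_wpM2l ?powR_ge0// lerDr powR_ge0.
case: (leP x y) => [xy|/ltW yx]; first exact: h.
by rewrite addrC [X in _ * X]addrC; exact: h.
Qed.

Lemma JpD p f g r : 0 <= p -> disc_holo f -> disc_holo g -> 0 <= r -> r < 1 ->
  Jp p (fun z => f z + g z) r <= 2 `^ p * (Jp p f r + Jp p g r).
Proof.
move=> p0 hf hg r0 r1.
have bf := bmeas_Jp hf p0 r0 r1; have bg := bmeas_Jp hg p0 r0 r1.
have hfg : disc_holo (fun z => f z + g z) by move=> w w1; apply: holoD; [exact: hf|exact: hg].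
have bfg := bmeas_Jp hfg p0 r0 r1.
rewrite /Jp -(meanD bf bg) -(meanZ _ (bmeasD bf bg)).
apply: (le_mean bfg (bmeasM (bmeas_cst _ _) (bmeasD bf bg))) => t _.
apply: le_trans (powRD_le p0 (cmod_ge0 _) (cmod_ge0 _)).
apply: ge0_ler_powR => //; rewrite ?nnegrE ?cmod_ge0 ?addr_ge0 ?cmod_ge0//.
exact: cmodD.
Qed.

Lemma JpZ p f (c : C) r : 0 <= p -> disc_holo f -> 0 <= r -> r < 1 ->
  Jp p (fun z => c * f z) r = cmod c `^ p * Jp p f r.
Proof.
move=> p0 hf r0 r1; rewrite /Jp -(meanZ _ (bmeas_Jp hf p0 r0 r1)).
by apply: eq_mean => t; rewrite cmodM powRM// cmod_ge0.
Qed.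

Lemma HpD p f g : 0 <= p -> Hp p f -> Hp p g -> Hp p (fun z => f z + g z).
Proof.
move=> p0 hf hg; split.
  by move=> w w1; apply: holoD; [exact: hf.1|exact: hg.1].
exists (2 `^ p * (Np p f + Np p g)) => r r0 r1.
apply: (le_trans (JpD p0 hf.1 hg.1 r0 r1)).
by rewrite ler_wpM2l ?powR_ge0// lerD// Jp_le_Np.
Qed.

Lemma NpD p f g : 0 <= p -> Hp p f -> Hp p g ->
  Np p (fun z => f z + g z) <= 2 `^ p * (Np p f + Np p g).
Proof.
move=> p0 hf hg; apply: Np_le => //; first exact: (HpD p0 hf hg).1.
move=> r r0 r1; apply: (le_trans (JpD p0 hf.1 hg.1 r0 r1)).
by rewrite ler_wpM2l ?powR_ge0// lerD// Jp_le_Np.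
Qed.

Lemma HpZ p f (c : C) : 0 <= p -> Hp p f -> Hp p (fun z => c * f z).
Proof.
move=> p0 hf; split; first by move=> w w1; apply: holoZ; exact: hf.1.
exists (cmod c `^ p * Np p f) => r r0 r1.
by rewrite JpZ//; [rewrite ler_wpM2l ?powR_ge0// Jp_le_Np|exact: hf.1].
Qed.

Lemma NpZ_le p f (c : C) : 0 <= p -> Hp p f -> Np p (fun z => c * f z) <= cmod c `^ p * Np p f.
Proof.
move=> p0 hf; apply: Np_le => //; first exact: (HpZ c p0 hf).1.
move=> r r0 r1; rewrite JpZ//; last exact: hf.1.
by rewrite ler_wpM2l ?powR_ge0// Jp_le_Np.
Qed.

Lemma NpZ p f (c : C) : 0 < p -> Hp p f -> Np p (fun z => c * f z) = cmod c `^ p * Np p f.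
Proof.
move=> p0 hf; apply/le_anti; rewrite NpZ_le ?(ltW p0)//=.
have [->|c0] := eqVneq c 0.
  have pn : p != 0 by rewrite gt_eqF.
  by rewrite cmod0 (powR0 pn) mul0r; exact: (Np_ge0 (ltW p0) (HpZ 0 (ltW p0) hf)).
have := NpZ_le (c^-1) (ltW p0) (HpZ c (ltW p0) hf).
rewrite (@eq_Np _ (fun z => c^-1 * (c * f z)) f); last by move=> z _; rewrite mulKf.
rewrite cmodV -ler_pdivrMl; last by rewrite powR_gt0// invr_gt0 cmod_gt0.
apply: le_trans; apply: ler_wpM2r; first by rewrite Np_ge0// ltW.
by rewrite -powR_inv1 ?cmod_ge0// -powRrM mulN1r powRN invrK.
Qed.

Lemma Hp_cst p (c : C) : 0 <= p -> Hp p (fun=> c).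
Proof.
move=> p0; split; first by move=> w _; exact: holo_cst.
by exists (cmod c `^ p) => r _ _; rewrite /Jp mean_cst.
Qed.

Lemma le1D_powR p (x : R) : 1 <= p -> 0 <= x -> x <= 1 + x `^ p.
Proof.
move=> p1 x0; case: (leP x 1) => x1; first by rewrite (le_trans x1)// lerDl powR_ge0.
by rewrite (le_trans (le1r_powR (ltW x1) p1))// lerDr.
Qed.

Lemma mean_cmod_le p f r : 1 <= p -> Hp p f -> 0 <= r -> r < 1 ->
  mean (fun t => cmod (f (polar r t))) <= 1 + Np p f.
Proof.
move=> p1 hp r0 r1; have p0 := le_trans ler01 p1.
have bf := bmeas_Jp hp.1 p0 r0 r1.
have b1 : bmeas (fun t => cmod (f (polar r t))).
  by apply/bmC_cmod/polar_circle_bmC => // w wr; apply/holo_ccont/hp.1; rewrite wr.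
apply: (@le_trans _ _ (1 + Jp p f r)); last by rewrite lerD2l Jp_le_Np.
rewrite -[X in X + _](mean_cst (R := R)) -(meanD (bmeas_cst _ 1) bf).
apply: (le_mean b1 (bmeasD (bmeas_cst _ 1) bf)) => t _.
by rewrite le1D_powR// cmod_ge0.
Qed.

Lemma mean_mul_cmod_le (f : R -> C) (g : R -> C) K : bmC f -> bmC g ->
  (forall t, cmod (g t) <= K) ->
  cmod (cmean (fun t => f t * g t)) <= K * mean (fun t => cmod (f t)).
Proof.
move=> bf bg Kg; rewrite (le_trans (cmod_cmean _))//; first exact: bmC_M.
rewrite -(meanZ _ (bmC_cmod bf)).
apply: (le_mean (bmC_cmod (bmC_M bf bg)) (bmeasM (bmeas_cst _ _) (bmC_cmod bf))) => t _.
by rewrite cmodM mulrC ler_wpM2r// cmod_ge0.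
Qed.

Section cauchy_estimates.
Variables (f : C -> C) (s r : R).
Hypotheses (hf : disc_holo f) (s0 : 0 <= s) (sr : s < r) (r1 : r < 1).

Let r0 : 0 < r. Proof. exact: le_lt_trans sr. Qed.

Let cr t : cmod (polar r t : C) = r. Proof. by rewrite cmod_polar gtr0_norm. Qed.

Let bf : bmC (fun t => f (polar r t)).
Proof. by apply: polar_circle_bmC (ltW r0) _ => w wr; apply/holo_ccont/hf; rewrite wr. Qed.

Let den z t : cmod z <= s -> r - s <= cmod ((polar r t : C) - z).
Proof. by move=> zs; rewrite (le_trans _ (cmod_sub_ge _ _))// cr lerD2l lerN2. Qed.

Let den_neq0 (z : C) t : cmod z <= s -> (polar r t : C) - z != 0.
Proof. by move=> zs; rewrite -cmod_gt0 (lt_le_trans _ (den t zs))// subr_gt0. Qed.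

Let neqz (z w : C) : cmod z <= s -> cmod w = r -> w - z != 0.
Proof.
move=> zs wr; rewrite subr_eq0; apply: contraTneq zs => <-.
by rewrite wr -ltNge.
Qed.

Lemma bmC_cauchy_kernel (z : C) : cmod z <= s -> bmC (fun t => (polar r t : C) / ((polar r t : C) - z)).
Proof.
move=> zs; apply: (@polar_circle_bmC _ (fun w => w / (w - z)) r (ltW r0)) => w wr.
apply: ccontM; first exact: ccont_id.
apply: ccontV; last exact: neqz.
by apply: ccontD; [exact: ccont_id|exact: ccont_cst].
Qed.

Lemma cauchy_bound (z : C) : cmod z <= s ->
  cmod (f z) <= r / (r - s) * mean (fun t => cmod (f (polar r t))).
Proof.
move=> zs; rewrite (cauchy_formula (le_lt_trans zs sr) r1 hf).
apply: mean_mul_cmod_le => //; first exact: bmC_cauchy_kernel.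
move=> t; rewrite cmodM cmodV cr ler_wpM2l ?(ltW r0)// lef_pV2 ?posrE ?den//.
  by rewrite (lt_le_trans _ (den t zs))// subr_gt0.
by rewrite subr_gt0.
Qed.

Lemma cauchy_lipschitz (z z' : C) : cmod z <= s -> cmod z' <= s ->
  cmod (f z - f z') <= r / (r - s) ^+ 2 * cmod (z - z') * mean (fun t => cmod (f (polar r t))).
Proof.
move=> zs zs'; rewrite (cauchy_formula (le_lt_trans zs sr) r1 hf).
rewrite (cauchy_formula (le_lt_trans zs' sr) r1 hf).
have bk := bmC_cauchy_kernel zs; have bk' := bmC_cauchy_kernel zs'.
rewrite -cmeanB; [|exact: bmC_M..].
rewrite (@eq_cmean _ _ (fun t => f (polar r t) *
    ((polar r t : C) / ((polar r t : C) - z) - (polar r t : C) / ((polar r t : C) - z')))); last first.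
  by move=> t; rewrite mulrBr.
apply: mean_mul_cmod_le => //; first exact: bmC_B.
move=> t; have d1 := den t zs; have d2 := den t zs'.
have n1 := den_neq0 t zs; have n2 := den_neq0 t zs'; have ct := cr t.
move: (polar r t : C) d1 d2 n1 n2 ct => w d1 d2 n1 n2 ct.
have -> : w / (w - z) - w / (w - z') = w * (z - z') / ((w - z) * (w - z')).
  by field; rewrite n1 n2.
rewrite !cmodM cmodV cmodM ct mulrAC ler_wpM2r ?cmod_ge0// ler_wpM2l ?(ltW r0)//.
have rs0 : 0 < r - s by rewrite subr_gt0.
rewrite lef_pV2 ?posrE ?exprn_gt0 ?mulr_gt0 ?cmod_gt0//.
by rewrite expr2 ler_pM// ltW.
Qed.

End cauchy_estimates.

(** Cauchy's formula bounds [f] by its mean modulus on a larger circle. There [x <= 1 + x ^ p]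
    replaces Hoelder's inequality, hence the affine dependence on [Np p f]. *)
Lemma Hp_lipschitz p s : 1 <= p -> 0 <= s -> s < 1 -> exists2 K, 0 < K & forall f, Hp p f ->
  forall z z' : C, cmod z <= s -> cmod z' <= s ->
  cmod (f z) <= K * (1 + Np p f) /\ cmod (f z - f z') <= K * cmod (z - z') * (1 + Np p f).
Proof.
move=> p1 s0 s1; have p0 := le_trans ler01 p1.
have [r sr r1] : exists2 r, s < r & r < 1 by exists ((s + 1) / 2); lra.
have rs0 : 0 < r - s by rewrite subr_gt0.
have r0 := le_lt_trans s0 sr.
exists (r / (r - s) + r / (r - s) ^+ 2); first by rewrite addr_gt0// divr_gt0// exprn_gt0.
move=> f hf z z' zs zs'.
have M := mean_cmod_le p1 hf (ltW r0) r1.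
have N0 : 0 <= 1 + Np p f by rewrite addr_ge0// Np_ge0.
have M0 : 0 <= mean (fun t => cmod (f (polar r t))) by apply: mean_ge0 => t; exact: cmod_ge0.
have q1 : 0 <= r / (r - s) by apply: divr_ge0; exact: ltW.
have q2 : 0 <= r / (r - s) ^+ 2 by apply: divr_ge0; [exact: ltW|exact: sqr_ge0].
split.
  apply: (le_trans (cauchy_bound hf.1 s0 sr r1 zs)); apply: (ler_pM q1 M0 _ M).
  by rewrite lerDl.
apply: (le_trans (cauchy_lipschitz hf.1 s0 sr r1 zs zs')).
apply: (ler_pM (mulr_ge0 q2 (cmod_ge0 _)) M0 _ M).
by apply: ler_wpM2r; [exact: cmod_ge0|rewrite lerDr].
Qed.

(** On circles of radius at most [s] the function is bounded. Beyond [s], [Jp_drop] compares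
    [|f|^(p/2)] with its values on the circle of radius [s], uniformly in the radius. *)
Lemma Hp_unif_integrable p f e : 1 <= p -> Hp p f -> 0 < e -> exists2 d, 0 < d &
  forall A : set R, measurable A -> mean \1_A <= d ->
  forall r, 0 <= r -> r < 1 -> mean (fun t => \1_A t * cmod (f (polar r t)) `^ p) <= e.
Proof.
move=> p1 hp e0; have p0 := le_trans ler01 p1; have hf := hp.1.
have p20 : 0 <= p / 2 by rewrite divr_ge0.
(* With [x^2 <= 2 y^2 + 2 (x - y)^2], the tolerance [e / 16] becomes [e / 2] through the factor 4 of
   [Jp_drop]; the choice [e / (4 * L)] below provides the other half. *)
have [s [s0 s1 Hs]] := Np_approx p1 hp (divr_gt0 e0 (ltr0n _ 16)).
have [K K0 HK] : exists2 K, 0 <= K & forall z : C, 0 <= cmod z <= s -> cmod (f z) <= K.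
  apply: annulus_bounded => z /andP[_ zs]; apply/holo_ccont/hf.
  exact: le_lt_trans s1.
pose L := K `^ p + 1.
have L0 : 0 < L by rewrite ltr_wpDl// powR_ge0.
have HL r t : 0 <= r -> r <= s -> cmod (f (polar r t)) `^ p <= L.
  move=> r0 rs; apply: (@le_trans _ _ (K `^ p)); last by rewrite lerDl.
  apply: ge0_ler_powR => //; rewrite ?nnegrE ?cmod_ge0//.
  by apply: HK; rewrite cmod_polar ger0_norm// r0.
exists (e / (4 * L)) => [|A mA Ad r r0 r1]; first by rewrite divr_gt0// mulr_gt0.
have bA : bmeas (\1_A : R -> R) by exact: bmeas_indic.
have i01 t : 0 <= (\1_A t : R) <= 1 by rewrite indicE; case: (_ \in _); rewrite ?lexx ?ler01.
have bfr := bmeas_Jp hf p0 r0 r1; have bfs := bmeas_Jp hf p0 s0 s1.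
have Ad' : L * mean \1_A <= e / 4.
  rewrite mulrC -ler_pdivlMr//; apply: (le_trans Ad).
  by rewrite invfM mulrA.
case: (leP r s) => rs.
  apply: (@le_trans _ _ (mean (fun t => L * \1_A t))).
    apply: (le_mean (bmeasM bA bfr) (bmeasM (bmeas_cst _ L) bA)) => t _.
    by rewrite mulrC ler_wpM2r ?HL//; case/andP: (i01 t).
  rewrite meanZ// (le_trans Ad')// ler_pdivrMr// ler_peMr ?(ltW e0)//; lra.
have bw := bmeas_Jp hf p20 r0 r1; have bv := bmeas_Jp hf p20 s0 s1.
have bD := bmeasX 2 (bmeasB bw bv).
have b1 := bmeasM (bmeas_cst _ 2) bD.
have b2 := bmeasM (bmeas_cst _ (2 * L)) bA.
apply: (@le_trans _ _ (mean (fun t => 2 * L * \1_A t +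
    2 * (cmod (f (polar r t)) `^ (p / 2) - cmod (f (polar s t)) `^ (p / 2)) ^+ 2))).
  apply: (le_mean (bmeasM bA bfr) (bmeasD b2 b1)) => t _.
  have := HL s t s0 (lexx s).
  rewrite -!(powR_half_sqr p (cmod_ge0 _)).
  move: (cmod (f (polar r t)) `^ (p / 2)) (cmod (f (polar s t)) `^ (p / 2)) => x y yL.
  have D := sqr_ge0 (x - 2 * y); have D2 := sqr_ge0 (x - y).
  rewrite indicE; case: (_ \in _) => /=; rewrite ?mul1r ?mul0r ?mulr0 ?mulr1; first by lra.
  by rewrite add0r mulr_ge0.
rewrite (meanD b2 b1) (meanZ _ bA) (meanZ _ bD).
have := Jp_drop hf p1 s0 rs r1.
have := Hs s (lexx s) s1; have := Jp_le_Np p0 hp r0 r1.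
move: Ad'; move: (mean _) (mean _) (Np p f) (Jp p f r) (Jp p f s) => a b N j1 j2.
lra.
Qed.

End HardySpace.

(** * Poisson means and the Hardy-Littlewood maximal function *)

Section Maximal.
Context {R : realType}.
Local Notation C := R[i].
Local Notation mu := (@lebesgue_measure R).

Lemma cos1_le (x : R) : 0 <= x <= 1 -> cos 1 * x <= sin x.
Proof.
case/andP; rewrite le_eqVlt => /predU1P[<-|x0] x1; first by rewrite mulr0 sin0.
have [y] : exists2 y, y \in `]0, x[%R & sin x - sin 0 = cos y * (x - 0).
  by apply: MVT => //; apply: continuous_subspaceT => ?; exact: continuous_sin.
rewrite in_itv /= => /andP[y0 yx]; rewrite sin0 !subr0 => ->.
apply: ler_wpM2r; first exact: ltW.
have pi1 : 1 <= pi :> R by rewrite (le_trans _ (pi_ge2 R))// ler1n.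
apply: ltW; rewrite ltr_cos ?in_itv/= ?ler01 ?pi1 ?(ltW y0)//=.
  exact: lt_le_trans x1.
by rewrite (le_trans (ltW yx))// (le_trans x1).
Qed.

(** Differences of angles are not reduced modulo a period, so the zeros of [1 - cos] at plus and
    minus [2 pi] must be kept away by [eta]. Up to 2 the half-angle formula applies; beyond,
    [1 - cos x] is bounded below and [x ^ 2] above. *)
Lemma one_sub_cos_ge (eta : R) : 0 < eta -> eta <= pi ->
  exists2 c, 0 < c <= 1 & forall x, `|x| <= twopi R - eta -> c * x ^+ 2 <= 1 - cos x.
Proof.
move=> eta0 etapi; have pi0 := pi_gt0 R; have pi2 := pi_ge2 R.
have c1 := cos1_gt0 R.
have ce : cos eta < 1.
  by rewrite -(cos0 R) ltr_cos// in_itv/= ?lexx ?(ltW eta0)// ltW.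
pose P2 : R := 4 * pi ^+ 2.
have P20 : 0 < P2 by rewrite mulr_gt0// exprn_gt0.
have [m [m0 m1 me]] : exists m, [/\ 0 < m, m <= 1 & m <= 1 - cos eta].
  by exists (Order.min 1 (1 - cos eta)); rewrite lt_min ltr01 subr_gt0 !ge_min !lexx orbT.
have [c [c0 cle1 cle2]] : exists c, [/\ 0 < c, c <= m / P2 & c <= cos 1 ^+ 2 / 2].
  exists (Order.min (cos 1 ^+ 2 / 2) (m / P2)).
  by rewrite lt_min !divr_gt0 ?exprn_gt0// !ge_min !lexx orbT.
exists c.
  rewrite c0 /=; apply: (le_trans cle2); rewrite ler_pdivrMr// mul1r.
  have := cos_le1 (1 : R); nra.
move=> x; rewrite -(cos_norm x) -(real_normK (num_real x)).
move: `|x| (normr_ge0 x) => {}x x0 xe; rewrite /twopi in xe.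
have far : m <= 1 - cos x -> c * x ^+ 2 <= 1 - cos x.
  apply: le_trans; apply: (@le_trans _ _ (m / P2 * P2)); last by rewrite divfK// gt_eqF.
  apply: (ler_pM (ltW c0) (sqr_ge0 x) cle1); rewrite /P2; nra.
have [x2|x2] := leP x 2.
  have h : 0 <= x / 2 <= 1 by rewrite divr_ge0//= ler_pdivrMr// mul1r.
  have s := cos1_le h.
  have -> : cos x = cos (x / 2 *+ 2) by rewrite -mulr_natr divfK.
  rewrite cos_mulr2n cos2sin2.
  have s1 : (cos 1 * (x / 2)) ^+ 2 <= sin (x / 2) ^+ 2.
    have : 0 <= cos 1 * (x / 2) by rewrite mulr_ge0 ?(ltW c1)//; case/andP: h.
    nra.
  have x20 := sqr_ge0 x.
  have : c * x ^+ 2 <= cos 1 ^+ 2 / 2 * x ^+ 2 by rewrite ler_wpM2r.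
  move: s1; move: (sin _) (cos 1) => S K h1 h2.
  have h3 : (K * (x / 2)) ^+ 2 = K ^+ 2 * x ^+ 2 / 4 by field.
  by move: h1 h2; rewrite h3; lra.
have [xp|xp] := leP x pi.
  apply: far; have : cos x < cos 2.
    by rewrite ltr_cos// in_itv/= ?x0 ?xp// pi2 andbT.
  have := cos2_lt0 R; lra.
apply: far.
have -> : cos x = cos (pi *+ 2 - x).
  by rewrite -[RHS]cosN opprB -[RHS](@cosD2pi R) subrK.
have : cos (pi *+ 2 - x) <= cos eta.
  have [<-//|ne] := eqVneq eta (pi *+ 2 - x).
  apply/ltW; rewrite ltr_cos ?in_itv/= ?(ltW eta0)//.
    by rewrite lt_neqAle ne/= -mulr_natl; lra.
  by rewrite -mulr_natl; lra.
lra.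
Qed.

Lemma pker_upper (eta : R) : 0 < eta -> eta <= pi -> exists2 c, 0 < c &
  forall rho th t, 1 / 2 <= rho -> rho < 1 -> `|th - t| <= twopi R - eta ->
   pker rho th t <= c * ((1 - rho) / ((1 - rho) ^+ 2 + (th - t) ^+ 2)).
Proof.
move=> eta0 etapi; have [c /andP[c0 c1] Hc] := one_sub_cos_ge eta0 etapi.
exists (2 / c); first by rewrite divr_gt0.
move=> rho th t r2 r1 /Hc h.
have d0 : 0 < 1 - rho by rewrite subr_gt0.
have x20 := sqr_ge0 (th - t).
have D1 : 0 < (1 - rho) ^+ 2 + (th - t) ^+ 2 by rewrite ltr_pwDl// exprn_gt0.
have D2 : c * ((1 - rho) ^+ 2 + (th - t) ^+ 2) <= 1 - 2 * rho * cos (th - t) + rho ^+ 2.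
  move: h (cos_le1 (th - t)) x20; move: (cos _) ((th - t) ^+ 2) => x y h1 h2 h3.
  have : c * (1 - rho) ^+ 2 <= (1 - rho) ^+ 2 by rewrite ler_piMl// sqr_ge0.
  nra.
rewrite /pker; apply: (@le_trans _ _ ((2 * (1 - rho)) / (c * ((1 - rho) ^+ 2 + (th - t) ^+ 2)))).
  apply: ler_pM.
  - by rewrite subr_ge0 expr_le1 ?(ltW r1)//; lra.
  - by rewrite invr_ge0 (le_trans _ D2)// mulr_ge0// ltW.
  - nra.
  - by rewrite lef_pV2 ?posrE ?mulr_gt0// (lt_le_trans _ D2)// mulr_gt0.
rewrite le_eqVlt; apply/orP; left; apply/eqP; field.
by rewrite !gt_eqF.
Qed.

(** One term suffices: for the least [i] with [|x| < 2^i d], either [i = 0] or [|x| >= 2^(i-1) d],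
    and the kernel is at most [4 / (d 4^i)]. *)
Lemma dyadic_kernel (d x : R) (I : nat) : 0 < d -> `|x| < 2 ^+ I * d ->
  d / (d ^+ 2 + x ^+ 2) <= \sum_(i < I.+1) 4 / d * 4 ^- i * \1_(ball (0 : R) (2 ^+ i * d)) x.
Proof.
move=> d0 xI.
pose P i := `|x| < 2 ^+ i * d.
have exP : exists i, P i by exists I.
case: (ex_minnP exP) => i Pi mini.
have iI : (i < I.+1)%N by rewrite ltnS; exact: mini.
have D0 : 0 < d ^+ 2 + x ^+ 2 by rewrite ltr_pwDl ?exprn_gt0// sqr_ge0.
have term_ge0 (k : 'I_I.+1) : 0 <= 4 / d * 4 ^- k * \1_(ball (0 : R) (2 ^+ k * d)) x.
  by rewrite !mulr_ge0// ?invr_ge0 ?exprn_ge0 ?(ltW d0)// indicE; case: (_ \in _).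
rewrite (bigD1 (Ordinal iI))//= ler_wpDr//; first by apply: sumr_ge0 => k _.
rewrite indicE mem_set ?mulr1; last by rewrite -ball_normE /= sub0r normrN.
have xx : x ^+ 2 = `|x| ^+ 2 by rewrite real_normK ?num_real.
case: i {iI} Pi mini => [|i] Pi mini.
  rewrite expr0 invr1 mulr1 ler_pdivlMr// mulrAC ler_pdivrMr//.
  have := sqr_ge0 x; have := sqr_ge0 d; rewrite !expr2; lra.
have hx : 2 ^+ i * d <= `|x|.
  by rewrite leNgt; apply/negP => h; have := mini i h; rewrite ltnn.
have p0 : 0 < (2 : R) ^+ i by rewrite exprn_gt0.
have E4 : (4 : R) ^+ i.+1 = 4 * (2 ^+ i) ^+ 2.
  rewrite exprS; congr (_ * _); rewrite -exprM mulnC exprM; congr (_ ^+ _).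
  by rewrite -natrX.
rewrite E4 ler_pdivrMr//.
have -> : 4 / d * (4 * (2 ^+ i) ^+ 2)^-1 * (d ^+ 2 + x ^+ 2) = (d ^+ 2 + x ^+ 2) / (d * (2 ^+ i) ^+ 2).
  by field; rewrite !gt_eqF.
rewrite ler_pdivlMr ?mulr_gt0 ?exprn_gt0//.
have : (2 ^+ i * d) ^+ 2 <= x ^+ 2.
  have q0 : 0 <= 2 ^+ i * d by rewrite mulr_ge0// ltW.
  by rewrite xx !expr2 ler_pM.
rewrite exprMn; have := sqr_ge0 d; rewrite !expr2; lra.
Qed.

Lemma sum_half_pow (n : nat) : \sum_(i < n) (2 : R) ^- i <= 2.
Proof.
suff -> : \sum_(i < n) (2 : R) ^- i = 2 - 2 * 2 ^- n.
  by rewrite gerBl mulr_ge0// invr_ge0 exprn_ge0.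
elim: n => [|n IH]; first by rewrite big_ord0 expr0 invr1 mulr1 subrr.
rewrite big_ord_recr /= IH exprS invfM; lra.
Qed.

Lemma exp2_unbounded (M : R) : exists n : nat, M < 2 ^+ n.
Proof.
have [N HN] := expr_small (q := 2^-1) (e := (`|M| + 1)^-1) ltac:(by []) ltac:(lra)
  ltac:(by rewrite invr_gt0 ltr_pwDr).
exists N; move: HN; rewrite exprVn lef_pV2 ?posrE ?exprn_gt0// ?ltr_pwDr//.
by apply: lt_le_trans; rewrite (le_lt_trans (ler_norm M))// ltrDl.
Qed.

Lemma HL_ball (H : R -> R) (th lam tau : R) : 0 < tau ->
  (HL_maximal H th <= lam%:E)%E ->
  (\int[mu]_(t in ball th tau) `|(H t)%:E| <= (2 * tau * lam)%:E)%E.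
Proof.
move=> tau0 HLle.
have : (iavg H (ball th tau) <= lam%:E)%E.
  apply: le_trans HLle; apply: ereal_sup_ubound; exists tau => //.
  by rewrite /= in_itv /= tau0.
rewrite /iavg (lebesgue_measure_ball _ (ltW tau0)).
have m0 : 0 < tau *+ 2 by rewrite mulrn_wgt0.
rewrite inver (gt_eqF m0) => h.
have := lee_wpmul2l (x := (tau *+ 2)%:E) (ltW m0 : (0 <= (tau *+ 2)%:E)%E) h.
by rewrite muleA -EFinM divff ?gt_eqF// mul1e -EFinM mulr_natl.
Qed.

(** The kernel is dominated by a combination of indicators of dyadic intervals about [th], and the
    maximal function bounds each average. Keeping [th] away from the ends of the period puts all
    differences in the range of [pker_upper]. *)
Lemma Pois_maximal (eta : R) : 0 < eta -> eta <= pi -> exists2 K, 0 < K &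
  forall (h : R -> R) (th rho lam : R), bmeas h -> (forall t, 0 <= h t) ->
    eta <= th <= twopi R - eta -> 1 / 2 <= rho -> rho < 1 ->
    (HL_maximal (h \_ `[0%R, twopi R]%classic) th <= lam%:E)%E -> Pois rho h th <= K * lam.
Proof.
move=> eta0 etapi; have [c c0 Hc] := pker_upper eta0 etapi.
have tp := @twopi_gt0 R.
(* Here 16 is the weight 4 of [dyadic_kernel], times 2 for the length of an interval of given
   radius, times 2 for the geometric series. *)
exists (16 * c / twopi R); first by rewrite divr_gt0// mulr_gt0.
move=> h th rho lam bh h0 /andP[th1 th2] r2 r1 HLle.
have rho0 : 0 <= rho by lra.
pose d := 1 - rho; have d0 : 0 < d by rewrite subr_gt0.
have [I HI] := exp2_unbounded (twopi R / d).
have {}HI : twopi R < 2 ^+ I * d by rewrite -ltr_pdivrMr.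
have mb i : measurable (ball th (2 ^+ i * d) : set R) by exact: measurable_ball.
have bball i : bmeas (fun t => \1_(ball th (2 ^+ i * d)) t * h t).
  by apply: bmeasM => //; exact: bmeas_indic.
have ballE i t : \1_(ball (0 : R) (2 ^+ i * d)) (th - t) = \1_(ball th (2 ^+ i * d)) t :> R.
  rewrite !indicE; congr ((nat_of_bool _)%:R).
  by apply/idP/idP; rewrite !inE -!ball_normE /= sub0r normrN.
have mball i : mean (fun t => \1_(ball th (2 ^+ i * d)) t * h t)
    <= (twopi R)^-1 * (2 * (2 ^+ i * d) * lam).
  rewrite mean_lebesgue// ler_wpM2l ?invr_ge0 ?(ltW tp)//.
  have tau0 : 0 < 2 ^+ i * d by rewrite mulr_gt0// exprn_gt0.
  rewrite -lee_fin /Rintegral fineK; last first.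
    by apply: integrable_fin_num => //; exact: bmeas_integrable_itv.
  apply: le_trans (HL_ball tau0 HLle).
  rewrite [leLHS]integral_mkcond [leRHS]integral_mkcond le_eqVlt; apply/orP; left; apply/eqP.
  apply: eq_integral => t _; rewrite !patchE indicE.
  have p0 : (point : R) = 0 by [].
  case: ifPn => t1; case: ifPn => t2; rewrite ?p0 ?mul1r ?mul0r ?abse0//.
  by rewrite gee0_abs// lee_fin.
pose F i t := c * (4 / d * 4 ^- i) * (\1_(ball th (2 ^+ i * d)) t * h t).
have bF i : bmeas (F i) by apply: bmeasM => //; exact: bmeas_cst.
apply: (@le_trans _ _ (mean (fun t => \sum_(i < I.+1) F i t))).
  apply: le_mean.
  - by apply: bmeasM => //; exact: bmeas_pker.
  - exact: (@bmeas_sum _ _ _ _ _ (fun (i : 'I_I.+1) t => F i t)).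
  move=> t /andP[t0 t1].
  have tht : `|th - t| <= twopi R - eta by rewrite ler_norml; lra.
  have := Hc rho th t r2 r1 tht; rewrite -/d => hp.
  have := @dyadic_kernel d (th - t) I d0 (le_lt_trans (le_trans tht (ltac:(lra) : twopi R - eta <= twopi R)) HI).
  move=> hd; apply: (@le_trans _ _ (c * (\sum_(i < I.+1)
     4 / d * 4 ^- i * \1_(ball (0 : R) (2 ^+ i * d)) (th - t)) * h t)).
    by rewrite ler_wpM2r// (le_trans hp)// ler_wpM2l// ltW.
  rewrite mulr_sumr mulr_suml le_eqVlt; apply/orP; left; apply/eqP.
  by apply: eq_bigr => i _; rewrite ballE /F !mulrA.
rewrite (@mean_sum _ _ _ (fun (i : 'I_I.+1) t => F i t))//.
have lam0 : 0 <= lam.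
  rewrite -lee_fin (le_trans _ HLle)//; apply: HL_maximalT_ge0.
  by apply: integrable_locally_restrict => //; exact: bmeas_integrable_itv.
apply: (@le_trans _ _ (\sum_(i < I.+1) (8 * c * lam / twopi R) * 2 ^- i)).
  apply: ler_sum => i _; rewrite meanZ//.
  have cd0 : 0 <= c * (4 / d * 4 ^- i).
    by rewrite !mulr_ge0 ?invr_ge0 ?exprn_ge0// ltW.
  apply: (le_trans (ler_wpM2l cd0 (mball i))).
  have p0 : (2 : R) ^+ i != 0 by rewrite expf_neq0.
  have -> : (4 : R) ^+ i = 2 ^+ i * 2 ^+ i.
    by rewrite -exprMn; congr (_ ^+ _); rewrite -natrM.
  rewrite le_eqVlt; apply/orP; left; apply/eqP; field.
  by rewrite p0 !gt_eqF.
rewrite -mulr_sumr.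
have q0 : 0 <= 8 * c * lam / twopi R by rewrite !mulr_ge0 ?invr_ge0 ?(ltW c0) ?(ltW tp).
apply: (le_trans (ler_wpM2l q0 (sum_half_pow _))).
rewrite le_eqVlt; apply/orP; left; apply/eqP; field.
by rewrite gt_eqF.
Qed.

End Maximal.

(** * Fatou's theorem on radial limits *)

Section Fatou.
Context {R : realType}.
Local Notation C := R[i].
Local Notation mu := (@lebesgue_measure R).

Lemma rcont_circle (f : C -> C) (r : R) : disc_holo f -> 0 <= r -> r < 1 ->
  rcont (fun t => f (polar r t)).
Proof.
move=> hf r0 r1; apply: (@rcont_polar _ f (fun=> r) id (1 + 2 * r)).
- by rewrite ltr_pwDl// mulr_ge0.
- by move=> t; apply/holo_ccont/hf; rewrite cmod_polar ger0_norm.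
- move=> s t; apply: (le_trans (dist_polar _ _ _ _)).
  by rewrite subrr normr0 add0r ger0_norm// ler_wpM2r// lerDr.
Qed.

Lemma continuous_cmod_circle (f : C -> C) (r : R) : disc_holo f -> 0 <= r -> r < 1 ->
  continuous (fun t => cmod (f (polar r t))).
Proof.
move=> hf r0 r1; apply: continuous_eps => t e e0.
have [d d0 Hd] := rcont_circle hf r0 r1 t e0.
by exists d => // s st; rewrite (le_trans (cmod_dist_le _ _))// Hd.
Qed.

Lemma bmC_circle (f : C -> C) (r : R) : disc_holo f -> 0 <= r -> r < 1 ->
  bmC (fun t => f (polar r t)).
Proof.
by move=> hf r0 r1; apply: polar_circle_bmC => // w wr; apply/holo_ccont/hf; rewrite wr.
Qed.

Lemma disc_holo_dilate (f : C -> C) (s : R) : disc_holo f -> 0 <= s -> s <= 1 ->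
  disc_holo (fun z => f ((s%:C)%C * z)).
Proof.
move=> hf s0 s1 w w1; apply: (@holo_comp _ (fun z => (s%:C)%C * z)).
  by apply: holoZ; exact: holo_id.
by apply: hf; rewrite cmodM cmod_real ger0_norm// (le_lt_trans _ w1)// ler_piMl// cmod_ge0.
Qed.

Lemma polarM (s r t : R) : (s%:C)%C * polar r t = polar (s * r) t :> C.
Proof. by rewrite !polarE rmorphM mulrA. Qed.

Lemma sqr_cmod_submean (f : C -> C) (rho r th : R) : disc_holo f -> 0 <= rho -> rho < 1 ->
  0 < r -> r < 1 ->
  cmod (f (polar (rho * r) th)) ^+ 2 <= Pois rho (fun t => cmod (f (polar r t)) ^+ 2) th.
Proof.
move=> hf rho0 rho1 r0 r1.
have bf := bmC_circle hf (ltW r0) r1; have bc := bmC_cmod bf.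
apply: le_trans (Pois_sqr rho0 rho1 th bc).
have h : cmod (f (polar (rho * r) th)) <= Pois rho (fun t => cmod (f (polar r t))) th.
  rewrite (poisson_formula th rho0 rho1 r0 r1 hf).
  have bp : bmC (fun t => ((pker rho th t)%:C)%C) by exact/bmC_real/bmeas_pker.
  apply: (le_trans (cmod_cmean (bmC_M bp bf))).
  rewrite le_eqVlt; apply/orP; left; apply/eqP; apply: eq_mean => t.
  by rewrite cmodM cmod_real ger0_norm// pker_ge0.
by rewrite !expr2 ler_pM// cmod_ge0.
Qed.

Lemma Jp2E (f : C -> C) r : Jp 2 f r = mean (fun t => cmod (f (polar r t)) ^+ 2).
Proof. by apply: eq_mean => t; rewrite powR_mulrn// cmod_ge0. Qed.

(** The real and imaginary parts of the dilate are Poisson transforms of those of [f] on the same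
    circle, so [Pois_defect] applies to each. *)
Lemma Jp2_dilate_drop (f : C -> C) (s r : R) : disc_holo f -> 0 <= s -> s < 1 -> 0 < r -> r < 1 ->
  mean (fun t => cmod (f (polar r t) - f (polar (s * r) t)) ^+ 2) <= Jp 2 f r - Jp 2 f (s * r).
Proof.
move=> hf s0 s1 r0 r1; rewrite !Jp2E.
have [b1 b2] := bmC_circle hf (ltW r0) r1.
have P1 t : complex.Re (f (polar (s * r) t)) = Pois s (fun t => complex.Re (f (polar r t))) t.
  rewrite (poisson_formula t s0 s1 r0 r1 hf) Re_cmean; apply: eq_mean => u.
  by rewrite cReM /= mul0r subr0.
have P2 t : complex.Im (f (polar (s * r) t)) = Pois s (fun t => complex.Im (f (polar r t))) t.
  rewrite (poisson_formula t s0 s1 r0 r1 hf); apply: eq_mean => u.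
  by rewrite cImM /= mul0r addr0.
have D1 := Pois_defect s0 s1 b1; have D2 := Pois_defect s0 s1 b2.
have Q1 := bmeas_Pois s0 s1 b1; have Q2 := bmeas_Pois s0 s1 b2.
rewrite (@eq_mean _ _ (fun t => (complex.Re (f (polar r t)) - Pois s (fun t => complex.Re (f (polar r t))) t) ^+ 2
  + (complex.Im (f (polar r t)) - Pois s (fun t => complex.Im (f (polar r t))) t) ^+ 2)); last first.
  by move=> t; rewrite sqr_cmod cReD cReN cImD cImN P1 P2.
rewrite (meanD (bmeasX 2 (bmeasB b1 Q1)) (bmeasX 2 (bmeasB b2 Q2))).
rewrite [X in _ <= X - _](@eq_mean _ _ (fun t => complex.Re (f (polar r t)) ^+ 2 + complex.Im (f (polar r t)) ^+ 2));
  last by move=> t; rewrite sqr_cmod.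
rewrite [X in _ <= _ - X](@eq_mean _ _ (fun t => Pois s (fun t => complex.Re (f (polar r t))) t ^+ 2 +
   Pois s (fun t => complex.Im (f (polar r t))) t ^+ 2)); last by move=> t; rewrite sqr_cmod P1 P2.
rewrite (meanD (bmeasX 2 b1) (bmeasX 2 b2)) (meanD (bmeasX 2 Q1) (bmeasX 2 Q2)).
move: D1 D2; move: (mean _) (mean _) (mean _) (mean _) (mean _) (mean _) => x1 x2 x3 x4 x5 x6.
lra.
Qed.

(** Superlevel set of a radial maximal function. Starting at radius [1 / 2] meets the condition of
    [Pois_maximal] on the ratio of radii; being a union of open sets makes it measurable although
    the union is uncountable. *)
Definition ray_exceeds (f : C -> C) (lam r : R) : set R :=
  \bigcup_(s in [set s | 1 / 2 <= s < r]) [set th | lam < cmod (f (polar s th))].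

Lemma measurable_ray_exceeds (f : C -> C) (lam r : R) : disc_holo f -> r <= 1 ->
  measurable (ray_exceeds f lam r).
Proof.
move=> hf r1; apply: open_measurable; apply: bigcup_open => s /= /andP[s2 sr].
have cs : continuous (fun t => cmod (f (polar s t))).
  by apply: continuous_cmod_circle => //; [lra|exact: lt_le_trans r1].
suff : open ((fun t => cmod (f (polar s t))) @^-1` [set x | lam < x]) by [].
by apply: open_comp; [move=> t _; exact: cs|exact: open_gt].
Qed.

Definition core_arc (eta : R) : set R := `[eta, twopi R - eta]%classic.

Lemma measurable_core_arc eta : measurable (core_arc eta).
Proof. exact: measurable_itv. Qed.

Lemma ray_exceeds_measure (eta : R) : 0 < eta -> eta <= pi -> exists2 K, 0 < K &
  forall (f : C -> C) (lam r : R), disc_holo f -> 0 < lam -> 0 < r -> r < 1 ->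
  (mu (ray_exceeds f lam r `&` core_arc eta) <=
    (K / lam ^+ 2 * mean (fun t => cmod (f (polar r t)) ^+ 2))%:E)%E.
Proof.
move=> eta0 etapi; have [K K0 HK] := Pois_maximal eta0 etapi.
have tp := @twopi_gt0 R.
(* The 3 is the constant of the maximal inequality, and [twopi R] turns a mean into an integral over
   the period. *)
exists (3 * K * twopi R); first by rewrite (mulr_gt0 _ tp)// mulr_gt0.
move=> f lam r hf lam0 r0 r1.
have bc := bmeasX 2 (bmC_cmod (bmC_circle hf (ltW r0) r1)).
pose h t := cmod (f (polar r t)) ^+ 2; have h0 t : 0 <= h t by exact: sqr_ge0.
pose H := h \_ `[0%R, twopi R]%classic.
have lH : locally_integrable [set: R] H.
  by apply: integrable_locally_restrict => //; exact: bmeas_integrable_itv.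
pose c := lam ^+ 2 / K; have c0 : 0 < c by rewrite divr_gt0// exprn_gt0.
have mS : measurable (ray_exceeds f lam r `&` core_arc eta).
  apply: measurableI; last exact: measurable_core_arc.
  by apply: measurable_ray_exceeds => //; exact: ltW.
have mH : measurable [set x | (c%:E < HL_maximal H x)%E].
  rewrite -[X in measurable X]setTI; apply: emeasurable_fun_o_infty => //.
  exact: measurable_HL_maximal.
have sub : ray_exceeds f lam r `&` core_arc eta `<=` [set x | (c%:E < HL_maximal H x)%E].
  move=> th [[s /= /andP[s2 sr] ls] thI]; rewrite ltNge; apply/negP => hle.
  have r1' : 1 / 2 <= s / r.
    by rewrite ler_pdivlMr// (le_trans _ s2)// ler_piMr ?divr_ge0// ltW.
  have r2' : s / r < 1 by rewrite ltr_pdivrMr// mul1r.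
  have rho0 : 0 <= s / r by rewrite (le_trans _ r1')// divr_ge0.
  rewrite /core_arc /= in_itv /= in thI.
  have h1 := HK h th (s / r) c bc h0 thI r1' r2' hle.
  have := sqr_cmod_submean th hf rho0 r2' r0 r1; rewrite divfK ?gt_eqF// => h2.
  have := le_trans h2 h1; rewrite /c mulrC divfK ?gt_eqF// leNgt => /negP; apply.
  by rewrite !expr2 ltr_pM// ltW.
apply: (@le_trans _ _ (mu [set x | (c%:E < HL_maximal H x)%E])).
  by apply: le_measure => //; rewrite inE.
apply: (le_trans (maximal_inequality lH c0)).
have -> : (\int[mu]_(y in [set: R]) `|(H y)%:E|)%E = (twopi R * mean h)%:E.
  rewrite mean_lebesgue// mulVKf ?gt_eqF//.
  rewrite /Rintegral fineK; last first.
    by apply: integrable_fin_num => //; exact: bmeas_integrable_itv.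
  rewrite [RHS]integral_mkcond; apply: eq_integral => t _; rewrite /H !patchE.
  by case: ifPn => _; rewrite ?gee0_abs ?lee_fin ?h0// abse0.
rewrite -EFinM lee_fin le_eqVlt; apply/orP; left; apply/eqP; rewrite /c.
by field; rewrite !gt_eqF.
Qed.

Definition radius_seq (n : nat) : R := 1 - (n.+2%:R)^-1.

Lemma radius_seq_itv n : 1 / 2 <= radius_seq n < 1.
Proof.
rewrite /radius_seq ltrBlDr ltrDl invr_gt0 ltr0n andbT.
have : ((n.+2%:R)^-1 : R) <= 2^-1 by rewrite lef_pV2 ?posrE ?ltr0n// ler_nat.
by move: (n.+2%:R^-1) => x; lra.
Qed.

Lemma radius_seq_mono m n : (m <= n)%N -> radius_seq m <= radius_seq n.
Proof.
by move=> mn; rewrite /radius_seq lerD2l lerN2 lef_pV2 ?posrE ?ltr0n// ler_nat !ltnS.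
Qed.

Lemma inv_small (e : R) : 0 < e -> exists n : nat, (n.+1%:R)^-1 < e.
Proof.
move=> e0; exists (Num.bound e^-1); rewrite -[ltRHS]invrK ltf_pV2 ?posrE ?invr_gt0 ?ltr0n//.
apply: lt_trans (archi_boundP _) _; first by rewrite invr_ge0 ltW.
by rewrite ltr_nat.
Qed.

Lemma radius_seq_cvg r : r < 1 -> exists N, forall n, (N <= n)%N -> r < radius_seq n.
Proof.
move=> r1; have [n Hn] := inv_small (e := 1 - r) ltac:(by rewrite subr_gt0).
exists n => k nk; rewrite /radius_seq ltrBrDr -ltrBrDl (le_lt_trans _ Hn)//.
by rewrite lef_pV2 ?posrE ?ltr0n// ler_nat ltnS (leq_trans nk).
Qed.

Definition dilate_diff (f : C -> C) (s : R) (z : C) : C := f z - f ((s%:C)%C * z).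

Lemma disc_holo_dilate_diff (f : C -> C) (s : R) : disc_holo f -> 0 <= s -> s <= 1 ->
  disc_holo (dilate_diff f s).
Proof.
by move=> hf s0 s1 w w1; apply: holoB; [exact: hf|exact: (disc_holo_dilate hf s0 s1)].
Qed.

(** For radii [r > s], the drop from [s r] to [r] is at most the drop from [s ^ 2] to the supremum.
    This bound is free of [r], so [r] can tend to 1 by continuity of the measure. *)
Lemma ray_exceeds_full_measure (eta : R) : 0 < eta -> eta <= pi -> exists2 K, 0 < K &
  forall (f : C -> C) (lam s : R), Hp 2 f -> 0 < lam -> 0 < s -> s < 1 ->
  (mu (ray_exceeds (dilate_diff f s) lam 1 `&` core_arc eta) <=
    (K / lam ^+ 2 * (Np 2 f - Jp 2 f (s ^+ 2)))%:E)%E.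
Proof.
move=> eta0 etapi; have [K K0 HK] := ray_exceeds_measure eta0 etapi.
exists K => // f lam s hpf lam0 s0 s1; have hf := hpf.1.
pose d := dilate_diff f s.
have hd : disc_holo d by exact: (disc_holo_dilate_diff hf (ltW s0) (ltW s1)).
pose F n := ray_exceeds d lam (radius_seq n) `&` core_arc eta.
have mF n : measurable (F n).
  apply: measurableI; last exact: measurable_core_arc.
    apply: measurable_ray_exceeds => //.
  by case/andP: (radius_seq_itv n) => _ /ltW.
have UF : ray_exceeds d lam 1 `&` core_arc eta = \bigcup_n F n.
  apply/seteqP; split.
    move=> th [[r /= /andP[r2 r1] lr] thI]; have [N HN] := radius_seq_cvg r1.
    by exists N => //; split => //; exists r => //=; rewrite r2 HN.
  move=> th [n _ [[r /= /andP[r2 rn] lr] thI]]; split => //; exists r => //=.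
  by rewrite r2 (lt_trans rn)//; case/andP: (radius_seq_itv n).
have mono : {homo F : n m / (n <= m)%N >-> (n <= m)%O}.
  move=> n m nm; apply/subsetPset; apply: setSI => th [r /= /andP[r2 rn] lr].
  by exists r => //=; rewrite r2 (lt_le_trans rn)// radius_seq_mono.
have cvgF := @nondecreasing_cvg_mu _ _ _ mu _ mF (bigcup_measurable (fun n _ => mF n)) mono.
rewrite -/d UF -(cvg_lim _ cvgF)//.
apply: lime_le; first by apply/cvg_ex; eexists; exact: cvgF.
have [N HN] := radius_seq_cvg s1; near=> n.
have /andP[rn2 rn1] := radius_seq_itv n.
have rn0 : 0 < radius_seq n by rewrite (lt_le_trans _ rn2).
apply: (le_trans (HK d lam _ hd lam0 rn0 rn1)); rewrite lee_fin ler_wpM2l//.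
  by rewrite divr_ge0 ?sqr_ge0// ltW.
rewrite (@eq_mean _ _ (fun t => cmod (f (polar (radius_seq n) t) - f (polar (s * radius_seq n) t)) ^+ 2)); last first.
  by move=> t; rewrite /d /dilate_diff polarM.
apply: (le_trans (Jp2_dilate_drop hf (ltW s0) s1 rn0 rn1)).
apply: lerB; first by apply: (Jp_le_Np _ hpf (ltW rn0) rn1).
apply: (Jp_monotone hf) => //; [by rewrite ler1n|exact: sqr_ge0| |].
  rewrite expr2 ler_wpM2l ?(ltW s0)// ltW// HN//; near: n; exact: nbhs_infty_ge.
by rewrite mulr_ilt1// ltW.
Unshelve. all: by end_near. Qed.

Definition radially_cauchy (f : C -> C) (th : R) : Prop :=
  forall e, 0 < e -> exists2 r0, r0 < 1 & forall r r', r0 < r -> r < 1 -> r0 < r' -> r' < 1 ->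
    cmod (f (polar r th) - f (polar r' th)) <= e.

(** The dilate [f (s z)] is continuous across the unit circle and has no radial oscillation there,
    so oscillation above [e] makes [dilate_diff f s] exceed [e / 3] somewhere on the ray. The
    measure of such rays tends to 0 as [s] tends to 1. *)
Lemma radial_oscillation_negligible (f : C -> C) (eta e : R) : 0 < eta -> eta <= pi -> 0 < e ->
  Hp 2 f ->
  mu.-negligible (core_arc eta `&`
    [set th | forall r0, r0 < 1 -> exists r r', [/\ r0 < r, r < 1, r0 < r', r' < 1 &
       e < cmod (f (polar r th) - f (polar r' th))]]).
Proof.
move=> eta0 etapi e0 hpf; have hf := hpf.1.
have [K K0 HK] := ray_exceeds_full_measure eta0 etapi.
pose lam := e / 3; have lam0 : 0 < lam by rewrite divr_gt0.
have p2 : 1 <= (2 : R) by rewrite ler1n.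
have ex (k : nat) : exists s, [/\ 0 < s, s < 1 & K / lam ^+ 2 * (Np 2 f - Jp 2 f (s ^+ 2)) <= (k.+1%:R)^-1].
  pose e1 := lam ^+ 2 / K / k.+1%:R.
  have e10 : 0 < e1 by rewrite !divr_gt0// exprn_gt0.
  have [r0 [r00 r01 Hr]] := Np_approx p2 hpf e10.
  exists ((1 + r0) / 2); split; [lra|lra|].
  have h := Hr (((1 + r0) / 2) ^+ 2) ltac:(nra) ltac:(nra).
  have {}h : Np 2 f - Jp 2 f (((1 + r0) / 2) ^+ 2) <= e1 by lra.
  have q0 : 0 <= K / lam ^+ 2 by rewrite divr_ge0 ?sqr_ge0// ltW.
  apply: (le_trans (ler_wpM2l q0 h)); rewrite /e1 le_eqVlt; apply/orP; left; apply/eqP.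
  by field; rewrite !gt_eqF//= ltr0n.
have [s Hs] := choice ex.
pose T k := ray_exceeds (dilate_diff f (s k)) lam 1 `&` core_arc eta.
have mT k : measurable (T k).
  have [s0 s1 _] := Hs k.
  apply: measurableI; last exact: measurable_core_arc.
  apply: measurable_ray_exceeds => //.
  exact: (disc_holo_dilate_diff hf (ltW s0) (ltW s1)).
have mI : measurable (\bigcap_k T k) by exact: bigcapT_measurable.
exists (\bigcap_k T k); split.
- exact: mI.
- apply/eqP; rewrite eq_le measure_ge0 andbT; apply/lee_addgt0Pr => d d0.
  rewrite add0e; have [k Hk] := inv_small d0; have [s0 s1 hs] := Hs k.
  apply: (@le_trans _ _ (mu (T k))).
    apply: le_measure; [by apply/mem_set|by apply/mem_set; exact: mT|by move=> th; exact].
  apply: (le_trans (HK f lam (s k) hpf lam0 s0 s1)); rewrite lee_fin.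
  by rewrite (le_trans hs)// ltW.
move=> th [thI osc] k _; split => //; have [s0 s1 _] := Hs k.
apply: contrapT => nS.
have small r : 1 / 2 <= r -> r < 1 -> cmod (f (polar r th) - f (polar (s k * r) th)) <= lam.
  move=> r2 r1; rewrite leNgt; apply/negP => h; apply: nS; exists r; first by rewrite /= r2 r1.
  by rewrite /= /dilate_diff polarM.
have cfs : ccont f (polar (s k) th).
  by apply/holo_ccont/hf; rewrite cmod_polar gtr0_norm.
have l20 : 0 < lam / 2 by rewrite divr_gt0.
have [d d0 Hd] := cfs _ l20.
have [r [r' [r1 r2 r3 r4]]] := osc (Order.max (1 / 2) (1 - d)) ltac:(by rewrite gt_max; lra).
move: r1 r3; rewrite !gt_max => /andP[a1 a2] /andP[a3 a4].
have near u : 1 - d < u -> u < 1 -> 1 / 2 < u -> cmod (f (polar (s k * u) th) - f (polar (s k) th)) <= lam / 2.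
  move=> u1 u2 u3; apply: Hd; apply: (le_lt_trans (dist_polar _ _ _ _)).
  rewrite subrr normr0 mulr0 addr0 -{2}(mulr1 (s k)) -mulrBr normrM gtr0_norm//.
  rewrite ltr0_norm ?subr_lt0// opprB; nra.
apply/negP; rewrite -leNgt.
have n1 := near r a2 r2 a1; have n2 := near r' a4 r4 a3.
have m1 := small r (ltW a1) r2; have m2 := small r' (ltW a3) r4.
have t1 := cmod_distD (f (polar (s k * r) th)) (f (polar r th)) (f (polar r' th)).
have t2 := cmod_distD (f (polar (s k * r') th)) (f (polar (s k * r) th)) (f (polar r' th)).
have t3 := cmod_distD (f (polar (s k) th)) (f (polar (s k * r) th)) (f (polar (s k * r') th)).
rewrite (cmodB (f (polar (s k * r') th)) (f (polar r' th))) in t2.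
rewrite (cmodB (f (polar (s k) th)) (f (polar (s k * r') th))) in t3.
rewrite /lam in n1 n2 m1 m2; lra.
Qed.

Lemma fatou (f : C -> C) : Hp 2 f ->
  mu.-negligible (`[0%R, twopi R[%classic `&` [set th | ~ radially_cauchy f th]).
Proof.
move=> hpf.
pose etaf (m : nat) : R := (m.+1%:R)^-1.
have eta0 m : 0 < etaf m by rewrite invr_gt0 ltr0n.
have etapi m : etaf m <= pi.
  rewrite (@le_trans _ _ 1)//; first by rewrite invf_le1 ?ltr0n// ler1n.
  by rewrite (le_trans _ (pi_ge2 R))// ler1n.
pose N m k := core_arc (etaf m) `&`
    [set th | forall r0, r0 < 1 -> exists r r', [/\ r0 < r, r < 1, r0 < r', r' < 1 &
       (k.+1%:R)^-1 < cmod (f (polar r th) - f (polar r' th))]].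
have nN : mu.-negligible (\bigcup_m \bigcup_k N m k).
  apply: negligible_bigcup => m; apply: negligible_bigcup => k.
  by apply: radial_oscillation_negligible => //; rewrite invr_gt0 ltr0n.
(* The angle 0 lies in none of the arcs, so it is added as a null set of its own. *)
have n0 : mu.-negligible [set (0 : R)].
  by apply/negligibleP => //; exact: lebesgue_measure_set1.
apply: negligibleS (negligibleU n0 nN) => th [].
rewrite /= in_itv /= => /andP[]; rewrite le_eqVlt => /predU1P[<- _ _|th0 th1 nC]; first by left.
right; have [e e0 He] : exists2 e, 0 < e & forall r0, r0 < 1 ->
    exists r r', [/\ r0 < r, r < 1, r0 < r', r' < 1 & e < cmod (f (polar r th) - f (polar r' th))].
  apply: contrapT => H; apply: nC => e e0; apply: contrapT => H'; apply: H.
  exists e => // r0 r01; apply: contrapT => H''; apply: H'; exists r0 => // r r' h1 h2 h3 h4.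
  by rewrite leNgt; apply/negP => h5; apply: H''; exists r, r'.
have [k Hk] := inv_small e0.
have [m Hm] := inv_small (e := Order.min th (twopi R - th)) ltac:(by rewrite lt_min th0 subr_gt0).
move: Hm; rewrite lt_min => /andP[m1 m2].
exists m => //; exists k => //; split.
  by rewrite /core_arc /= in_itv /= (ltW m1)/= lerBrDr -lerBrDl ltW.
move=> r0 /He[r [r' [h1 h2 h3 h4 h5]]]; exists r, r'; split => //; exact: lt_trans h5.
Qed.

End Fatou.

(** * Exceptional sets of angles and the contact set *)

Section ContactSet.
Context {R : realType}.
Local Notation C := R[i].
Local Notation mu := (@lebesgue_measure R).

Lemma real_cauchy_limit (u : nat -> R) :
  (forall e, 0 < e -> exists N, forall m n, (N <= m)%N -> (N <= n)%N -> `|u m - u n| <= e) ->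
  exists l : R, u @ \oo --> l.
Proof.
move=> H; suff : cvg (u @ \oo) by move=> cu; exists (lim (u @ \oo)).
apply: cauchy_cvg; apply: cauchy_exP => e e0.
have [N HN] := H (e / 2) (divr_gt0 e0 (ltr0n _ 2)).
exists (u N); exists N => // n /= Nn; rewrite -ball_normE /=.
by rewrite (le_lt_trans (HN _ _ (leqnn _) Nn))// ltr_pdivrMr// ltr_pMr// ltr1n.
Qed.

Lemma cvg_eps (u : nat -> R) (l : R) : u @ \oo --> l -> forall e, 0 < e ->
  exists N, forall n, (N <= n)%N -> `|u n - l| <= e.
Proof.
move=> /cvgrPdist_le H e /H[N _ HN]; exists N => n Nn; rewrite distrC.
exact: HN.
Qed.

Lemma complex_cauchy_limit (u : nat -> C) :
  (forall e, 0 < e -> exists N, forall m n, (N <= m)%N -> (N <= n)%N -> cmod (u m - u n) <= e) ->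
  exists l : C, forall e, 0 < e -> exists N, forall n, (N <= n)%N -> cmod (u n - l) <= e.
Proof.
move=> H.
have [a /cvg_eps Ha] : exists a : R, (fun n => complex.Re (u n)) @ \oo --> a.
  apply: real_cauchy_limit => e /H[N HN]; exists N => m n Nm Nn.
  by rewrite (le_trans _ (HN m n Nm Nn))// -cReN -cReD cmod_Re.
have [b /cvg_eps Hb] : exists b : R, (fun n => complex.Im (u n)) @ \oo --> b.
  apply: real_cauchy_limit => e /H[N HN]; exists N => m n Nm Nn.
  by rewrite (le_trans _ (HN m n Nm Nn))// -cImN -cImD cmod_Im.
exists (Complex a b) => e e0; have e2 : 0 < e / 2 by rewrite divr_gt0.
have [N1 H1] := Ha _ e2; have [N2 H2] := Hb _ e2.
exists (maxn N1 N2) => n; rewrite geq_max => /andP[n1 n2].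
rewrite (le_trans (cmod_le_ReIm _))// cReD cReN cImD cImN /= (splitr e).
by apply: lerD; [exact: H1|exact: H2].
Qed.

Lemma radially_cauchy_limit (f : C -> C) (th : R) : radially_cauchy f th -> exists l : C,
  forall e, 0 < e -> exists2 r0, r0 < 1 & forall r, r0 < r -> r < 1 -> cmod (f (polar r th) - l) <= e.
Proof.
move=> H.
have [l Hl] : exists l : C, forall e, 0 < e -> exists N, forall n, (N <= n)%N ->
    cmod (f (polar (radius_seq n) th) - l) <= e.
  apply: complex_cauchy_limit => e /H[r0 r01 Hr]; have [N HN] := radius_seq_cvg r01.
  exists N => m n Nm Nn; have /andP[_ m1] := @radius_seq_itv R m.
  have /andP[_ n1] := @radius_seq_itv R n.
  by apply: Hr => //; apply: HN.
exists l => e e0; have e2 : 0 < e / 2 by rewrite divr_gt0.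
have [r0 r01 Hr] := H _ e2; have [N HN] := Hl _ e2; have [M HM] := radius_seq_cvg r01.
exists r0 => // r r0r r1; pose n := maxn N M.
rewrite (le_trans (cmod_distD (f (polar (radius_seq n) th)) _ _))// (splitr e).
have /andP[_ n1] := @radius_seq_itv R n.
apply: lerD; last by apply: HN; exact: leq_maxl.
by apply: Hr => //; apply: HM; exact: leq_maxr.
Qed.

Lemma radial_limit_cvg (f : C -> C) (th : R) (l : C) :
  (forall e, 0 < e -> exists2 r0, r0 < 1 & forall r, r0 < r -> r < 1 -> cmod (f (polar r th) - l) <= e) ->
  ((f : Cx R -> Cx R) (polar r th) @[r --> at_left (1 : R)] --> (l : Cx R)).
Proof.
move=> H; apply/(@cvgrPdist_le _ (C^o)) => _ /Cgt0[e e0 ->].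
have [r0 r01 Hr] := H e e0; near=> r.
rewrite leC_cmod cmodB; apply: Hr; near: r; [exact: nbhs_left_gt|exact: nbhs_left_lt].
Unshelve. all: by end_near. Qed.

Lemma mean_indic (B : set R) : measurable B ->
  (mean \1_B)%:E = ((twopi R)^-1%:E * mu (B `&` `[0%R, twopi R[%classic))%E.
Proof.
move=> mB; have bB : bmeas (\1_B : R -> R) by exact: bmeas_indic.
rewrite mean_lebesgue// -Rintegral_itv_bndo_bndc; last first.
  by apply: integrableS (bmeas_integrable_itv 0 (twopi R) bB) => //; exact: subset_itv_co_cc.
rewrite EFinM /Rintegral fineK; last first.
  apply: integrable_fin_num => //.
  by apply: integrableS (bmeas_integrable_itv 0 (twopi R) bB) => //; exact: subset_itv_co_cc.
by rewrite integral_indic// setIC.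
Qed.

Lemma bounded_Hp (p : R) (f : C -> C) : 0 <= p -> disc_holo f ->
  (forall z, cmod z < 1 -> cmod (f z) < 1) -> Hp p f.
Proof.
move=> p0 hf f1; split => //; exists 1 => r r0 r1.
rewrite /Jp -[leRHS](mean_cst (R := R)).
apply: (le_mean (bmeas_Jp hf p0 r0 r1) (bmeas_cst _ 1)) => t _.
have e1 : (1 : R) `^ p = 1 by rewrite powR1.
rewrite -[leRHS]e1; apply: ge0_ler_powR => //; rewrite ?nnegrE ?cmod_ge0//.
by apply/ltW/f1; rewrite cmod_polar ger0_norm.
Qed.

(* Up to a null set, the intersection over [i] is the contact set; off the [i]-th set,
   [phi] maps the circles of radii [radius_seq j], [i <= j], into a fixed smaller disc. *)
Definition limsup_sets (phi : C -> C) (i : nat) : set R :=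
  \bigcup_(j in [set j | (i <= j)%N])
    [set t | 1 - (i.+1%:R)^-1 < cmod (phi (polar (radius_seq j) t))].

Section exceptional_sets.
Variable phi : C -> C.
Hypotheses (hphi : disc_holo phi) (phi1 : forall z : C, cmod z < 1 -> cmod (phi z) < 1).

Lemma measurable_limsup_sets i : measurable (limsup_sets phi i).
Proof.
apply: bigcup_measurable => j _; have /andP[j2 j1] := @radius_seq_itv R j.
have j0 : (0 : R) <= radius_seq j by rewrite (le_trans _ j2)// divr_ge0.
apply: open_measurable.
suff : open ((fun t => cmod (phi (polar (radius_seq j) t))) @^-1` [set x | 1 - (i.+1%:R)^-1 < x]) by [].
apply: open_comp; last exact: open_gt.
by move=> t _; exact: continuous_cmod_circle.
Qed.

Lemma limsup_sets_decreasing i k : (i <= k)%N -> limsup_sets phi k `<=` limsup_sets phi i.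
Proof.
move=> ik t [j /= kj h]; exists j => /=; first exact: leq_trans kj.
by apply: le_lt_trans h; rewrite lerD2l lerN2 lef_pV2 ?posrE ?ltr0n// ler_nat ltnS.
Qed.

(** Where the radial limit exists its modulus is at most 1 since [phi] maps into the disc, and at
    least 1 on the intersection, where [cmod phi] comes arbitrarily close to 1 at radii arbitrarily
    close to 1. *)
Lemma limsup_sets_contact :
  mu.-negligible (contact_set (phi : Cx R -> Cx R)) ->
  mu.-negligible (`[0%R, twopi R[%classic `&` \bigcap_i limsup_sets phi i).
Proof.
move=> nc; have nf := fatou (bounded_Hp (ltac:(by []) : 0 <= (2 : R)) hphi phi1).
apply: negligibleS (negligibleU nc nf) => t [tI tB].
have [rc|nrc] := pselect (radially_cauchy phi t); [left|by right].
split; first by move: tI; rewrite /= in_itv.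
have [l Hl] := radially_cauchy_limit rc; exists l; split; first exact: radial_limit_cvg.
apply/le_anti/andP; split; apply/ler_addgt0Pl => e e0.
  have [r0 r01 Hr] := Hl e e0.
  pose r := Order.max 0 ((r0 + 1) / 2).
  have r1 : r < 1 by rewrite gt_max ltr01; lra.
  have rr0 : r0 < r by rewrite lt_max; apply/orP; right; lra.
  have h := Hr r rr0 r1; have := cmod_sub_ge l (phi (polar r t)); rewrite cmodB.
  have : cmod (phi (polar r t)) < 1 by apply: phi1; rewrite cmod_polar ger0_norm// le_max lexx.
  lra.
have e2 : 0 < e / 2 by rewrite divr_gt0.
have [r0 r01 Hr] := Hl _ e2; have [N HN] := radius_seq_cvg r01.
have [k Hk] := inv_small e2.
have [j /= nj] := tB (maxn N k) I; have /andP[_ j1] := @radius_seq_itv R j.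
have h := Hr _ (HN j (leq_trans (leq_maxl _ _) nj)) j1.
have h2 : ((maxn N k).+1%:R)^-1 <= (k.+1%:R)^-1 :> R.
  by rewrite lef_pV2 ?posrE ?ltr0n// ler_nat ltnS leq_maxr.
have := cmod_sub_ge (phi (polar (radius_seq j) t)) l.
move: h2 Hk h; move: (_^-1) (_^-1) => a b; lra.
Qed.

(** Continuity from above requires a set of finite measure, whence the restriction to one period. *)
Lemma limsup_sets_small : mu.-negligible (contact_set (phi : Cx R -> Cx R)) ->
  forall d : R, 0 < d -> exists N, forall i, (N <= i)%N -> mean \1_(limsup_sets phi i) <= d.
Proof.
move=> nc d d0; have tp := @twopi_gt0 R.
pose T i := limsup_sets phi i `&` `[0%R, twopi R[%classic.
have mT i : measurable (T i) by apply: measurableI => //; exact: measurable_limsup_sets.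
have mono : {homo T : n m / (n <= m)%N >-> (m <= n)%O}.
  by move=> n m nm; apply/subsetPset; apply: setSI; exact: limsup_sets_decreasing.
have T0 : (mu (T 0%N) < +oo)%E.
  apply: (@le_lt_trans _ _ (mu `[0%R, twopi R[%classic)).
    by apply: le_measure; [rewrite inE; exact: mT|rewrite inE; exact: measurable_itv|exact: subIsetr].
  by rewrite lebesgue_measure_itv/= lte_fin tp -EFinB ltry.
have mI : measurable (\bigcap_i T i) by exact: bigcapT_measurable.
have cvgT := @nonincreasing_cvg_mu _ _ _ mu _ T0 mT mI mono.
have I0 : mu (\bigcap_i T i) = 0%E.
  apply: measure_negligible => //; apply: negligibleS (limsup_sets_contact nc) => t Tt.
  by split; [case: (Tt 0%N I)|move=> i _; case: (Tt i I)].
have {}cvgT : mu (T n) @[n --> \oo] --> (0 : \bar R)%E by rewrite -I0; exact: cvgT.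
have [N _ HN] : \forall n \near \oo, (mu (T n) < (twopi R * d)%:E)%E.
  have := cvgT; move/fine_cvgP => [fT /cvgrPdist_lt/(_ (twopi R * d) (mulr_gt0 tp d0)) H].
  near=> n; have : mu (T n) \is a fin_num by near: n.
  move=> /fineK <-; rewrite lte_fin.
  have : `|0 - fine (mu (T n))| < twopi R * d by near: n.
  by rewrite sub0r normrN; apply: le_lt_trans; exact: ler_norm.
exists N => i Ni; rewrite -lee_fin mean_indic; last exact: measurable_limsup_sets.
apply: (@le_trans _ _ ((twopi R)^-1%:E * (twopi R * d)%:E)%E).
  apply: lee_wpmul2l; first by rewrite lee_fin invr_ge0 ltW.
  by apply/ltW/HN.
by rewrite -EFinM mulKf// gt_eqF.
Unshelve. all: by end_near. Qed.

Lemma limsup_sets_out i j t : (i <= j)%N -> ~ limsup_sets phi i t ->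
  cmod (phi (polar (radius_seq j) t)) <= 1 - (i.+1%:R)^-1.
Proof. by move=> ij nB; rewrite leNgt; apply/negP => h; apply: nB; exists j. Qed.

End exceptional_sets.
End ContactSet.

(** * Unit vectors that are small on a compact disc *)

Section SmallOnCompacts.
Context {R : realType}.
Local Notation C := R[i].
Implicit Types (p : R) (M : set (C -> C)).

(* The scale-free form of the local bound is obtained by applying the affine one to [f / ||f||]. *)
Lemma Hp_eval p s : 1 <= p -> 0 <= s -> s < 1 -> exists2 K, 0 < K &
  forall f, Hp p f -> forall z : C, cmod z <= s -> cmod (f z) `^ p <= K * Np p f.
Proof.
move=> p1 s0 s1; have p00 : 0 < p := lt_le_trans ltr01 p1.
have p0 := ltW p00.
have [K K0 HK] := Hp_lipschitz p1 s0 s1.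
exists ((K * 2) `^ p); first by rewrite powR_gt0// mulr_gt0.
move=> f hf z zs; have N0 := Np_ge0 p0 hf.
have H (l : R) : 0 <= l -> l * cmod (f z) <= K * (1 + l `^ p * Np p f).
  move=> l0; have [+ _] := HK _ (HpZ (l%:C)%C p0 hf) z z zs zs.
  by rewrite cmodM cmod_real ger0_norm// NpZ// cmod_real ger0_norm.
have [N1|N1] := ltP 0 (Np p f).
  have q0 : 0 < Np p f `^ p^-1 by rewrite powR_gt0.
  have e : (Np p f `^ p^-1) `^ p = Np p f by rewrite -powRrM mulVf ?gt_eqF// powRr1.
  rewrite -[X in _ * X]e -powRM; [|by rewrite mulr_ge0// ltW|exact: ltW].
  apply: ge0_ler_powR => //; rewrite ?nnegrE ?cmod_ge0//.
    by rewrite mulr_ge0 ?ltW// mulr_gt0.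
  have := H (Np p f `^ p^-1)^-1; rewrite invr_ge0 (ltW q0) => /(_ isT).
  rewrite -powRN -powRrM mulNr mulVf ?gt_eqF// powR_inv1// mulVf ?gt_eqF//.
  rewrite powRN [_^-1 * _]mulrC ler_pdivrMr// => h; apply: (le_trans h).
have NE : Np p f = 0 by apply/le_anti; rewrite N1 N0.
rewrite NE mulr0; suff -> : cmod (f z) = 0 by rewrite powR0// gt_eqF.
apply/le_anti; rewrite cmod_ge0 andbT leNgt; apply/negP => c0.
(* When [Np p f] is 0, [H] bounds every multiple [l * cmod (f z)] by [K]; this multiple equals
   [K + 1]. *)
have l0 : 0 <= (K + 1) / cmod (f z) by apply: divr_ge0; [lra|exact: ltW].
have := H _ l0; rewrite NE mulr0 addr0 mulr1 divfK ?gt_eqF//; lra.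
Qed.

Lemma Np_eq0 p f : 1 <= p -> Hp p f -> Np p f = 0 -> forall z : C, cmod z < 1 -> f z = 0.
Proof.
move=> p1 hf N0 z z1; have [K K0 HK] := Hp_eval p1 (cmod_ge0 z) z1.
have := HK f hf z (lexx _); rewrite N0 mulr0 => h.
apply/eqP; rewrite -cmod_eq0; apply/eqP/(@powR_eq0_eq0 _ _ p).
by apply/le_anti; rewrite h powR_ge0.
Qed.

Lemma disc_net (s d : R) : 0 < d -> exists l : seq C, (forall w, w \in l -> cmod w <= s) /\
  forall z : C, cmod z <= s -> exists2 w, w \in l & cmod (z - w) <= d.
Proof.
move=> d0.
have [l [l1 l2]] : exists l : seq C, (forall w, w \in l -> cmod w <= s) /\
  forall z : C, 0 <= cmod z <= s -> exists2 w, w \in l & cmod (z - w) <= d.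
  apply: (@annulus_ind _ 0 s (fun A => exists l : seq C, (forall w, w \in l -> cmod w <= s) /\
    forall z : C, A z -> exists2 w, w \in l & cmod (z - w) <= d)).
  - by exists [::].
  - move=> A B [l [l1 l2]] [k [k1 k2]]; exists (l ++ k); split.
      by move=> w; rewrite mem_cat => /orP[/l1|/k1].
    by move=> z [/l2|/k2][w wl h]; exists w => //; rewrite mem_cat wl ?orbT.
  - by move=> A B AB [l [l1 l2]]; exists l; split => // z /AB/l2.
  - move=> z /andP[_ zs]; exists d => //; exists [:: z]; split.
      by move=> w; rewrite inE => /eqP ->.
    by move=> w wz; exists z; [rewrite inE|exact: ltW].
exists l; split => // z zs; apply: l2; by rewrite cmod_ge0.
Qed.

Definition lin_closed M : Prop :=
  M (fun=> 0) /\ forall (a : C) f g, M f -> M g -> M (fun z => a * f z + g z).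

Lemma lin_closed_sum M (I : Type) (s : seq I) (c : I -> C) (f : I -> C -> C) : lin_closed M ->
  (forall i, M (f i)) -> M (fun z => \sum_(i <- s) c i * f i z).
Proof.
move=> [M0 ML] Mf; elim: s => [|i s IH].
  by under eq_fun do rewrite big_nil.
under eq_fun do rewrite big_cons; exact: ML.
Qed.

(** Vanishing on [l] imposes [size l] linear conditions on one coefficient more, so a nonzero
    combination exists; independence and [Np_eq0] allow it to be normalised. *)
Lemma vanishing_element M p (l : seq C) : 1 <= p -> (forall f, M f -> Hp p f) -> lin_closed M ->
  infinite_dim (M : set (Cx R -> Cx R)) ->
  exists f, [/\ M f, Np p f = 1 & forall w, w \in l -> f w = 0].
Proof.
move=> p1 MH ML iM; have p00 : 0 < p := lt_le_trans ltr01 p1.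
have p0 := ltW p00.
have [fs [Mfs free]] := iM (size l).+1.
pose A : 'M[C]_((size l).+1, size l) := \matrix_(i, j) (fs i (tnth (in_tuple l) j) : C).
pose v := nz_row (kermx A).
have v0 : v != 0.
  rewrite nz_row_eq0 kermx_eq0 /row_free; apply/eqP => h.
  by have := rank_leq_col A; rewrite h ltnn.
have vA : v *m A = 0 by apply/sub_kermxP; exact: nz_row_sub.
pose f z : C := \sum_(i < (size l).+1) v ord0 i * fs i z.
have Mf : M f by exact: lin_closed_sum.
have N0 := Np_ge0 p0 (MH _ Mf).
have N1 : 0 < Np p f.
  rewrite lt_neqAle N0 andbT; apply/eqP => NE; case/negP: v0; apply/eqP/rowP => i.
  rewrite mxE; apply: (free (fun i => v ord0 i)) => z z1.
  exact: (Np_eq0 p1 (MH _ Mf) (esym NE)).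
have q0 : 0 < Np p f `^ p^-1 by rewrite powR_gt0.
exists (fun z => (((Np p f `^ p^-1)^-1)%:C)%C * f z); split.
- have := ML.2 (((Np p f `^ p^-1)^-1)%:C)%C _ _ Mf ML.1.
  by under eq_fun do rewrite addr0.
- rewrite NpZ//; last exact: MH.
  rewrite cmod_real ger0_norm ?invr_ge0 ?ltW// -powRN -powRrM mulNr mulVf ?gt_eqF//.
  by rewrite powR_inv1// mulVf ?gt_eqF.
- move=> w wl; have [j ->] : exists j, w = tnth (in_tuple l) j.
    by move/tnthP: (wl : w \in in_tuple l).
  suff -> : f (tnth (in_tuple l) j) = 0 by rewrite mulr0.
  have := congr1 (fun B : 'M[C]_(1, size l) => B ord0 j) vA; rewrite !mxE => <-.
  by apply: eq_bigr => i _; rewrite mxE.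
Qed.

(** Unit vectors share the Lipschitz constant [K * 2] on the disc, as [1 + Np p f = 2]; it suffices
    to vanish on a net of mesh [e / (K * 2)]. *)
Lemma small_element M p (s e : R) : 1 <= p -> (forall f, M f -> Hp p f) -> lin_closed M ->
  infinite_dim (M : set (Cx R -> Cx R)) -> s < 1 -> 0 < e ->
  exists f, [/\ M f, Np p f = 1 & forall z : C, cmod z <= s -> cmod (f z) <= e].
Proof.
move=> p1 MH ML iM s1 e0.
have [s0|s0] := ltP s 0.
  have [f [Mf Nf _]] := vanishing_element [::] p1 MH ML iM; exists f; split => // z zs.
  by have := le_lt_trans zs s0; rewrite ltNge cmod_ge0.
have [K K0 HK] := Hp_lipschitz p1 s0 s1.
have K2 : 0 < K * 2 by rewrite mulr_gt0.
have [l [l1 l2]] := disc_net s (divr_gt0 e0 K2).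
have [f [Mf Nf f0]] := vanishing_element l p1 MH ML iM; exists f; split => // z zs.
have [w wl zw] := l2 z zs; have [_] := HK f (MH f Mf) z w zs (l1 w wl).
rewrite (f0 w wl) subr0 Nf => h; apply: (le_trans h).
rewrite ler_pdivlMr// mulrC in zw; apply: le_trans zw.
by rewrite le_eqVlt; apply/orP; left; apply/eqP; ring.
Qed.
End SmallOnCompacts.

(** * Sums of functions concentrated on disjoint sets *)

Section GlidingHump.
Context {R : realType}.
Local Notation C := R[i].
Implicit Types (p : R).

(** Peeling off one term at a time with [powRD_le] gives weights independent of [n], at the price of
    geometric growth in [i]. *)
Lemma powR_sum_le p n (x : nat -> R) : 0 < p -> (forall i, 0 <= x i) ->
  (\sum_(i < n) x i) `^ p <= \sum_(i < n) (2 `^ p) ^+ i.+1 * x i `^ p.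
Proof.
move=> p0; elim: n x => [|n IH] x x0; first by rewrite !big_ord0 powR0// gt_eqF.
rewrite !big_ord_recl.
apply: (le_trans (powRD_le (ltW p0) (x0 _) _)); first by rewrite sumr_ge0.
rewrite mulrDr; apply: lerD; first by rewrite expr1.
apply: (@le_trans _ _ (2 `^ p * \sum_(i < n) (2 `^ p) ^+ i.+1 * x i.+1 `^ p)).
  apply: ler_wpM2l; first exact: powR_ge0.
  exact: (IH (fun i => x i.+1)).
rewrite mulr_sumr le_eqVlt; apply/orP; left; apply/eqP/eq_bigr => i _.
by rewrite mulrA -exprS.
Qed.

Lemma powR_cmod_disjoint p n (d : pred 'I_n) (x : 'I_n -> C) : 0 < p ->
  (forall i j, d i -> d j -> i = j) ->
  cmod (\sum_(i < n | d i) x i) `^ p = \sum_(i < n | d i) cmod (x i) `^ p.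
Proof.
move=> p0 dd; case: (pickP d) => [k dk|none].
  have dE : d =1 pred1 k by move=> i; apply/idP/eqP => [di|->//]; exact: dd.
  by rewrite !(big_pred1 k).
by rewrite !big_pred0// cmod0 powR0// gt_eqF.
Qed.

(** Here [d i] stands for membership of a fixed point in the [i]-th set, true for at most one index.
    That term is the main one, and the others are collected in [S2]. *)
Lemma hump_pointwise p n (d : pred nat) (x : nat -> C) : 0 < p ->
  (forall i j, d i -> d j -> i = j) ->
  let G := cmod (\sum_(i < n) x i) `^ p in
  let S1 := \sum_(i < n) (d i)%:R * cmod (x i) `^ p in
  let S2 := \sum_(i < n) (2 `^ p) ^+ i.+1 * ((~~ d i)%:R * cmod (x i) `^ p) in
  G <= 2 `^ p * (S1 + S2) /\ S1 <= 2 `^ p * (G + S2).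
Proof.
move=> p0 dd.
have E1 : cmod (\sum_(i < n | d i) x i) `^ p = \sum_(i < n) (d i)%:R * cmod (x i) `^ p.
  rewrite powR_cmod_disjoint//; last by move=> i j di dj; apply/val_inj/dd.
  rewrite big_mkcond; apply: eq_bigr => i _.
  by case: (d i); rewrite ?mul1r ?mul0r.
have E2 : cmod (\sum_(i < n | ~~ d i) x i) `^ p <=
    \sum_(i < n) (2 `^ p) ^+ i.+1 * ((~~ d i)%:R * cmod (x i) `^ p).
  pose y i := if d i then 0 else cmod (x i).
  have y0 i : 0 <= y i by rewrite /y; case: ifP => // _; exact: cmod_ge0.
  apply: (@le_trans _ _ ((\sum_(i < n) y i) `^ p)).
    apply: ge0_ler_powR; rewrite ?nnegrE ?cmod_ge0 ?sumr_ge0 ?(ltW p0)//.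
    apply: (le_trans (cmod_sum _ _ _)); rewrite big_mkcond le_eqVlt; apply/orP; left.
    by apply/eqP/eq_bigr => i _; rewrite /y; case: (d i).
  apply: (le_trans (powR_sum_le n p0 y0)); apply: ler_sum => i _.
  apply: ler_wpM2l; first by rewrite exprn_ge0// powR_ge0.
  by rewrite /y; case: (d i); rewrite ?mul1r// powR0 ?gt_eqF// mul0r.
have E3 : \sum_(i < n) x i = \sum_(i < n | d i) x i + \sum_(i < n | ~~ d i) x i.
  by rewrite (bigID (fun i : 'I_n => d i)).
split.
  rewrite E3 -E1; set a := \sum_(_ < _ | d _) _; set b := \sum_(_ < _ | ~~ _) _ in E2 *.
  apply: (@le_trans _ _ ((cmod a + cmod b) `^ p)).
    by apply: ge0_ler_powR; rewrite ?nnegrE ?addr_ge0 ?cmod_ge0 ?(ltW p0) ?cmodD.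
  apply: (le_trans (powRD_le (ltW p0) (cmod_ge0 _) (cmod_ge0 _))).
  by apply: ler_wpM2l; rewrite ?powR_ge0// lerD2l.
rewrite -E1; move: E2 E3; set a := \sum_(_ < _ | d _) _; set b := \sum_(_ < _ | ~~ _) _.
set G := \sum_(_ < _) x _ => E2 E3.
apply: (@le_trans _ _ ((cmod G + cmod b) `^ p)).
  apply: ge0_ler_powR; rewrite ?nnegrE ?addr_ge0 ?cmod_ge0 ?(ltW p0)//.
  have -> : a = G - b by rewrite E3 addrK.
  by rewrite -[cmod b]cmodN cmodD.
apply: (le_trans (powRD_le (ltW p0) (cmod_ge0 _) (cmod_ge0 _))).
by apply: ler_wpM2l; rewrite ?powR_ge0// lerD2l.
Qed.

(** The bound [e / (2 ^ p) ^ (k + 1)] cancels the weight of the [k]-th term in [powR_sum_le], so the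
    total error is at most [e * S] for every [n]. *)
Lemma hump_mean p n r (g : nat -> C -> C) (D : nat -> set R) (c : nat -> C) (A B e : R) :
  0 < p -> 0 <= r -> r < 1 -> 0 <= e -> (forall k, disc_holo (g k)) ->
  (forall k, measurable (D k)) -> (forall i j t, D i t -> D j t -> i = j) ->
  (forall k, (k < n)%N -> A <= Jp p (g k) r /\ Jp p (g k) r <= B) ->
  (forall k, (k < n)%N ->
     mean (fun t => \1_(~` D k) t * cmod (g k (polar r t)) `^ p) <= e / (2 `^ p) ^+ k.+1) ->
  let J := Jp p (fun z => \sum_(k < n) c k * g k z) r in
  let S := \sum_(k < n) cmod (c k) `^ p in
  J <= 2 `^ p * ((B + e) * S) /\ (A - e) * S <= 2 `^ p * (J + e * S).
Proof.
move=> p0 r0 r1 e0 gh mD dD AB De J S.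
pose G t := cmod (\sum_(i < n) c i * g i (polar r t)) `^ p.
pose in1 k t := \1_(D k) t * cmod (g k (polar r t)) `^ p.
pose out k t := \1_(~` D k) t * cmod (g k (polar r t)) `^ p.
have bg k : bmeas (fun t => cmod (g k (polar r t)) `^ p) by apply: bmeas_Jp => //; exact: ltW.
have bin k : bmeas (in1 k) by apply: bmeasM => //; exact: bmeas_indic.
have bout k : bmeas (out k) by apply: bmeasM => //; apply/bmeas_indic/measurableC.
have bG : bmeas G.
  apply: (bmeas_Jp (f := fun z => \sum_(i < n) c i * g i z)) => //; last exact: ltW.
  by move=> z z1; apply: holo_sum => i; apply: holoZ; exact: gh.
have JE : J = mean G by [].
pose S1 t := \sum_(i < n) cmod (c i) `^ p * in1 i t.
pose S2 t := \sum_(i < n) ((2 `^ p) ^+ i.+1 * cmod (c i) `^ p) * out i t.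
have bscale (a : R) F : bmeas F -> bmeas (fun t : R => a * F t).
  by move=> bF; exact: (bmeasM (bmeas_cst _ a) bF).
have bS1 : bmeas S1 by apply: bmeas_sum => i; exact: (bscale _ _ (bin i)).
have bS2 : bmeas S2 by apply: bmeas_sum => i; exact: (bscale _ _ (bout i)).
have pw t : G t <= 2 `^ p * (S1 t + S2 t) /\ S1 t <= 2 `^ p * (G t + S2 t).
  have := @hump_pointwise p n (fun i => t \in D i) (fun i => c i * g i (polar r t)) p0.
  have -> : S1 t = \sum_(i < n) (t \in D i)%:R * cmod (c i * g i (polar r t)) `^ p.
    apply: eq_bigr => i _; rewrite /in1 indicE cmodM powRM ?cmod_ge0//.
    by rewrite mulrCA.
  have -> : S2 t = \sum_(i < n) (2 `^ p) ^+ i.+1 *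
      ((t \notin D i)%:R * cmod (c i * g i (polar r t)) `^ p).
    apply: eq_bigr => i _; rewrite /out indicE in_setC cmodM powRM ?cmod_ge0// -mulrA.
    by apply: (congr1 (fun x => _ * x)); rewrite mulrCA.
  by apply => i j; rewrite !inE; exact: dD.
have mS1 : mean S1 = \sum_(i < n) cmod (c i) `^ p * mean (in1 i).
  rewrite mean_sum; last by move=> i; exact: (bscale _ _ (bin i)).
  by apply: eq_bigr => i _; rewrite meanZ.
have mS2 : mean S2 = \sum_(i < n) ((2 `^ p) ^+ i.+1 * cmod (c i) `^ p) * mean (out i).
  rewrite mean_sum; last by move=> i; exact: (bscale _ _ (bout i)).
  by apply: eq_bigr => i _; rewrite meanZ.
have q1 : 1 <= 2 `^ p by rewrite -[leLHS](powRr0 2) ler_powR// ?ler1n// ltW.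
have lS2 : mean S2 <= e * S.
  rewrite mS2 mulr_sumr; apply: ler_sum => i _.
  have q0 : 0 < (2 `^ p) ^+ i.+1 by rewrite exprn_gt0// powR_gt0.
  have := De i (ltn_ord i); rewrite ler_pdivlMr// => h.
  rewrite -mulrA mulrC -mulrA [e * _]mulrC; apply: ler_wpM2l; first exact: powR_ge0.
  exact: h.
have Jsplit k : Jp p (g k) r = mean (in1 k) + mean (out k).
  rewrite -(meanD (bin k) (bout k)); apply: eq_mean => t; rewrite /in1 /out !indicE in_setC.
  by case: (t \in D k); rewrite ?mul1r ?mul0r ?addr0 ?add0r.
have out_e k : (k < n)%N -> mean (out k) <= e.
  move=> kn; apply: (le_trans (De k kn)); rewrite ler_pdivrMr ?exprn_gt0 ?powR_gt0//.
  by rewrite ler_peMr// exprn_ege1.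
have out0 k : 0 <= mean (out k) by apply: mean_ge0 => t; rewrite mulr_ge0 ?powR_ge0// indicE.
have S1B : mean S1 <= B * S.
  rewrite mS1 mulr_sumr; apply: ler_sum => i _; rewrite [B * _]mulrC.
  apply: ler_wpM2l; first exact: powR_ge0.
  have [_] := AB i (ltn_ord i); rewrite Jsplit; apply: le_trans.
  by rewrite lerDl.
have S1A : (A - e) * S <= mean S1.
  rewrite mS1 mulr_sumr; apply: ler_sum => i _; rewrite [(A - e) * _]mulrC.
  apply: ler_wpM2l; first exact: powR_ge0.
  have [+ _] := AB i (ltn_ord i); rewrite Jsplit lerBlDr => h; apply: (le_trans h).
  by rewrite lerD2l; exact: out_e.
have q0 : 0 <= 2 `^ p := powR_ge0 _ _.
have mm (F H : R -> R) : bmeas F -> bmeas H -> mean (fun t => 2 `^ p * (F t + H t)) = 2 `^ p * (mean F + mean H).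
  by move=> bF bH; rewrite meanZ ?meanD//; exact: bmeasD.
have bZ (F H : R -> R) : bmeas F -> bmeas H -> bmeas (fun t => 2 `^ p * (F t + H t)).
  by move=> bF bH; apply: bmeasM; [exact: bmeas_cst|exact: bmeasD].
split; rewrite ?JE.
  apply: (@le_trans _ _ (mean (fun t => 2 `^ p * (S1 t + S2 t)))).
    by apply: (le_mean bG (bZ _ _ bS1 bS2)) => t _; exact: (pw t).1.
  by rewrite mm// mulrDl; apply: ler_wpM2l => //; exact: lerD.
apply: (le_trans S1A); apply: (@le_trans _ _ (mean (fun t => 2 `^ p * (G t + S2 t)))).
  by apply: (le_mean bS1 (bZ _ _ bG bS2)) => t _; exact: (pw t).2.
by rewrite mm//; apply: ler_wpM2l => //; rewrite lerD2l.
Qed.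
End GlidingHump.

(** * Extraction of an almost disjoint sequence *)

Section AlmostDisjointSequence.
Context {R : realType}.
Local Notation C := R[i].
Local Notation mu := (@lebesgue_measure R).
Variables (p : R) (u phi : C -> C) (M : set (C -> C)).
Hypotheses (p1 : 1 <= p) (hu : Hp p u) (hphi : disc_holo phi).
Hypothesis phi1 : forall z : C, cmod z < 1 -> cmod (phi z) < 1.
Hypothesis nc : mu.-negligible (contact_set (phi : Cx R -> Cx R)).
Hypotheses (MH : forall f, M f -> Hp p f) (ML : lin_closed M).
Hypothesis iM : infinite_dim (M : set (Cx R -> Cx R)).
Local Notation W f := (wcomp (u : Cx R -> Cx R) phi f : C -> C).
Variables (b c : R).
Hypotheses (b0 : 0 < b) (c0 : 0 < c).
Hypothesis Wb : forall f, Hp p f -> Hp p (W f) /\ Np p (W f) <= b * Np p f.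
Hypothesis Wc : forall f, M f -> c * Np p f <= Np p (W f).

Let p00 : 0 < p := lt_le_trans ltr01 p1.
Let p0 : 0 <= p := ltW p00.

Lemma radius_seq_ge0 j : 0 <= radius_seq j :> R.
Proof. by have /andP[h _] := @radius_seq_itv R j; rewrite (le_trans _ h)// divr_ge0. Qed.

Lemma radius_seq_lt1 j : radius_seq j < 1 :> R.
Proof. by have /andP[_ h] := @radius_seq_itv R j. Qed.

Lemma hump_choice i (e : R) : 0 < e -> exists f i', [/\ M f, Np p f = 1, (i < i')%N,
  (forall j, (i <= j)%N -> mean (fun t => \1_(~` limsup_sets phi i) t *
      cmod (W f (polar (radius_seq j) t)) `^ p) <= e) &
  (forall r, 0 <= r -> r < 1 -> mean (fun t => \1_(limsup_sets phi i') t *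
      cmod (W f (polar r t)) `^ p) <= e)].
Proof.
move=> e0; have Nu0 := Np_ge0 p0 hu.
have Nu1 : 0 < Np p u + 1 by rewrite ltr_wpDl.
(* With [cmod f] at most this root where [phi] takes its values, the [p]-th power of the image is at
   most [e / (Np p u + 1)] times that of [u]; the [+ 1] avoids dividing by zero. *)
have q0 : 0 < (e / (Np p u + 1)) `^ p^-1 by rewrite powR_gt0// divr_gt0.
have qE : ((e / (Np p u + 1)) `^ p^-1) `^ p = e / (Np p u + 1).
  by rewrite -powRrM mulVf ?gt_eqF// powRr1// divr_ge0// ltW.
have s1 : 1 - (i.+1%:R)^-1 < 1 :> R by rewrite gtrBl invr_gt0 ltr0n.
have [f [Mf Nf small]] := small_element p1 MH ML iM s1 q0.
have [hg _] := Wb (MH Mf).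
have [d d0 Hd] := Hp_unif_integrable p1 hg e0.
have [N HN] := limsup_sets_small hphi phi1 nc d0.
(* The threshold [N] makes the new set small enough for uniform integrability; [i.+1] makes the
   indices strictly increasing. *)
exists f, (maxn N i.+1); split => //; first by rewrite leq_max ltnSn orbT.
- move=> j ij; have rj0 := radius_seq_ge0 j; have rj1 := radius_seq_lt1 j.
  have mB := measurable_limsup_sets hphi i.
  have bl : bmeas (fun t => \1_(~` limsup_sets phi i) t * cmod (W f (polar (radius_seq j) t)) `^ p).
    apply: bmeasM; first by apply/bmeas_indic/measurableC.
    exact: (bmeas_Jp hg.1 p0 rj0 rj1).
  have bu := bmeas_Jp hu.1 p0 rj0 rj1.
  apply: (@le_trans _ _ (mean (fun t => e / (Np p u + 1) * cmod (u (polar (radius_seq j) t)) `^ p))).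
    apply: (le_mean bl (bmeasM (bmeas_cst _ _) bu)) => t _.
    rewrite indicE in_setC; have [tB|/negP tB] := boolP (t \in limsup_sets phi i).
      by rewrite mul0r mulr_ge0 ?powR_ge0// divr_ge0// ltW.
    rewrite mul1r -qE -powRM ?cmod_ge0// ?(ltW q0)//.
    apply: ge0_ler_powR; rewrite ?nnegrE ?mulr_ge0 ?cmod_ge0 ?(ltW q0)//.
    rewrite /wcomp cmodM mulrC; apply: ler_wpM2r; first exact: cmod_ge0.
    by apply/small/limsup_sets_out => // tB'; apply/tB/mem_set.
  rewrite (meanZ _ bu) mulrAC ler_pdivrMr//; apply: ler_wpM2l; first exact: ltW.
  apply: (le_trans (Jp_le_Np p0 hu rj0 rj1)).
  by rewrite lerDl.
- apply: Hd; first exact: measurable_limsup_sets.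
  by apply: HN; exact: leq_maxl.
Qed.

Let Q : R := 2 `^ p.
(** Since [Q * eta = c / 4] and [eta <= c / 4], the three losses in the lower bound of [hump_mean]
    leave at least [c / 4]. *)
Let eta : R := c / (4 * Q).

Let Q1 : 1 <= Q.
Proof. by rewrite -[leLHS](powRr0 2) ler_powR// ?ler1n// ltW. Qed.

Let Q0 : 0 < Q := lt_le_trans ltr01 Q1.

Let eta0 : 0 < eta.
Proof. by rewrite divr_gt0// mulr_gt0. Qed.

Let Qeta : Q * eta = c / 4.
Proof. by rewrite /eta invfM mulrCA [Q * _]mulrC divfK// gt_eqF. Qed.

Lemma hump_sequence : exists f : nat -> C -> C, exists iseq : nat -> nat,
  [/\ (forall k, M (f k)), (forall k, Np p (f k) = 1),
   (forall k, iseq k < iseq k.+1)%N,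
   (forall k j, (iseq k <= j)%N -> mean (fun t => \1_(~` limsup_sets phi (iseq k)) t *
      cmod (W (f k) (polar (radius_seq j) t)) `^ p) <= eta / 2 / Q ^+ k.+1) &
   (forall k r, 0 <= r -> r < 1 -> mean (fun t => \1_(limsup_sets phi (iseq k.+1)) t *
      cmod (W (f k) (polar r t)) `^ p) <= eta / 2 / Q ^+ k.+1)].
Proof.
have e0 k : 0 < eta / 2 / Q ^+ k.+1 by rewrite divr_gt0 ?exprn_gt0// divr_gt0.
(* Choosing for every pair of a stage and an index, rather than along the sequence, lets a plain
   fixpoint define the indices. *)
have /choice[F HF] : forall ki : nat * nat, exists fi : (C -> C) * nat,
  [/\ M fi.1, Np p fi.1 = 1, (ki.2 < fi.2)%N,
  (forall j, (ki.2 <= j)%N -> mean (fun t => \1_(~` limsup_sets phi ki.2) t *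
      cmod (W fi.1 (polar (radius_seq j) t)) `^ p) <= eta / 2 / Q ^+ ki.1.+1) &
  (forall r, 0 <= r -> r < 1 -> mean (fun t => \1_(limsup_sets phi fi.2) t *
      cmod (W fi.1 (polar r t)) `^ p) <= eta / 2 / Q ^+ ki.1.+1)].
  by move=> [k i]; have [f [i' H]] := hump_choice i (e0 k); exists (f, i').
pose iseq := fix iseq k := if k is k'.+1 then (F (k', iseq k')).2 else 0%N.
exists (fun k => (F (k, iseq k)).1), iseq; split => k.
- by have [] := HF (k, iseq k).
- by have [] := HF (k, iseq k).
- by have [] := HF (k, iseq k).
- by have [] := HF (k, iseq k).
- by have [] := HF (k, iseq k).
Qed.

(** The first [n] images are compared on one circle, close enough to the boundary for all of them;
    the constants depend neither on the circle nor on [n]. The bounds for the operator then carry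
    the estimate from the images back to the [f k]. *)
Theorem almost_disjoint_sequence : exists f : nat -> C -> C, (forall k, M (f k)) /\
  exists2 a, 0 < a & exists2 a', 0 < a' & forall n (x : nat -> C),
  let S := \sum_(k < n) cmod (x k) `^ p in let F z := \sum_(k < n) x k * f k z in
  a * S <= Np p F /\ Np p F <= a' * S.
Proof.
have [f [iseq [Mf Nf incr off on]]] := hump_sequence.
exists f; split => //.
pose D k := limsup_sets phi (iseq k) `\` limsup_sets phi (iseq k.+1).
have mB i := measurable_limsup_sets hphi i.
have mD k : measurable (D k) by exact: measurableD.
have mono i j : (i <= j)%N -> (iseq i <= iseq j)%N.
  by apply: (@homo_leq _ iseq leq) => //; [exact: leq_trans|move=> k; exact/ltnW].
have dlt i j t : D i t -> D j t -> ~ (i < j)%N.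
  move=> [_ ti] [tj _] ij; apply: ti; apply: limsup_sets_decreasing tj.
  exact: mono.
have dD i j t : D i t -> D j t -> i = j.
  by move=> di dj; have [/(dlt _ _ t di dj)|/(dlt _ _ t dj di)|] := ltngtP i j.
pose g k : C -> C := W (f k).
have hg k : Hp p (g k) := (Wb (MH (Mf k))).1.
have Nb k : Np p (g k) <= b by have [_] := Wb (MH (Mf k)); rewrite Nf mulr1.
have Nc k : c <= Np p (g k) by have := Wc (Mf k); rewrite Nf mulr1.
(* Off [D k] a point is outside the [k]-th exceptional set or inside the next one, and each case
   carries half of the allowed mass. *)
have off_D k j : (iseq k <= j)%N ->
  mean (fun t => \1_(~` D k) t * cmod (g k (polar (radius_seq j) t)) `^ p) <= eta / Q ^+ k.+1.
  move=> kj; have rj0 := radius_seq_ge0 j; have rj1 := radius_seq_lt1 j.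
  have bg := bmeas_Jp (hg k).1 p0 rj0 rj1.
  have b1 : bmeas (fun t => \1_(~` limsup_sets phi (iseq k)) t * cmod (g k (polar (radius_seq j) t)) `^ p).
    by apply: (bmeasM _ bg); exact/bmeas_indic/measurableC.
  have b2 : bmeas (fun t => \1_(limsup_sets phi (iseq k.+1)) t * cmod (g k (polar (radius_seq j) t)) `^ p).
    by apply: (bmeasM _ bg); exact/bmeas_indic.
  have b3 : bmeas (fun t => \1_(~` D k) t * cmod (g k (polar (radius_seq j) t)) `^ p).
    by apply: (bmeasM _ bg); exact/bmeas_indic/measurableC.
  apply: (le_trans (le_mean b3 (bmeasD b1 b2) _)).
    move=> t _; rewrite -mulrDl; apply: ler_wpM2r; first exact: powR_ge0.
    rewrite !indicE !in_setC in_setD.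
    by case: (t \in _); case: (t \in _) => /=; rewrite ?addr0 ?add0r// lerDl.
  rewrite (meanD b1 b2) [eta]splitr mulrDl.
  by apply: lerD; [exact: off|exact: on].
have low k : exists N, forall j, (N <= j)%N -> c - eta <= Jp p (g k) (radius_seq j).
  have [s [s0 s1 Hs]] := Np_approx p1 (hg k) eta0.
  have [N HN] := radius_seq_cvg s1; exists N => j Nj.
  have := Hs (radius_seq j) (ltW (HN j Nj)) (radius_seq_lt1 j).
  by apply: le_trans; rewrite lerD2r.
have [Nlow Hlow] := choice low.
have key n (x : nat -> C) : exists N, forall j, (N <= j)%N ->
  let S := \sum_(k < n) cmod (x k) `^ p in
  let J := Jp p (fun z => \sum_(k < n) x k * g k z) (radius_seq j) in
  J <= Q * ((b + eta) * S) /\ c / (4 * Q) * S <= J.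
  exists (\max_(k < n) maxn (Nlow k) (iseq k)) => j Nj.
  have jk k : (k < n)%N -> (Nlow k <= j)%N /\ (iseq k <= j)%N.
    move=> kn; have := leq_trans (leq_bigmax (Ordinal kn)) Nj.
    by rewrite geq_max => /andP.
  have := @hump_mean R p n (radius_seq j) g D x (c - eta) b eta p00 (radius_seq_ge0 j)
    (radius_seq_lt1 j) (ltW eta0) (fun k => (hg k).1) mD dD.
  move=> /(_ (fun k kn => conj (Hlow k j (jk k kn).1)
    (le_trans (Jp_le_Np p0 (hg k) (radius_seq_ge0 j) (radius_seq_lt1 j)) (Nb k)))).
  move=> /(_ (fun k kn => off_D k j (jk k kn).2)) /=.
  set S := \sum_(k < n) _; set J := Jp _ _ _ => -[h1 h2]; split => //.
  have S0 : 0 <= S by apply: sumr_ge0 => i _; exact: powR_ge0.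
  rewrite -/eta; move: h2; rewrite -/Q mulrDr mulrA Qeta => h2.
  have h3 : eta <= c / 4 by rewrite -Qeta ler_peMl// ltW.
  have h4 : (c - eta - eta - c / 4) * S <= Q * J by move: h2; rewrite !mulrBl; move: (_ * S) (_ * J) => *; lra.
  have h5 : c / 4 * S <= Q * J by apply: le_trans h4; apply: ler_wpM2r => //; lra.
  by rewrite -(ler_pM2l Q0) mulrA Qeta.
exists (c / (4 * Q) / b); first by rewrite !divr_gt0// mulr_gt0.
have bc0 : 0 < Q * (b + eta) / c by rewrite divr_gt0// mulr_gt0// addr_gt0.
exists (Q * (b + eta) / c) => // n x S F.
have MF : M F by exact: lin_closed_sum.
have [hWF WF] := Wb (MH MF); have WcF := Wc MF.
have WE : W F = (fun z => \sum_(k < n) x k * g k z).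
  by apply/funext => z; rewrite /wcomp /F mulr_sumr; apply: eq_bigr => k _; rewrite mulrCA.
have [N HN] := key n x; rewrite -WE in HN; split.
  rewrite mulrAC ler_pdivrMr// [_ * b]mulrC; apply: le_trans WF.
  apply: (le_trans (HN N (leqnn _)).2).
  exact: (Jp_le_Np p0 hWF (radius_seq_ge0 _) (radius_seq_lt1 _)).
rewrite mulrAC ler_pdivlMr// [_ * c]mulrC; apply: (le_trans WcF).
apply/ler_addgt0Pr => e e0; have [s [s0 s1 Hs]] := Np_approx p1 hWF e0.
have [N' HN'] := radius_seq_cvg s1.
have := Hs (radius_seq (maxn N N')) (ltW (HN' _ (leq_maxr _ _))) (radius_seq_lt1 _).
rewrite lerBlDr => h; apply: (le_trans h); rewrite lerD2r -mulrA.
exact: (HN (maxn N N') (leq_maxl _ _)).1.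
Qed.
End AlmostDisjointSequence.

(** * Weierstrass' theorem on locally uniform limits *)

Section LocallyUniformLimits.
Context {R : realType}.
Local Notation C := R[i].

Section cauchy_integral.
Variables (F : C -> C) (s r : R).
Hypotheses (s0 : 0 <= s) (sr : s < r).
Hypothesis cF : forall w : C, cmod w = r -> ccont F w.
Hypothesis cauchyF : forall w : C, cmod w <= s ->
  F w = cmean (fun t => F (polar r t) * ((polar r t : C) / ((polar r t : C) - w))).

(** Differentiation of the Cauchy integral by an explicit remainder: the second-order error of the
    kernel is [x (w - z)^2 / ((x - w) (x - z)^2)], bounded on the circle by [r / (r - s)^3] times
    the square of the increment. *)
Lemma cauchy_integral_holo (z : C) : cmod z < s -> holo F z.
Proof.
move=> zs; have r0 := le_lt_trans s0 sr.
have cr t : cmod (polar r t : C) = r by rewrite cmod_polar gtr0_norm.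
have bF : bmC (fun t => F (polar r t)) by exact: polar_circle_bmC (ltW r0) _.
have neqw (w x : C) : cmod w <= s -> cmod x = r -> x - w != 0.
  move=> ws xr; rewrite subr_eq0; apply: contraTneq ws => <-.
  by rewrite xr -ltNge.
have den (w x : C) : cmod w <= s -> cmod x = r -> r - s <= cmod (x - w).
  by move=> ws xr; rewrite (le_trans _ (cmod_sub_ge _ _))// xr lerD2l lerN2.
have rs0 : 0 < r - s by rewrite subr_gt0.
have cinv (w x : C) : cmod w <= s -> cmod x = r -> ccont (fun y => (y - w)^-1) x.
  move=> ws xr; apply: ccontV; last exact: neqw.
  by apply: ccontD; [exact: ccont_id|exact: ccont_cst].
have bk (w : C) : cmod w <= s -> bmC (fun t => (polar r t : C) / ((polar r t : C) - w)).
  move=> ws; apply: (@polar_circle_bmC _ (fun x => x / (x - w)) r (ltW r0)) => x xr.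
  by apply: ccontM; [exact: ccont_id|exact: cinv].
have bk2 : bmC (fun t => (polar r t : C) / ((polar r t : C) - z) / ((polar r t : C) - z)).
  apply: (@polar_circle_bmC _ (fun x => x / (x - z) / (x - z)) r (ltW r0)) => x xr.
  by apply: ccontM; [apply: ccontM; [exact: ccont_id|]|]; apply: cinv => //; exact: ltW.
pose L := r / (r - s) ^+ 3 * mean (fun t => cmod (F (polar r t))).
have L0 : 0 <= L.
  rewrite /L mulr_ge0 ?divr_ge0 ?exprn_ge0 ?(ltW r0) ?(ltW rs0)//.
  by apply: mean_ge0 => t; exact: cmod_ge0.
pose d := cmean (fun t => F (polar r t) *
  ((polar r t : C) / ((polar r t : C) - z) / ((polar r t : C) - z))).
have main (w : C) : cmod w <= s -> cmod (F w - F z - d * (w - z)) <= L * cmod (w - z) ^+ 2.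
  move=> ws; rewrite (cauchyF ws) (cauchyF (ltW zs)) [d * _]mulrC.
  have bFk (x : C) : cmod x <= s -> _ := fun xs => bmC_M bF (bk x xs).
  rewrite -(cmeanB (bFk _ ws) (bFk _ (ltW zs))) -(cmeanZ _ (bmC_M bF bk2)).
  have bw := bk w ws; have bz := bk z (ltW zs); have bzz := bmC_Z (w - z) bk2.
  rewrite -cmeanB; [|by apply: bmC_B; exact: bmC_M|by apply: bmC_Z; exact: bmC_M].
  rewrite (@eq_cmean _ _ (fun t => F (polar r t) * ((polar r t : C) / ((polar r t : C) - w) -
      (polar r t : C) / ((polar r t : C) - z) -
      (w - z) * ((polar r t : C) / ((polar r t : C) - z) / ((polar r t : C) - z))))); last first.
    by move=> t; rewrite [(w - z) * (F _ * _)]mulrCA -!mulrBr.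
  rewrite /L mulrAC; apply: (mean_mul_cmod_le bF (bmC_B (bmC_B bw bz) bzz)).
  move=> t; have ct := cr t; move: (polar r t : C) ct => x xr.
  have n1 := neqw w x ws xr; have n2 := neqw z x (ltW zs) xr.
  have -> : x / (x - w) - x / (x - z) - (w - z) * (x / (x - z) / (x - z)) =
      x * (w - z) ^+ 2 / ((x - w) * (x - z) ^+ 2) by field; rewrite n1 n2.
  rewrite !cmodM cmodV cmodM !cmodX xr mulrAC; apply: ler_wpM2r; first exact: sqr_ge0.
  apply: ler_wpM2l; first exact: ltW.
  have d1 := den w x ws xr; have d2 := den z x (ltW zs) xr.
  rewrite lef_pV2 ?posrE ?exprn_gt0// ?mulr_gt0 ?exprn_gt0 ?(lt_le_trans rs0)//.
  rewrite exprS; apply: ler_pM; rewrite ?exprn_ge0 ?(ltW rs0)//.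
  by apply: lerXn2r => //; rewrite nnegrE ?cmod_ge0// ltW.
exists d => e e0; have L1 : 0 < L + 1 by rewrite ltr_wpDl.
exists (Order.min (s - cmod z) (e / (L + 1))).
  by rewrite lt_min subr_gt0 zs divr_gt0.
move=> w; rewrite lt_min ltr_pdivlMr// => /andP[w1 w2].
have ws : cmod w <= s.
  have := cmodD (w - z) z; rewrite subrK => h; apply: (le_trans h).
  by rewrite -lerBrDr ltW.
apply: (le_trans (main w ws)); rewrite expr2 mulrA; apply: ler_wpM2r; first exact: cmod_ge0.
apply: le_trans (ltW w2); rewrite mulrC; apply: ler_wpM2l; first exact: cmod_ge0.
by rewrite lerDl.
Qed.
End cauchy_integral.

(** The limit is continuous and inherits Cauchy's formula from the approximants, which makes it
    holomorphic. *)
Lemma locally_uniform_limit_holo (F : C -> C) :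
  (forall s e : R, s < 1 -> 0 < e -> exists2 f, disc_holo f &
     forall z : C, cmod z <= s -> cmod (f z - F z) <= e) ->
  disc_holo F.
Proof.
move=> H.
have cF (z : C) : cmod z < 1 -> ccont F z.
  move=> z1 e e0; have e3 : 0 < e / 3 by rewrite divr_gt0.
  have [|f hf Hf] := H ((1 + cmod z) / 2) (e / 3) _ e3; first lra.
  have [r r0 Hr] := holo_ccont (hf z z1) e3.
  exists (Order.min r ((1 - cmod z) / 2)); first by rewrite lt_min r0/=; lra.
  move=> w; rewrite lt_min => /andP[wr wz].
  have h1 := Hf z ltac:(lra); have h2 := Hr w wr.
  have h3 : cmod (f w - F w) <= e / 3.
    apply: Hf; have := cmodD (w - z) z; rewrite subrK; lra.
  have := cmod_distD (f w) (F w) (F z); have := cmod_distD (f z) (f w) (F z).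
  rewrite [cmod (F w - f w)]cmodB; lra.
move=> z z1.
have [s [r [zs sr r1]]] : exists s r, [/\ cmod z < s, s < r & r < 1].
  by exists ((2 * cmod z + 1) / 3), ((cmod z + 2) / 3); split; lra.
have s0 : 0 <= s := le_trans (cmod_ge0 _) (ltW zs); have r0 := le_lt_trans s0 sr.
apply: (@cauchy_integral_holo F s r) => //; first by move=> w wr; apply: cF; rewrite wr.
move=> w ws; apply/eqP; rewrite -subr_eq0 -cmod_eq0; apply/eqP.
have rs0 : 0 < r - s by rewrite subr_gt0.
pose K := r / (r - s).
have K0 : 0 <= K by rewrite divr_ge0 ?ltW.
apply/le_anti; rewrite cmod_ge0 andbT; apply/ler_addgt0Pl => e e0; rewrite addr0.
have K1 : 0 < 1 + K by rewrite ltr_pwDl.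
(* The error counts once at [w] and [K] times under the integral, [K] being the bound of the Cauchy
   kernel. *)
have [f hf Hf] := H r (e / (1 + K)) r1 (divr_gt0 e0 K1).
have cr t : cmod (polar r t : C) = r by rewrite cmod_polar gtr0_norm.
have bF : bmC (fun t => F (polar r t)).
  by apply: polar_circle_bmC (ltW r0) _ => x xr; apply: cF; rewrite xr.
have bf := bmC_circle hf (ltW r0) r1.
have bk := bmC_cauchy_kernel s0 sr ws.
rewrite (le_trans (cmod_distD (f w) _ _))//.
have h1 : cmod (F w - f w) <= e / (1 + K) by rewrite cmodB; apply/Hf/(le_trans ws)/ltW.
have h2 : cmod (f w - cmean (fun t => F (polar r t) * ((polar r t : C) / ((polar r t : C) - w)))) <=
    K * (e / (1 + K)).
  rewrite (cauchy_formula (le_lt_trans ws sr) r1 hf) -(cmeanB (bmC_M bf bk) (bmC_M bF bk)).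
  apply: cmod_cmean_le; first by apply: bmC_B; exact: bmC_M.
  move=> t; rewrite -mulrBl cmodM mulrC; apply: ler_pM; rewrite ?cmod_ge0//; last first.
    by apply: Hf; rewrite cr.
  rewrite cmodM cmodV cr; apply: ler_wpM2l; first exact: ltW.
  have h : r - s <= cmod ((polar r t : C) - w).
    by rewrite (le_trans _ (cmod_sub_ge _ _))// cr lerD2l lerN2.
  by rewrite lef_pV2 ?posrE ?(lt_le_trans rs0 h).
apply: (le_trans (lerD h1 h2)).
by rewrite -{1}[e / _]mul1r -mulrDl mulrC divfK// gt_eqF.
Qed.
End LocallyUniformLimits.

(** * Sequence spaces through [q]-th powers of norms *)

Section LqSpaces.
Context {R : realType}.
Local Notation C := R[i].
Implicit Types (q : R) (x y : nat -> C).

Definition lq_sum q x : R := fine (\sum_(k <oo) ((cmod (x k)) `^ q)%:E)%E.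

Lemma lq_normE q x : lq_norm q (x : nat -> Cx R) = lq_sum q x `^ q^-1.
Proof. by []. Qed.

Lemma lq_partial_EFin q x n :
  (\sum_(0 <= k < n) ((cmod (x k)) `^ q)%:E)%E = (\sum_(k < n) cmod (x k) `^ q)%:E.
Proof. by rewrite sumEFin big_mkord. Qed.

Lemma lq_series_le q x K : (forall n, \sum_(k < n) cmod (x k) `^ q <= K) ->
  (\sum_(k <oo) ((cmod (x k)) `^ q)%:E <= K%:E)%E.
Proof.
move=> H; apply: lime_le; first by apply: is_cvg_nneseries => k _ _; rewrite lee_fin powR_ge0.
by apply: nearW => n; rewrite lq_partial_EFin lee_fin.
Qed.

Lemma lq_series_ge q x n :
  ((\sum_(k < n) cmod (x k) `^ q)%:E <= \sum_(k <oo) ((cmod (x k)) `^ q)%:E)%E.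
Proof.
by rewrite -lq_partial_EFin; apply: nneseries_lim_ge => k _ _; rewrite lee_fin powR_ge0.
Qed.

Lemma lq_sum_EFin q x : in_lq q (x : nat -> Cx R) ->
  (\sum_(k <oo) ((cmod (x k)) `^ q)%:E)%E = (lq_sum q x)%:E.
Proof.
move=> [K HK]; rewrite /lq_sum fineK// ge0_fin_numE.
  exact: le_lt_trans (lq_series_le HK) (ltry _).
by apply: nneseries_ge0 => k _ _; rewrite lee_fin powR_ge0.
Qed.

Lemma lq_sum_ge q x n : in_lq q (x : nat -> Cx R) -> \sum_(k < n) cmod (x k) `^ q <= lq_sum q x.
Proof. by move=> hx; rewrite -lee_fin -(lq_sum_EFin hx) lq_series_ge. Qed.

Lemma lq_sum_le q x K : (forall n, \sum_(k < n) cmod (x k) `^ q <= K) -> lq_sum q x <= K.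
Proof.
move=> H; have hx : in_lq q (x : nat -> Cx R) by exists K.
by rewrite -lee_fin -(lq_sum_EFin hx); exact: lq_series_le.
Qed.

Lemma lq_sum_ge0 q x : 0 <= lq_sum q x.
Proof. by apply: fine_ge0; apply: nneseries_ge0 => k _ _; rewrite lee_fin powR_ge0. Qed.

Lemma lq_partial_mono q x m n : (m <= n)%N ->
  \sum_(k < m) cmod (x k) `^ q <= \sum_(k < n) cmod (x k) `^ q.
Proof.
move=> mn; rewrite -(subnKC mn) big_split_ord/= lerDl sumr_ge0// => k _.
exact: powR_ge0.
Qed.

Lemma lq_sum_approx q x e : in_lq q (x : nat -> Cx R) -> 0 < e -> exists N, forall n, (N <= n)%N ->
  lq_sum q x - e <= \sum_(k < n) cmod (x k) `^ q.
Proof.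
move=> hx e0; apply: contrapT => H.
suff : lq_sum q x <= lq_sum q x - e by rewrite lerDl oppr_ge0 leNgt e0.
apply: lq_sum_le => n; rewrite leNgt; apply/negP => h; apply: H; exists n => m nm.
exact: le_trans (ltW h) (lq_partial_mono q x nm).
Qed.

Lemma lq_coord0 q x k : in_lq q (x : nat -> Cx R) -> lq_sum q x = 0 -> x k = 0.
Proof.
move=> hx x0; have := lq_sum_ge k.+1 hx; rewrite x0 => h.
apply/eqP; rewrite -cmod_eq0; apply/eqP/(@powR_eq0_eq0 _ _ q).
apply/le_anti; rewrite powR_ge0 andbT; apply: le_trans h.
by rewrite big_ord_recr/= lerDr sumr_ge0// => i _; exact: powR_ge0.
Qed.

Lemma in_lqD q (a : C) x y : 0 <= q -> in_lq q (x : nat -> Cx R) -> in_lq q (y : nat -> Cx R) ->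
  in_lq q (fun k => a * x k + y k : Cx R).
Proof.
move=> q0 [K HK] [L HL]; exists (2 `^ q * (cmod a `^ q * K + L)) => n.
apply: (@le_trans _ _ (\sum_(k < n) 2 `^ q * (cmod a `^ q * cmod (x k) `^ q + cmod (y k) `^ q))).
  apply: ler_sum => k _.
  apply: (@le_trans _ _ ((cmod a * cmod (x k) + cmod (y k)) `^ q)).
    apply: ge0_ler_powR; rewrite ?nnegrE ?addr_ge0 ?mulr_ge0 ?cmod_ge0//.
    by rewrite -cmodM; exact: cmodD.
  rewrite -powRM ?cmod_ge0//; apply: powRD_le => //; rewrite ?mulr_ge0 ?cmod_ge0//.
rewrite -mulr_sumr big_split/= -mulr_sumr; apply: ler_wpM2l; first exact: powR_ge0.
by apply: lerD; [apply: ler_wpM2l; [exact: powR_ge0|exact: HK]|exact: HL].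
Qed.

Lemma in_lq0 q : 0 < q -> in_lq q (fun=> 0 : Cx R).
Proof.
move=> q0; exists 0 => n; rewrite big1// => k _.
by rewrite cmod0 powR0// gt_eqF.
Qed.

Lemma in_lq_delta q (i : nat) : 0 < q -> in_lq q (fun k => (k == i)%:R : Cx R).
Proof.
move=> q0; exists 1 => n.
have z k : k != i -> cmod (((k == i)%:R : C)) `^ q = 0.
  by move=> /negbTE ->; rewrite cmod0 powR0// gt_eqF.
have [ni|ni] := leqP n i.
  by rewrite big1// => k _; apply: z; rewrite neq_ltn (leq_trans (ltn_ord k) ni).
rewrite (bigD1 (Ordinal ni))//= eqxx cmod1 powR1 big1 ?addr0// => k ki.
exact: z.
Qed.
End LqSpaces.

(** * Infinite combinations and the embedding of [l^p] *)

Section Embedding.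
Context {R : realType}.
Local Notation C := R[i].

Lemma Jp_perturb (p : R) (f F : C -> C) (r d : R) : 0 <= p -> disc_holo f -> disc_holo F ->
  0 <= r -> r < 1 -> (forall z : C, cmod z <= r -> cmod (f z - F z) <= d) ->
  Jp p F r <= 2 `^ p * (Jp p f r + d `^ p).
Proof.
move=> p0 hf hF r0 r1 H; have bf := bmeas_Jp hf p0 r0 r1; have bF := bmeas_Jp hF p0 r0 r1.
have bc : bmeas (fun _ : R => d `^ p) by exact: bmeas_cst.
apply: (@le_trans _ _ (mean (fun t => 2 `^ p * (cmod (f (polar r t)) `^ p + d `^ p)))).
  apply: (le_mean bF (bmeasM (bmeas_cst _ _) (bmeasD bf bc))) => t _.
  have h : cmod (f (polar r t) - F (polar r t)) <= d by apply: H; rewrite cmod_polar ger0_norm.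
  have d0 : 0 <= d by rewrite (le_trans _ h)// cmod_ge0.
  apply: (@le_trans _ _ ((cmod (f (polar r t)) + d) `^ p)); last first.
    by apply: powRD_le => //; exact: cmod_ge0.
  apply: ge0_ler_powR; rewrite ?nnegrE ?addr_ge0 ?cmod_ge0//.
  by have := cmod_sub_ge (F (polar r t)) (f (polar r t)); rewrite cmodB; move: h; lra.
rewrite (meanZ _ (bmeasD bf bc)) (meanD bf bc) (mean_cst (R := R)).
exact: lexx.
Qed.

Lemma HpB (p : R) (f g : C -> C) : 0 <= p -> Hp p f -> Hp p g -> Hp p (fun z => f z - g z).
Proof.
move=> p0 hf hg; apply: (eq_Hp _ (HpD p0 hf (HpZ (-1) p0 hg))) => z _.
by rewrite mulN1r.
Qed.

Variables (p : R) (f : nat -> C -> C) (a b : R).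
Hypotheses (p1 : 1 <= p) (hf : forall k, Hp p (f k)) (a0 : 0 < a) (b0 : 0 < b).
Hypothesis fab : forall n (x : nat -> C),
  let S := \sum_(k < n) cmod (x k) `^ p in let F z := \sum_(k < n) x k * f k z in
  a * S <= Np p F /\ Np p F <= b * S.

Let p00 : 0 < p := lt_le_trans ltr01 p1.
Let p0 : 0 <= p := ltW p00.

Definition partial_comb (x : nat -> C) n (z : C) : C := \sum_(k < n) x k * f k z.

(** [xget] selects the pointwise limit and falls back on 0 where there is none; [series_comb_lim]
    shows that for [x] in [l^p] the limit exists throughout the disc. *)
Definition series_comb (x : nat -> C) (z : C) : C := xget 0 [set l : C |
  forall e : R, 0 < e -> exists N, forall n, (N <= n)%N -> cmod (partial_comb x n z - l) <= e].

Lemma Hp_partial_comb x n : Hp p (partial_comb x n).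
Proof.
elim: n => [|n IH].
  by apply: (eq_Hp _ (Hp_cst 0 p0)) => z _; rewrite /partial_comb big_ord0.
apply: (eq_Hp _ (HpD p0 IH (HpZ (x n) p0 (hf n)))) => z _.
by rewrite /partial_comb big_ord_recr.
Qed.

(** Zeroing the first [m] coefficients makes the difference a finite combination again, so the
    hypothesis [fab] controls it. *)
Lemma partial_combB x m n z : (m <= n)%N ->
  partial_comb x n z - partial_comb x m z = partial_comb (fun k => if (k < m)%N then 0 else x k) n z.
Proof.
move=> mn; rewrite /partial_comb -(subnKC mn) !big_split_ord/= addrAC subrr add0r.
rewrite [X in _ = X + _]big1 ?add0r; last by move=> i _; rewrite ltn_ord mul0r.
by apply: eq_bigr => i _; rewrite ltnNge leq_addr.
Qed.

Lemma Hp_partial_combB x m n : Hp p (fun z => partial_comb x n z - partial_comb x m z).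
Proof. exact: HpB (Hp_partial_comb x n) (Hp_partial_comb x m). Qed.

Lemma Np_partial_combB x m n : (m <= n)%N ->
  Np p (fun z => partial_comb x n z - partial_comb x m z) <=
  b * (\sum_(k < n) cmod (x k) `^ p - \sum_(k < m) cmod (x k) `^ p).
Proof.
move=> mn; rewrite (@eq_Np _ p _ (partial_comb (fun k => if (k < m)%N then 0 else x k) n)); last first.
  by move=> z _; exact: partial_combB.
have [_ h] := fab n (fun k => if (k < m)%N then 0 else x k).
apply: (le_trans h); apply: ler_wpM2l; first exact: ltW.
rewrite -(subnKC mn) !big_split_ord/= addrAC subrr add0r big1 ?add0r; last first.
  by move=> i _; rewrite ltn_ord cmod0 powR0// gt_eqF.
by apply: ler_sum => i _; rewrite ltnNge leq_addr.
Qed.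

Lemma partial_comb_cauchy x (s d : R) : in_lq p (x : nat -> Cx R) -> s < 1 -> 0 < d ->
  exists N, forall m n, (N <= m)%N -> (N <= n)%N -> forall z : C, cmod z <= s ->
    cmod (partial_comb x m z - partial_comb x n z) <= d.
Proof.
move=> hx s1 d0; have [s0|s0] := ltP s 0.
  by exists 0%N => m n _ _ z zs; have := le_lt_trans zs s0; rewrite ltNge cmod_ge0.
have [K K0 HK] := Hp_eval p1 s0 s1.
(* [K * b] is the factor by which a tail of coefficients bounds the [p]-th power of the difference
   at a point of the disc. *)
have e0 : 0 < d `^ p / (K * b) by rewrite divr_gt0 ?powR_gt0// mulr_gt0.
have [N HN] := lq_sum_approx hx e0; exists N.
suff H m n : (N <= m)%N -> (m <= n)%N -> forall z : C, cmod z <= s ->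
    cmod (partial_comb x n z - partial_comb x m z) <= d.
  move=> m n Nm Nn z zs; have [mn|/ltnW nm] := leqP m n.
    by rewrite cmodB; exact: H.
  exact: H.
move=> Nm mn z zs; have h := HK _ (Hp_partial_combB x m n) z zs.
rewrite leNgt; apply/negP => dlt.
have : d `^ p < cmod (partial_comb x n z - partial_comb x m z) `^ p.
  by apply: gt0_ltr_powR; rewrite ?nnegrE ?cmod_ge0 ?ltW.
apply/negP; rewrite -leNgt (le_trans h)// (le_trans (ler_wpM2l (ltW K0) (Np_partial_combB x mn)))//.
rewrite mulrA mulrC -ler_pdivlMr ?mulr_gt0//.
have := HN m Nm; have := lq_sum_ge n hx; move: (_ / (K * b)) => q; lra.
Qed.

Lemma series_comb_lim x (s d : R) : in_lq p (x : nat -> Cx R) -> s < 1 -> 0 < d ->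
  exists N, forall n, (N <= n)%N -> forall z : C, cmod z <= s ->
    cmod (partial_comb x n z - series_comb x z) <= d.
Proof.
move=> hx s1 d0.
have lim z : cmod z < 1 -> forall e : R, 0 < e -> exists N, forall n, (N <= n)%N ->
    cmod (partial_comb x n z - series_comb x z) <= e.
  move=> z1; rewrite /series_comb.
  have [l Hl] := @complex_cauchy_limit _ (fun n => partial_comb x n z) (fun e e0 =>
    let: ex_intro N HN := partial_comb_cauchy hx z1 e0 in
    ex_intro _ N (fun m n Nm Nn => HN m n Nm Nn z (lexx _))).
  by case: xgetP => [_ _ //|/(_ l)].
have [N HN] := partial_comb_cauchy hx s1 d0; exists N => n Nn z zs.
apply/ler_addgt0Pl => e e0; have [N' HN'] := lim z (le_lt_trans zs s1) e e0.
rewrite (le_trans (cmod_distD (partial_comb x (maxn N N') z) _ _))// addrC; apply: lerD.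
  by apply: HN'; exact: leq_maxr.
by apply: HN => //; exact: leq_maxl.
Qed.

Lemma series_comb_holo x : in_lq p (x : nat -> Cx R) -> disc_holo (series_comb x).
Proof.
move=> hx; apply: locally_uniform_limit_holo => s e s1 e0.
have [N HN] := series_comb_lim hx s1 e0.
by exists (partial_comb x N); [exact: (Hp_partial_comb x N).1|exact: HN].
Qed.

(** On a fixed circle the convergence is uniform, so the perturbation tends to 0 and only the factor
    [2 ^ p] of [Jp_perturb] is lost. *)
Lemma Jp_limit (g : nat -> C -> C) (F : C -> C) (r K : R) : (forall n, disc_holo (g n)) ->
  disc_holo F -> 0 <= r -> r < 1 ->
  (forall d, 0 < d -> exists N, forall n, (N <= n)%N -> forall z : C, cmod z <= r ->
    cmod (g n z - F z) <= d) ->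
  (exists N, forall n, (N <= n)%N -> Jp p (g n) r <= K) -> Jp p F r <= 2 `^ p * K.
Proof.
move=> hg hF r0 r1 H [N0 HN0]; have Q0 : 0 < 2 `^ p :> R by rewrite powR_gt0.
apply/ler_addgt0Pr => e e0.
have d0 : 0 < (e / 2 `^ p) `^ p^-1 by rewrite powR_gt0// divr_gt0.
have [N HN] := H _ d0.
rewrite (le_trans (Jp_perturb p0 (hg (maxn N N0)) hF r0 r1 (HN _ (leq_maxl _ _))))//.
rewrite -powRrM mulVf ?gt_eqF// powRr1; last by rewrite divr_ge0// ltW.
rewrite mulrDr [_ * (e / _)]mulrC divfK ?gt_eqF// lerD2r.
by apply: ler_wpM2l; [exact: ltW|apply: HN0; exact: leq_maxr].
Qed.

Lemma Hp_series_comb x : in_lq p (x : nat -> Cx R) ->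
  Hp p (series_comb x) /\ Np p (series_comb x) <= 2 `^ p * (b * lq_sum p x).
Proof.
move=> hx; have hT := series_comb_holo hx.
have J r : 0 <= r -> r < 1 -> Jp p (series_comb x) r <= 2 `^ p * (b * lq_sum p x).
  move=> r0 r1; apply: (Jp_limit (fun n => (Hp_partial_comb x n).1) hT r0 r1).
    by move=> d d0; exact: series_comb_lim.
  exists 0%N => n _; rewrite (le_trans (Jp_le_Np p0 (Hp_partial_comb x n) r0 r1))//.
  rewrite (le_trans (fab n x).2)//; apply: ler_wpM2l; first exact: ltW.
  exact: lq_sum_ge.
by split; [split => //; eexists; exact: J|exact: Np_le].
Qed.

(** Let [m] tend to infinity at fixed [n] in the Cauchy estimate, one circle at a time. *)
Lemma Np_series_comb_lim x e : in_lq p (x : nat -> Cx R) -> 0 < e ->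
  exists N, forall n, (N <= n)%N -> Np p (fun z => partial_comb x n z - series_comb x z) <= e.
Proof.
move=> hx e0; have Q0 : 0 < 2 `^ p :> R by rewrite powR_gt0.
have d0 : 0 < e / (2 `^ p * b) by rewrite divr_gt0// mulr_gt0.
have [N HN] := lq_sum_approx hx d0; exists N => n Nn.
have hT := series_comb_holo hx.
have hB : disc_holo (fun z => partial_comb x n z - series_comb x z).
  by move=> z z1; apply: holoB; [exact: (Hp_partial_comb x n).1|exact: hT].
apply: Np_le => // r r0 r1.
have -> : e = 2 `^ p * (e / 2 `^ p) by rewrite mulrC divfK// gt_eqF.
apply: (Jp_limit (g := fun m z => partial_comb x n z - partial_comb x m z)) => //.
- by move=> m; exact: (Hp_partial_combB x m n).1.
- move=> d dd0; have [N' HN'] := series_comb_lim hx r1 dd0; exists N' => m Nm z zr.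
  rewrite (_ : _ - _ = - (partial_comb x m z - series_comb x z)); last by ring.
  by rewrite cmodN; exact: HN'.
exists n => m nm.
rewrite (@eq_Jp _ p _ (fun z => -1 * (partial_comb x m z - partial_comb x n z)) r r0 r1); last first.
  by move=> z _; rewrite mulN1r opprB.
rewrite (JpZ _ p0 (Hp_partial_combB x n m).1 r0 r1) cmodN cmod1 powR1 mul1r.
rewrite (le_trans (Jp_le_Np p0 (Hp_partial_combB x n m) r0 r1))//.
rewrite (le_trans (Np_partial_combB x nm))// mulrC -ler_pdivlMr// -mulrA -invfM.
have := HN n Nn; have := lq_sum_ge m hx; move: (_ / (_ * b)) => q; lra.
Qed.

Lemma series_comb_lower x : in_lq p (x : nat -> Cx R) ->
  a * lq_sum p x <= 2 `^ p * Np p (series_comb x).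
Proof.
move=> hx; have Q0 : 0 < 2 `^ p :> R by rewrite powR_gt0.
have [hT _] := Hp_series_comb hx.
rewrite mulrC -ler_pdivlMr//; apply: lq_sum_le => n; rewrite ler_pdivlMr// mulrC.
apply/ler_addgt0Pr => e e0.
have [N HN] := Np_series_comb_lim hx (divr_gt0 e0 Q0).
pose m := maxn N n.
have hB := HpB p0 (Hp_partial_comb x m) hT.
apply: (@le_trans _ _ (Np p (partial_comb x m))).
  apply: le_trans (fab m x).1; apply: ler_wpM2l; first exact: ltW.
  by apply: lq_partial_mono; exact: leq_maxr.
rewrite (@eq_Np _ p _ (fun z => series_comb x z + (partial_comb x m z - series_comb x z))); last first.
  by move=> z _; rewrite addrC subrK.
rewrite (le_trans (NpD p0 hT hB))// mulrDr lerD2l.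
rewrite mulrC -ler_pdivlMr//; apply: HN; exact: leq_maxl.
Qed.

Lemma series_comb_linear (c : C) x y : in_lq p (x : nat -> Cx R) -> in_lq p (y : nat -> Cx R) ->
  forall z : C, cmod z < 1 ->
  series_comb (fun k => c * x k + y k) z = c * series_comb x z + series_comb y z.
Proof.
move=> hx hy z z1; have hxy := in_lqD c p0 hx hy.
apply/eqP; rewrite -subr_eq0 -cmod_eq0; apply/eqP/le_anti; rewrite cmod_ge0 andbT.
apply/ler_addgt0Pl => e e0; rewrite addr0.
have e3 : 0 < e / 3 by rewrite divr_gt0.
have c1 : 0 < cmod c + 1 by rewrite ltr_wpDl// cmod_ge0.
have [N1 H1] := series_comb_lim hx z1 (divr_gt0 e3 c1).
have [N2 H2] := series_comb_lim hy z1 e3.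
have [N3 H3] := series_comb_lim hxy z1 e3.
pose n := maxn N1 (maxn N2 N3).
have h1 := H1 n (leq_maxl _ _) z (lexx _).
have h2 := H2 n (leq_trans (leq_maxl _ _) (leq_maxr _ _)) z (lexx _).
have h3 := H3 n (leq_trans (leq_maxr _ _) (leq_maxr _ _)) z (lexx _).
have E : partial_comb (fun k => c * x k + y k) n z = c * partial_comb x n z + partial_comb y n z.
  rewrite /partial_comb mulr_sumr -big_split/=; apply: eq_bigr => k _.
  by rewrite mulrDl mulrA.
rewrite E in h3; move: h1 h2 h3; move: (partial_comb x n z) (partial_comb y n z) => X Y.
move: (series_comb x z) (series_comb y z) => T1 T2; move: (series_comb _ z) => T3 h1 h2 h3.
rewrite (_ : T3 - _ = c * (X - T1) + ((Y - T2) - (c * X + Y - T3))); last by ring.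
have h4 : cmod c * cmod (X - T1) <= e / 3.
  rewrite ler_pdivlMr// mulrC in h1; apply: le_trans h1; apply: ler_wpM2r; first exact: cmod_ge0.
  by rewrite lerDl.
have := cmodD (c * (X - T1)) ((Y - T2) - (c * X + Y - T3)); rewrite cmodM.
have := cmodD (Y - T2) (- (c * X + Y - T3)); rewrite cmodN.
lra.
Qed.
End Embedding.

(** * Comparison of powers, and choice of signs in [l^2] *)

Section PowersAndSigns.
Context {R : realType}.
Local Notation C := R[i].

Lemma mul_root (p c A : R) : 0 < p -> 0 <= c -> 0 <= A ->
  c * A `^ p^-1 = (c `^ p * A) `^ p^-1.
Proof.
by move=> p0 c0 A0; rewrite powRM ?powR_ge0// -powRrM divff ?gt_eqF// powRr1.
Qed.

Lemma ler_root (p A B : R) : 0 < p -> 0 <= A -> 0 <= B ->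
  (A `^ p^-1 <= B `^ p^-1) = (A <= B).
Proof.
move=> p0 A0 B0; have q0 : 0 < p^-1 by rewrite invr_gt0.
apply/idP/idP => [|AB]; last by apply: ge0_ler_powR => //; rewrite ?nnegrE// ltW.
by apply: contraTT; rewrite -!ltNge => BA; apply: gt0_ltr_powR.
Qed.

(** Dividing by [n ^ s] would bound [n ^ (t - s)], hence [n] itself. *)
Lemma powR_growth (al be s t : R) : 0 < al -> s < t ->
  ~ (forall n : nat, (0 < n)%N -> al * n%:R `^ t <= be * n%:R `^ s).
Proof.
move=> al0 st H; pose q := t - s; have q0 : 0 < q by rewrite subr_gt0.
have bd (n : nat) : (0 < n)%N -> n%:R <= (`|be| / al + 1) `^ q^-1.
  move=> n0; have nR : 0 < n%:R :> R by rewrite ltr0n.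
  have b0 : 0 <= `|be| / al + 1 by rewrite addr_ge0// divr_ge0// ltW.
  have -> : n%:R = (n%:R `^ q) `^ q^-1 :> R by rewrite -powRrM divff ?gt_eqF// powRr1// ltW.
  rewrite ler_root ?powR_ge0//.
  apply: (@le_trans _ _ (`|be| / al)); last by rewrite lerDl.
  rewrite ler_pdivlMr// mulrC; apply: le_trans (ler_norm be).
  have ns0 : 0 < n%:R `^ s :> R by rewrite powR_gt0.
  rewrite -(ler_pM2r ns0) -mulrA -powRD; last by rewrite (gt_eqF nR) implybT.
  by rewrite subrK; exact: H.
have := archi_boundP (powR_ge0 (`|be| / al + 1) q^-1).
have := bd (Num.bound ((`|be| / al + 1) `^ q^-1)).+1 isT; rewrite -natr1.
move: (_ `^ _) (Num.Def.archi_bound _)%:R => y x; lra.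
Qed.

Lemma lq_sum_cvg (q : R) (x : nat -> C) : in_lq q (x : nat -> Cx R) ->
  (fun n => \sum_(k < n) cmod (x k) `^ q) @ \oo --> lq_sum q x.
Proof.
move=> hx; apply/cvgrPdist_le => e e0; have [N HN] := lq_sum_approx hx e0.
exists N => // n /= Nn; rewrite ger0_norm ?subr_ge0 ?lq_sum_ge//.
by rewrite lerBlDr addrC -lerBlDr; exact: HN.
Qed.

(** The coefficients [1] and [-1] stay explicit to match the form [a * x + y] of linearity and of
    [row_combS]. The pointwise identity passes to the limit of the partial sums. *)
Lemma lq_sum2_parallelogram (x y : nat -> C) :
  in_lq 2 (x : nat -> Cx R) -> in_lq 2 (y : nat -> Cx R) ->
  lq_sum 2 (fun k => 1 * x k + y k) + lq_sum 2 (fun k => -1 * x k + y k) =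
  2 * (lq_sum 2 x + lq_sum 2 y).
Proof.
move=> hx hy; have h2 : 0 <= 2 :> R by [].
have hp := in_lqD 1 h2 hx hy; have hm := in_lqD (-1) h2 hx hy.
have pw (z w : C) : cmod (1 * z + w) `^ 2 + cmod (-1 * z + w) `^ 2 =
    2 * (cmod z `^ 2 + cmod w `^ 2).
  rewrite mul1r mulN1r !(powR_mulrn 2) ?cmod_ge0// !sqr_cmod !cReD !cImD !cReN !cImN; ring.
have ps n : \sum_(k < n) cmod (1 * x k + y k) `^ 2 + \sum_(k < n) cmod (-1 * x k + y k) `^ 2 =
    2 * (\sum_(k < n) cmod (x k) `^ 2 + \sum_(k < n) cmod (y k) `^ 2).
  by rewrite -!big_split/= mulr_sumr; apply: eq_bigr => k _; exact: pw.
pose Z n : R := 2 * (\sum_(k < n) cmod (x k) `^ 2 + \sum_(k < n) cmod (y k) `^ 2).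
have h : Z @ \oo --> lq_sum 2 (fun k => 1 * x k + y k) + lq_sum 2 (fun k => -1 * x k + y k).
  by rewrite /Z; under eq_fun => n do rewrite -(ps n); apply: cvgD; exact: lq_sum_cvg.
have h' : Z @ \oo --> 2 * (lq_sum 2 x + lq_sum 2 y).
  by apply: cvgMl_tmp; apply: cvgD; exact: lq_sum_cvg.
exact: (cvg_unique (@norm_hausdorff R R) h h').
Qed.

Definition row_comb (c : nat -> C) (x : nat -> nat -> C) n (j : nat) : C :=
  \sum_(k < n) c k * x k j.

Lemma row_combS c x n : row_comb c x n.+1 = (fun j => c n * x n j + row_comb c x n j).
Proof. by apply/funext => j; rewrite /row_comb big_ord_recr/= addrC. Qed.

Lemma in_lq_row_comb q c x n : 0 < q -> (forall k, in_lq q (x k : nat -> Cx R)) ->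
  in_lq q (row_comb c x n : nat -> Cx R).
Proof.
move=> q0 hx; elim: n => [|n IH].
  rewrite (_ : row_comb c x 0 = fun=> 0); first exact: in_lq0.
  by apply/funext => j; rewrite /row_comb big_ord0.
by rewrite row_combS; apply: in_lqD => //; exact: ltW.
Qed.

(* [s] is applied with both signs, to make the norm of the sum small or large. *)
Lemma sign_choice (s : R) (x : nat -> nat -> C) n : (forall k, in_lq 2 (x k : nat -> Cx R)) ->
  exists c : nat -> C, (forall k, cmod (c k) = 1) /\
    s * lq_sum 2 (row_comb c x n) <= s * \sum_(k < n) lq_sum 2 (x k).
Proof.
have arith (a b d e g : R) : a + b = 2 * (d + e) -> g + s * d <= s * a -> s * e <= g ->
    s * b <= g + s * d.
  move=> h; have -> : b = 2 * (d + e) - a by lra.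
  rewrite mulrBr [s * (2 * _)]mulrCA [s * (d + e)]mulrDr.
  move: (s * a) (s * d) (s * e) => *; lra.
move=> hx; elim: n => [|n [c [c1 IH]]].
  exists (fun=> 1); split=> [k|]; first exact: cmod1.
  rewrite big_ord0; suff -> : lq_sum 2 (row_comb (fun=> 1) x 0) = 0 :> R by [].
  apply/le_anti; rewrite lq_sum_ge0 andbT; apply: lq_sum_le => n.
  by rewrite big1// => k _; rewrite /row_comb big_ord0 cmod0 powR0.
have h2 : 0 < 2 :> R by [].
have hy := in_lq_row_comb c n h2 hx.
have par := lq_sum2_parallelogram (hx n) hy.
pose c' (d : C) k := if k == n then d else c k.
have E d : row_comb (c' d) x n.+1 = (fun j => d * x n j + row_comb c x n j).
  rewrite row_combS /c' eqxx; apply/funext => j; congr (_ + _); apply: eq_bigr => k _.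
  by rewrite ltn_eqF.
have C1 d : cmod d = 1 -> forall k, cmod (c' d k) = 1.
  by move=> d1 k; rewrite /c'; case: ifP.
rewrite big_ord_recr/= mulrDr.
(* If the sign [+1] misses the bound, the parallelogram law forces [-1] to satisfy it. *)
have /orP[h|h] := le_total (s * lq_sum 2 (row_comb (c' 1) x n.+1))
  (s * (\sum_(i < n) lq_sum 2 (x i)) + s * lq_sum 2 (x n)).
  by exists (c' 1); split => //; apply: C1; exact: cmod1.
exists (c' (-1)); split; first by apply: C1; rewrite cmodN cmod1.
rewrite E in h; rewrite E; exact: (arith _ _ _ _ _ par h IH).
Qed.
End PowersAndSigns.

(** * Copies of [l^p] and of [l^2] *)

Section FixedCopies.
Context {R : realType}.
Local Notation C := R[i].
Local Notation mu := (@lebesgue_measure R).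
Variables (p : R) (u phi : C -> C).
Hypotheses (p1 : 1 <= p) (hphi : disc_holo phi).
Hypothesis phi1 : forall z : C, cmod z < 1 -> cmod (phi z) < 1.
Hypothesis nc : mu.-negligible (contact_set (phi : Cx R -> Cx R)).
Hypothesis bW : wcomp_bounded p (u : Cx R -> Cx R) phi.
Local Notation W f := (wcomp (u : Cx R -> Cx R) phi f : C -> C).

Let p00 : 0 < p := lt_le_trans ltr01 p1.
Let p0 : 0 <= p := ltW p00.

(** Stated for linear subspaces, so as to apply both to a closed [M] and to the range of an
    embedding of [l^2]. Bounds for norms are raised to the power [p], with [|K| + 1] as a positive
    operator bound. *)
Lemma wcomp_sequence (M : set (C -> C)) : (forall f, M f -> Hp p f) -> lin_closed M ->
  infinite_dim (M : set (Cx R -> Cx R)) ->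
  bounded_below_on p (u : Cx R -> Cx R) phi (M : set (Cx R -> Cx R)) ->
  exists f : nat -> C -> C, (forall k, M (f k)) /\
  exists2 a, 0 < a & exists2 b, 0 < b & forall n (x : nat -> C),
  let S := \sum_(k < n) cmod (x k) `^ p in let F z := \sum_(k < n) x k * f k z in
  a * S <= Np p F /\ Np p F <= b * S.
Proof.
move=> MH ML iM [c [c0 Hc]]; have [K HK] := bW.
have Wb f : Hp p f -> Hp p (W f) /\ Np p (W f) <= (`|K| + 1) `^ p * Np p f.
  move=> hf; have /HK[/(in_HpP _ p0) hW h] : in_Hp p (f : Cx R -> Cx R) by exact/in_HpP.
  split => //; move: h; rewrite !Hp_normE => h.
  rewrite -(ler_root p00) ?Np_ge0// ?mulr_ge0 ?powR_ge0 ?Np_ge0//.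
  rewrite -mul_root ?Np_ge0 ?addr_ge0//; apply: (le_trans h).
  apply: ler_wpM2r; first exact: powR_ge0.
  by apply: (le_trans (ler_norm K)); rewrite lerDl.
(* The multiplier is the image of the constant function 1. *)
have hu : Hp p u.
  have [+ _] := Wb _ (Hp_cst 1 p0); apply: eq_Hp => z _.
  by rewrite /wcomp mulr1.
have Wc f : M f -> c `^ p * Np p f <= Np p (W f).
  move=> Mf; have hf := MH f Mf; have [hW _] := Wb f hf.
  have := Hc _ Mf; rewrite !Hp_normE mul_root ?Np_ge0 ?(ltW c0)//.
  by rewrite ler_root// ?mulr_ge0 ?powR_ge0 ?Np_ge0.
apply: (almost_disjoint_sequence p1 hu hphi phi1 nc MH ML iM _ _ Wb Wc); rewrite powR_gt0// ltr_wpDl.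
Qed.

(** The linear structure of [M] yields the sequence [f], its closedness keeps the infinite
    combinations inside, and the lower bound on the range is inherited from [M]. *)
Lemma lp_copy (M : set (Cx R -> Cx R)) : closed_subspace_Hp p M -> infinite_dim M ->
  bounded_below_on p (u : Cx R -> Cx R) phi M -> exists T : (nat -> Cx R) -> (Cx R -> Cx R),
    lq_embedding_into p p M T /\ bounded_below_on p (u : Cx R -> Cx R) phi (lq_range p T).
Proof.
move=> [MH [M0 [ML Mcl]]] iM bM.
have MH' f : M f -> Hp p f by move=> /MH/(in_HpP _ p0).
have [f [Mf [a a0 [b b0 fab]]]] := wcomp_sequence MH' (conj M0 ML) iM bM.
have hf k := MH' _ (Mf k).
have MT x : in_lq p x -> M (series_comb f x).
  move=> hx; have [hT _] := Hp_series_comb p1 hf b0 fab hx.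
  apply: (Mcl (partial_comb f x)); [|exact/in_HpP|].
    by move=> n; exact: (lin_closed_sum _ (fun k : 'I_n => x k) (conj M0 ML) (fun k => Mf k)).
  apply/cvgrPdist_le => e e0; have ep : 0 < e `^ p by rewrite powR_gt0.
  have [N HN] := Np_series_comb_lim p1 hf b0 fab hx ep.
  exists N => // n /= Nn; rewrite sub0r normrN Hp_normE ger0_norm ?powR_ge0//.
  have -> : e = (e `^ p) `^ p^-1 by rewrite -powRrM divff ?gt_eqF// powRr1// ltW.
  have N0 := Np_ge0 p0 (HpB p0 (Hp_partial_comb p1 hf x n) hT).
  by rewrite (ler_root p00 N0 (ltW ep)); exact: HN.
exists (series_comb f); split; last first.
  have [c [c0 Hc]] := bM; exists c; split => // _ [x hx <-]; apply: Hc; exact: MT.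
split; [exact: MT|split].
  by move=> c x y hx hy z z1; exact: (series_comb_linear p1 hf b0 fab c hx hy z1).
have Q0 : 0 < 2 `^ p :> R by rewrite powR_gt0.
exists ((a / 2 `^ p) `^ p^-1), ((2 `^ p * b) `^ p^-1).
split; first by rewrite powR_gt0// divr_gt0.
split; first by rewrite powR_gt0// mulr_gt0.
move=> x hx; have [hT T1] := Hp_series_comb p1 hf b0 fab hx.
have T2 := series_comb_lower p1 hf a0 b0 fab hx.
have Ep (c : R) : 0 < c -> (c `^ p^-1) `^ p = c.
  by move=> c0; rewrite -powRrM mulVf ?gt_eqF// powRr1// ltW.
have s0 := lq_sum_ge0 p x; have N0 := Np_ge0 p0 hT.
rewrite lq_normE Hp_normE !mul_root ?powR_ge0// !Ep ?divr_gt0 ?mulr_gt0//.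
rewrite !ler_root ?mulr_ge0 ?divr_ge0 ?(ltW a0) ?(ltW b0) ?(ltW Q0)//.
apply/andP; split; last by rewrite -mulrA.
by rewrite mulrAC ler_pdivrMr// mulrC [_ * 2 `^ p]mulrC; move: T2; rewrite mulrC.
Qed.

Section no_hilbert_copy.
Variable T : (nat -> C) -> C -> C.
Hypothesis eT : lq_embedding_into 2 p (in_Hp p : set (Cx R -> Cx R)) (T : (nat -> Cx R) -> (Cx R -> Cx R)).
Hypothesis bT : bounded_below_on p (u : Cx R -> Cx R) phi (lq_range 2 (T : (nat -> Cx R) -> (Cx R -> Cx R))).

Let h2 : 0 < 2 :> R. Proof. by []. Qed.

Lemma embedding0 z : cmod z < 1 -> T (fun=> 0) z = 0.
Proof.
move=> z1; have h := in_lq0 h2.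
have := eT.2.1 (-1) _ _ h h z z1.
rewrite (_ : (fun k : nat => -1 * 0 + 0) = fun=> 0); last first.
  by apply/funext => k; rewrite mulr0 addr0.
by move=> ->; rewrite mulN1r addNr.
Qed.

Lemma embedding_row_comb c x n : (forall k, in_lq 2 (x k : nat -> Cx R)) ->
  forall z, cmod z < 1 -> T (row_comb c x n) z = \sum_(k < n) c k * T (x k) z.
Proof.
move=> hx z z1; elim: n => [|n IH].
  rewrite (_ : row_comb c x 0 = fun=> 0); last by apply/funext => j; rewrite /row_comb big_ord0.
  by rewrite embedding0// big_ord0.
rewrite row_combS big_ord_recr/= addrC -IH.
exact: (eT.2.1 (c n) _ _ (hx n) (in_lq_row_comb c n h2 hx) z z1).
Qed.

(** The range of [T] saturated under equality on the disc: [T] is linear only up to that equality,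
    whereas [lin_closed] asks for membership of the combinations themselves. *)
Let M : set (C -> C) := [set f | exists2 x : nat -> C, in_lq 2 (x : nat -> Cx R) &
  forall z, cmod z < 1 -> f z = T x z].

Let HpT x : in_lq 2 (x : nat -> Cx R) -> Hp p (T x).
Proof. by move=> hx; apply/(in_HpP _ p0); exact: eT.1. Qed.

Lemma embedding_span_infinite : infinite_dim (M : set (Cx R -> Cx R)).
Proof.
have [a [b [a0 [b0 Hab]]]] := eT.2.2.
pose d (i k : nat) : C := (k == i)%:R.
have hd i : in_lq 2 (d i : nat -> Cx R) by exact: in_lq_delta.
move=> n; exists (fun i => T (d i)); split; first by move=> i; exists (d i).
move=> c c0 i.
(* Coefficients indexed by ordinals are extended by 0 to a sequence, as [row_comb] expects. *)
pose c' k : C := if insub k is Some j then c j else 0.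
have c'E (j : 'I_n) : c' j = c j by rewrite /c' valK.
have hy := in_lq_row_comb c' n h2 hd.
have y0 z : cmod z < 1 -> T (row_comb c' d n) z = 0.
  move=> z1; rewrite embedding_row_comb// -[RHS](c0 z z1).
  by apply: eq_bigr => k _; rewrite c'E.
have /andP[+ _] := Hab _ hy; rewrite lq_normE Hp_normE.
have -> : Np p (T (row_comb c' d n)) = 0.
  rewrite (eq_Np p (g := fun=> 0) y0); apply/le_anti; rewrite Np_ge0 ?andbT//; last exact: Hp_cst.
  apply: Np_le => //; first exact: (Hp_cst 0 p0).1.
  move=> r r0 r1; rewrite /Jp (eq_mean (g := fun=> 0)) ?(mean_cst (R := R))//.
  by move=> t; rewrite cmod0 powR0// gt_eqF.
rewrite powR0 ?invr_eq0 ?gt_eqF// pmulr_rle0// => s0.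
have z0 : lq_sum 2 (row_comb c' d n) = 0.
  apply: (@powR_eq0_eq0 _ _ 2^-1); apply/le_anti; rewrite s0; exact: powR_ge0.
have := lq_coord0 i hy z0; rewrite /row_comb (bigD1 i)//= big1 ?addr0.
  by rewrite /d eqxx mulr1 c'E.
by move=> k ki; rewrite /d val_eqE eq_sym (negbTE ki) mulr0.
Qed.

Lemma no_hilbert_embedding : p = 2.
Proof.
have [a [b [a0 [b0 Hab]]]] := eT.2.2.
have MH f : M f -> Hp p f by move=> [x hx fx]; apply: (eq_Hp _ (HpT hx)) => z /fx ->.
have ML : lin_closed M.
  split; first by exists (fun=> 0); [exact: in_lq0|move=> z z1; rewrite embedding0].
  move=> c f g [x hx fx] [y hy gy]; exists (fun k => c * x k + y k).
    by apply: in_lqD.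
  by move=> z z1; rewrite fx// gy//; apply/esym; exact: (eT.2.1 c _ _ hx hy z z1).
have bM : bounded_below_on p (u : Cx R -> Cx R) phi (M : set (Cx R -> Cx R)).
  have [c [c0 Hc]] := bT; exists c; split => // f [x hx fx].
  have := Hc (T x); rewrite !Hp_normE (eq_Np p fx).
  rewrite (@eq_Np _ p (wcomp (u : Cx R -> Cx R) phi f) (wcomp (u : Cx R -> Cx R) phi (T x))).
    by apply; exists x.
  by move=> z z1; rewrite /wcomp fx//; exact: phi1.
have [f [Mf [al al0 [be be0 fab]]]] := wcomp_sequence MH ML embedding_span_infinite bM.
have /choice[x Hx] : forall k, exists x : nat -> C, in_lq 2 (x : nat -> Cx R) /\
    forall z, cmod z < 1 -> f k z = T x z by move=> k; have [x] := Mf k; exists x.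
have hx k := (Hx k).1.
(* The norm [E ^ (1/2)] is rewritten as [(E ^ (p/2)) ^ (1/p)], so that the embedding inequalities
   compare two [p]-th roots. *)
have norm_comb c n : let E := lq_sum 2 (row_comb c x n) in
    let N := Np p (fun z => \sum_(k < n) c k * f k z) in
    a `^ p * E `^ (p / 2) <= N /\ N <= b `^ p * E `^ (p / 2).
  move=> E N; have hy := in_lq_row_comb c n h2 hx.
  have E0 : 0 <= E := lq_sum_ge0 _ _.
  have NE : N = Np p (T (row_comb c x n)).
    apply: eq_Np => z z1; rewrite embedding_row_comb//; apply: eq_bigr => k _.
    by rewrite (Hx k).2.
  have Ep : E `^ 2^-1 = (E `^ (p / 2)) `^ p^-1.
    by rewrite -powRrM mulrAC (divff (lt0r_neq0 p00)) mul1r.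
  have N0 : 0 <= N by rewrite NE; exact/Np_ge0/HpT.
  have /andP[] := Hab _ hy; rewrite lq_normE Hp_normE -/E -NE Ep.
  have Y0 : 0 <= E `^ (p / 2) := powR_ge0 _ _.
  rewrite (mul_root p00 (ltW a0) Y0) (mul_root p00 (ltW b0) Y0).
  rewrite (ler_root p00 (mulr_ge0 (powR_ge0 a p) Y0) N0).
  rewrite (ler_root p00 N0 (mulr_ge0 (powR_ge0 b p) Y0)) => l1 l2.
  exact: conj l1 l2.
(* Coefficients supported at [k] turn the two estimates for combinations into bounds on a single
   [x k], uniform in [k]. *)
have one k : al <= b `^ p * lq_sum 2 (x k) `^ (p / 2) /\
    a `^ p * lq_sum 2 (x k) `^ (p / 2) <= be.
  pose d j : C := (j == k)%:R.
  have dk (V : C -> C) (v : nat -> C) : \sum_(j < k.+1) d j * v j = v k.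
    rewrite big_ord_recr/= /d eqxx mul1r big1 ?add0r// => j _.
    by rewrite ltn_eqF// mul0r.
  have [] := norm_comb d k.+1; have [] := fab k.+1 d.
  have -> : row_comb d x k.+1 = x k by apply/funext => j; exact: (dk id (fun i => x i j)).
  have -> : \sum_(j < k.+1) cmod (d j) `^ p = 1.
    rewrite big_ord_recr/= /d eqxx cmod1 powR1 big1 ?add0r// => j _.
    by rewrite ltn_eqF// cmod0 powR0// gt_eqF.
  rewrite !mulr1; move: (Np _ _) => N h3 h4 h5 h6.
  by split; [exact: le_trans h6|exact: le_trans h4].
have p20 : 0 < p / 2 by rewrite divr_gt0.
have ap : 0 < a `^ p by rewrite powR_gt0.
have bp : 0 < b `^ p by rewrite powR_gt0.
have constS n (e : R) : e * n%:R = \sum_(k < n) e by rewrite sumr_const card_ord mulr_natr.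
have sgn s n := sign_choice s n hx.
have mono (A B : R) : 0 <= A -> A <= B -> A `^ (p / 2) <= B `^ (p / 2).
  by move=> A0 AB; apply: (ge0_ler_powR (ltW p20)); rewrite ?nnegrE// (le_trans A0).
have nS (c : nat -> C) n : (forall k, cmod (c k) = 1) -> \sum_(k < n) cmod (c k) `^ p = n%:R.
  move=> c1; under eq_bigr do rewrite c1 powR1.
  by rewrite sumr_const card_ord.
have root (A B : R) : 0 <= A -> 0 <= B -> (A <= B `^ (p / 2) -> A `^ (2 / p) <= B) /\
    (B `^ (p / 2) <= A -> B <= A `^ (2 / p)).
  move=> A0 B0; have -> : 2 / p = (p / 2)^-1 by rewrite invf_div.
  have BE : B = (B `^ (p / 2)) `^ (p / 2)^-1 by rewrite -powRrM divff ?gt_eqF// powRr1.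
  by split => h; rewrite [X in _ <= X]BE || rewrite BE; rewrite ler_root ?powR_ge0.
have up k : lq_sum 2 (x k) <= (be / a `^ p) `^ (2 / p).
  apply: (root _ _ _ _).2; [by rewrite divr_ge0// ltW|exact: lq_sum_ge0|].
  by rewrite ler_pdivlMr// mulrC; exact: (one k).2.
have low k : (al / b `^ p) `^ (2 / p) <= lq_sum 2 (x k).
  apply: (root _ _ _ _).1; [by rewrite divr_ge0// ltW|exact: lq_sum_ge0|].
  by rewrite ler_pdivrMr// mulrC; exact: (one k).1.
move: up low; set e2 := (be / _) `^ _; set e1 := (al / _) `^ _ => up low.
have e10 : 0 < e1 by rewrite powR_gt0// divr_gt0.
have e20 : 0 <= e2 := powR_ge0 _ _.
apply/le_anti/andP; split; rewrite leNgt; apply/negP => pl.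
  (* For [p > 2], signs making the [l^2] norm large force a quantity of order [n ^ (p/2)] below a
     multiple of [n]. *)
  have ts : 1 < p / 2 by rewrite ltr_pdivlMr// mul1r.
  apply: (@powR_growth _ (a `^ p * e1 `^ (p / 2)) be 1 (p / 2)) => //.
    by rewrite mulr_gt0// powR_gt0.
  move=> n n0; have [c [c1 Hc]] := sgn (-1) n; rewrite !mulN1r lerN2 in Hc.
  have [h1 _] := norm_comb c n; have [_ h3] := fab n c; rewrite nS// in h3.
  rewrite powRr1//; apply: le_trans h3; apply: le_trans h1.
  rewrite -mulrA; apply: ler_wpM2l; first exact: ltW.
  rewrite -(powRM (p / 2) (ltW e10) (ler0n R n)); apply: mono.
    exact: (mulr_ge0 (ltW e10) (ler0n R n)).
  apply: le_trans Hc; rewrite constS.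
  by apply: ler_sum => k _; exact: low.
(* For [p < 2], signs making the [l^2] norm small force a multiple of [n] below a quantity of order
   [n ^ (p/2)]. *)
have ts : p / 2 < 1 by rewrite ltr_pdivrMr// mul1r.
apply: (@powR_growth _ al (b `^ p * e2 `^ (p / 2)) (p / 2) 1) => //.
move=> n n0; have [c [c1 Hc]] := sgn 1 n; rewrite !mul1r in Hc.
have [_ h1] := norm_comb c n; have [h3 _] := fab n c; rewrite nS// in h3.
rewrite powRr1//; apply: (le_trans h3); apply: (le_trans h1).
rewrite -mulrA; apply: ler_wpM2l; first exact: ltW.
rewrite -(powRM (p / 2) e20 (ler0n R n)); apply: (mono _ _ (lq_sum_ge0 _ _)).
apply: (le_trans Hc); rewrite constS.
by apply: ler_sum => k _; exact: up.
Qed.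
End no_hilbert_copy.
End FixedCopies.

Unset Implicit Arguments.

Theorem theorem1p3 (R : realType) (p : R) (u phi : Cx R -> Cx R) :
  1 <= p ->
  analytic_on_disc u ->
  analytic_on_disc phi ->
  (forall z, in_disc z -> in_disc (phi z)) ->
  wcomp_bounded p u phi ->
  (@lebesgue_measure R).-negligible (contact_set phi) ->
  (forall M : set (Cx R -> Cx R),
     closed_subspace_Hp p M -> infinite_dim M ->
     bounded_below_on p u phi M ->
     exists T : (nat -> Cx R) -> (Cx R -> Cx R),
       lq_embedding_into p p M T /\
       bounded_below_on p u phi (lq_range p T)) /\
  (p != 2 ->
   ~ exists T : (nat -> Cx R) -> (Cx R -> Cx R),
       lq_embedding_into 2 p (in_Hp p) T /\
       bounded_below_on p u phi (lq_range 2 T)).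
Proof.
move=> p1 _ /analytic_disc_holo hphi phi1 bW nc; split.
  by move=> M cM iM bM; exact: (lp_copy p1 hphi phi1 nc bW cM iM bM).
move=> p2 [T [eT bT]]; move/eqP: p2; apply.
exact: (no_hilbert_embedding p1 hphi phi1 nc bW eT bT).
Qed.
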